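(* Let $N\ge1$, $1\le p<\infty$, $\omega\in C^+_{\mathrm{inc}}$, and $\Omega\in C_{\mathrm{inc}}$ such that $m_1t^p\le\Omega(t)\le m_2t^p$ for all $t\ge0$ and some constants $0<m_1\le m_2$. Let $(\rho_\varepsilon)_{\varepsilon>0}\subset L^1(\mathbb{R}^N)$ be a family of radial mollifiers of the form $\rho_\varepsilon(h)=\varepsilon^{-N}\rho(h/\varepsilon)$ for some $\rho\in L^1(\mathbb{R}^N)$. Then for $f\in L^p(\mathbb{R}^N)$ the following are equivalent: (i) $f\in W^{1,p}(\mathbb{R}^N)$ if $p>1$, resp. $f\in BV(\mathbb{R}^N)$ if $p=1$; (ii) $\displaystyle\limsup_{\varepsilon\downarrow0}\int_{\mathbb{R}^N}\rho_\varepsilon(h)\,\omega\!\left(\int_{\mathbb{R}^N}\Omega\!\left(\frac{|f(x+h)-f(x)|}{|h|}\right)\mathrm{d}x\right)\mathrm{d}h<\infty$. Moreover, there are constants $0<c\le C$ independent of $f$ such that \[c\,\omega\big(\|\nabla f\|^p_{L^p(\mathbb{R}^N)}\big)\le \limsup_{\varepsilon\downarrow0}\int_{\mathbb{R}^N}\rho_\varepsilon(h)\,\omega\!\left(\int_{\mathbb{R}^N}\Omega\!\left(\frac{|f(x+h)-f(x)|}{|h|}\right)\mathrm{d}x\right)\mathrm{d}h\le C\,\omega\big(\|\nabla f\|^p_{L^p(\mathbb{R}^N)}\big),\] where for $p=1$, $\|\nabla f\|_{L^1}$ denotes the total variation $[f]_{BV}$ of $f$ (taken to be $+\infty$ if $f\notin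 BV$, and similarly $\|\nabla f\|_{L^p}=+\infty$ if $f\notin W^{1,p}$).
   Context: Mollifiers: $\rho_\varepsilon\ge0$, $\int\rho_\varepsilon=1$, and $\lim_{\varepsilon\downarrow0}\int_{|z|\ge\delta}\rho_\varepsilon=0$ for all $\delta>0$. $C_{\mathrm{inc}}$ is the set of continuous increasing $\omega:[0,\infty)\to[0,\infty)$ with $\omega(0)=0$ and $\lim_{t\to\infty}\omega(t)=\infty$; $C^+_{\mathrm{inc}}$ is the set of $\omega\in C_{\mathrm{inc}}$ that are roughly subadditive: there is $A>0$ with $\omega(t_1+t_2)\le A(\omega(t_1)+\omega(t_2))$ for all $t_1,t_2\ge0$. Convention $\omega(+\infty)=+\infty$. $[f]_{BV}=\sup\{\int f\,\mathrm{div}\phi:\phi\in C^1_c(\mathbb{R}^N;\mathbb{R}^N),\|\phi\|_\infty\le1\}$. *)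

(* Defs.v *)
From HB Require Import structures.
From mathcomp Require Import all_boot all_order all_algebra.
From mathcomp Require Import all_classical all_reals all_analysis.
Set Implicit Arguments. Unset Strict Implicit. Unset Printing Implicit Defensive.
Import Order.TTheory GRing.Theory Num.Theory.
Import numFieldNormedType.Exports.
Local Open Scope classical_set_scope.
Local Open Scope ring_scope.

Section Defs.
Variables (R : realType) (N : nat).

Definition RN := g_sigma_algebraType (@open 'rV[R]_N).

Definition enorm (h : 'rV[R]_N) : R := Num.sqrt (\sum_(i < N) (h ord0 i) ^+ 2).

Definition evec (i : 'I_N) : 'rV[R]_N := delta_mx ord0 i.

Definition is_lebesgue_RN (mu : {measure set RN -> \bar R}) : Prop :=
  forall a b : 'rV[R]_N, (forall i, a ord0 i <= b ord0 i) ->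
    mu [set x : RN | forall i, a ord0 i <= (x : 'rV[R]_N) ord0 i <= b ord0 i]
    = (\prod_(i < N) (b ord0 i - a ord0 i))%:E.

Definition Lp (mu : {measure set RN -> \bar R}) (p : R) (f : 'rV[R]_N -> R) : Prop :=
  measurable_fun [set: RN] (f : RN -> R) /\
  (\int[mu]_x ((`|f x| `^ p)%:E) < +oo)%E.

Definition C1c (phi : 'rV[R]_N -> R) : Prop :=
  continuous phi /\
  (forall i x, derivable phi x (evec i)) /\
  (forall i, continuous (fun x => 'D_(evec i) phi x)) /\
  compact (closure [set x | phi x != 0]).

Definition weak_gradient (mu : {measure set RN -> \bar R}) (p : R)
  (f : 'rV[R]_N -> R) (g : 'I_N -> 'rV[R]_N -> R) : Prop :=
  (forall i, Lp mu p (g i)) /\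
  forall phi, C1c phi -> forall i,
    (\int[mu]_x ((f x * 'D_(evec i) phi x)%:E)
     = - \int[mu]_x ((g i x * phi x)%:E))%E.

Definition inW1p mu p f : Prop := exists g, weak_gradient mu p f g.

Definition BV_seminorm (mu : {measure set RN -> \bar R}) (f : 'rV[R]_N -> R) : \bar R :=
  ereal_sup [set (\int[mu]_x ((f x * \sum_(i < N) 'D_(evec i) (phi i) x)%:E))%E
            | phi in [set phi : 'I_N -> 'rV[R]_N -> R |
                 (forall i, C1c (phi i)) /\
                 forall x, enorm (\row_i phi i x) <= 1]].

Definition inBV mu f : Prop := (BV_seminorm mu f < +oo)%E.

(* ||grad f||_{L^p}^p, equal to +oo if f is not in W^{1,p} (p > 1);
   for p = 1 it is [f]_BV (+oo if f is not in BV) *)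
Definition grad_norm_p (mu : {measure set RN -> \bar R}) (p : R) (f : 'rV[R]_N -> R)
  : \bar R :=
  if p == 1 then BV_seminorm mu f
  else ereal_inf [set (\int[mu]_x (((enorm (\row_i g i x)) `^ p)%:E))%E
                 | g in [set g | weak_gradient mu p f g]].

Definition cond_i mu p f : Prop := if p == 1 then inBV mu f else inW1p mu p f.

End Defs.

Definition extE (R : realType) (w : R -> R) (x : \bar R) : \bar R :=
  match x with
  | EFin r => (w r)%:E
  | _ => +oo%E
  end.

Definition C_inc (R : realType) (w : R -> R) : Prop :=
  {within `[0, +oo[%classic, continuous w} /\
  {in `[0, +oo[ &, {homo w : s t / s <= t}} /\
  (forall t, 0 <= t -> 0 <= w t) /\
  w 0 = 0 /\
  w @ +oo --> +oo.

Definition C_inc_plus (R : realType) (w : R -> R) : Prop :=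
  C_inc w /\ exists A : R, 0 < A /\
    forall t1 t2, 0 <= t1 -> 0 <= t2 -> w (t1 + t2) <= A * (w t1 + w t2).

Definition limsup0 (R : realType) (F : R -> \bar R) : \bar R :=
  ereal_inf [set ereal_sup [set F e | e in `]0, d[%classic] | d in `]0, +oo[%classic].

Definition BBM_quantity (R : realType) (N : nat) (mu : {measure set RN R N -> \bar R})
  (rho : 'rV[R]_N -> R) (w W : R -> R) (f : 'rV[R]_N -> R) : \bar R :=
  limsup0 (fun eps : R =>
    (\int[mu]_h (((eps ^- N) * rho (eps^-1 *: (h : 'rV[R]_N)))%:E *
       extE w (\int[mu]_x
          ((W (`|f ((x : 'rV[R]_N) + (h : 'rV[R]_N)) - f x| / enorm h))%:E))%E))%E).

(* Main.v *)
(* For D(h) = \int |f(x+h) - f(x)|^p dx, the growth of Omega makes the inner integral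
   comparable to D(h)/|h|^p. If G = ||grad f||_p^p then D(h) <= C |h|^p G, by duality with
   test functions, and the upper bound follows since rho_eps has mass one.

   Conversely, if the functional stays below S for small eps and w(m1 T) exceeds a multiple
   of S, then the points z with D(eps z) <= T |eps z|^p carry nearly all the mass of rho.
   By a Steinhaus argument two of them differ by s_i e_i with s_i independent of eps, and
   quasi-subadditivity of D yields D(t e_i) <= C T t^p for all small t. A limit of
   difference quotients then gives G <= C T; for p > 1 the weak gradient is an L^p limit of
   almost minimal elements of the convex sets approximating it. Taking T = G / (2 C) bounds
   w(G / C') by a multiple of S, and the rough subadditivity of w absorbs the constant. *)

Require Import Defs.
From HB Require Import structures.
From mathcomp Require Import all_boot all_order all_algebra.
From mathcomp Require Import all_classical all_reals all_analysis.
From mathcomp Require Import measurable_realfun.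
Import Order.TTheory GRing.Theory Num.Theory.
Import numFieldNormedType.Exports.
Local Open Scope classical_set_scope.
Local Open Scope ring_scope.
From mathcomp Require Import ring lra.
Set Implicit Arguments.
Unset Strict Implicit.
Unset Printing Implicit Defensive.

(** * Lebesgue measure on R^N *)

Section borel_structure_of_RN.
Context {R : realType} {N : nat}.
Local Notation V := 'rV[R]_N.
Local Notation RN := (RN R N).

(** The good points found this way need not lie on the coordinate axes, but differences of two of
    them do. As [s_i] is fixed before [eps], the choice [eps = t / s_i] reaches every small step
    [t].

    The choice [T = G / (2 C)] presupposes that [G] is finite. Finiteness is obtained beforehand,
    from a [T] with [w (m1 T)] above the threshold, which exists because [w] is unbounded.

    The pairing of [f] with a translated test function, as a function of the translation, is the
    common tool: it gives the bound on increments, the limit of the difference quotients, and the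
    continuity of translations behind the Steinhaus argument.

    The measure [mu] is known on boxes only, so its behaviour under translations and dilations comes
    from uniqueness of measures on a generating family stable under intersection. *)

Definition box (a b : V) : set RN :=
  [set x : RN | forall i, a ord0 i <= (x : V) ord0 i <= b ord0 i].

Definition boxes : set (set RN) :=
  [set A | A = set0 \/ exists a b, A = box a b].

Lemma measurable_open_RN (A : set V) : open A -> measurable (A : set RN).
Proof. by move=> oA; exact: sub_sigma_algebra. Qed.

Lemma measurable_continuous_RN (g : V -> R) :
  continuous g -> measurable_fun [set: RN] (g : RN -> R).
Proof.
move=> cg; apply: (@measurability _ _ RN R setT g _ (RGenOpens.measurableE R)) => _ [_ [a [b ->]] <-].
rewrite setTI; apply: measurable_open_RN.
by move/continuousP: cg; apply; exact: interval_open.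
Qed.

Lemma measurable_coord_RN (i : 'I_N) :
  measurable_fun [set: RN] ((fun x : V => x ord0 i) : RN -> R).
Proof. by apply: measurable_continuous_RN; exact: coord_continuous. Qed.

Lemma measurable_box (a b : V) : measurable (box a b).
Proof.
have -> : box a b = \bigcap_(i in [set: 'I_N])
    ((fun x : RN => (x : V) ord0 i) @^-1` `[a ord0 i, b ord0 i]%classic).
  apply/seteqP; split => x /= h i; first by move=> _; rewrite /= in_itv; exact: h.
  by have := h i I; rewrite /= in_itv.
apply: fin_bigcap_measurable => // i _.
by rewrite -[X in measurable X]setTI; apply: measurable_coord_RN.
Qed.

Lemma open_RN_bigcup_boxes (U : set V) : open U ->
  exists2 F : nat -> set RN, (forall n, boxes (F n)) & U = \bigcup_n F n.
Proof.
move=> oU.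
pose rv (q : 'rV[rat]_N) : V := \row_i ratr (q ord0 i).
(* Pairs of rational corners are enumerated through their codes. A number that codes no pair, or
   codes a box not contained in [U], contributes [set0], which is why [boxes] contains the empty
   set. *)
pose F n : set RN := if (unpickle n : option ('rV[rat]_N * 'rV[rat]_N)) is Some q
  then (if `[< box (rv q.1) (rv q.2) `<=` U >] then box (rv q.1) (rv q.2) else set0)
  else set0.
exists F.
  move=> n; rewrite /F; case: unpickle => [q|]; last by left.
  by case: ifP => _; [right; exists (rv q.1), (rv q.2)|left].
apply/seteqP; split => x; last first.
  case=> n _; rewrite /F; case: unpickle => [q|//].
  by case: ifP => // /asboolP; apply.
move=> Ux; have /nbhs_ballP[e /= e0 eU] : nbhs x U by exact: open_nbhs_nbhs.
have lo i : exists q : rat, x ord0 i - e < ratr q < x ord0 i.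
  have [q] := @rat_in_itvoo R (x ord0 i - e) (x ord0 i) ltac:(by rewrite ltrBlDr ltrDl).
  by rewrite in_itv /=; exists q.
have hi i : exists q : rat, x ord0 i < ratr q < x ord0 i + e.
  have [q] := @rat_in_itvoo R (x ord0 i) (x ord0 i + e) ltac:(by rewrite ltrDl).
  by rewrite in_itv /=; exists q.
have [q1 q1P] := choice lo; have [q2 q2P] := choice hi.
exists (pickle (\row_i q1 i, \row_i q2 i)) => //; rewrite /F pickleK ifT /=.
  by move=> i; rewrite !mxE; have /andP[_ /ltW->] := q1P i; have /andP[/ltW->] := q2P i.
apply/asboolP => y yb; apply: eU; split => // i j.
rewrite (ord1 i) /ball /=.
have := yb j; rewrite !mxE; have /andP[h1 _] := q1P j; have /andP[_ h2] := q2P j.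
move=> /andP[/(lt_le_trans h1) h3 /le_lt_trans /(_ h2) h4].
by rewrite ltr_distlC h3 h4.
Qed.

Lemma measurable_RN_boxesE : @measurable _ RN = <<s boxes >>.
Proof.
apply/seteqP; split => A.
  apply: smallest_sub; first exact: smallest_sigma_algebra.
  move=> U /open_RN_bigcup_boxes[F bF ->].
  apply: sigma_algebra_bigcup => n; exact: sub_sigma_algebra.
apply: smallest_sub.
  by split => //= [B mB|F mF]; [rewrite setTD; exact: measurableC|exact: bigcupT_measurable].
by move=> _ [->|[a [b ->]]]; [exact: measurable0|exact: measurable_box].
Qed.

Lemma setI_closed_boxes : setI_closed boxes.
Proof.
move=> A B [->|[a [b ->]]]; first by rewrite set0I; left.
move=> [->|[c [d ->]]]; first by rewrite setI0; left.
right; exists (\row_i Num.max (a ord0 i) (c ord0 i)), (\row_i Num.min (b ord0 i) (d ord0 i)).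
apply/seteqP; split => x /= => [[h1 h2] i|h].
  rewrite !mxE ge_max le_min.
  by have /andP[-> ->] := h1 i; have /andP[-> ->] := h2 i.
by split => i; have := h i; rewrite !mxE ge_max le_min => /andP[/andP[? ?] /andP[? ?]]; apply/andP.
Qed.

Definition cube (r : R) : set RN := box (const_mx (- r)) (const_mx r).

Lemma cubeP (r : R) (x : V) : cube r x <-> forall i, `|x ord0 i| <= r.
Proof. by split => h i; have := h i; rewrite !mxE ler_norml. Qed.

Lemma coord_le_norm (x : V) (i : 'I_N) : `|x ord0 i| <= `|x|.
Proof.
rewrite [leRHS]/Num.norm /= mx_normrE; apply/bigmax_geP; right => /=.
by exists (ord0, i).
Qed.

Lemma cube_nat_cover (x : V) : exists n : nat, cube n%:R x.
Proof.
have [n nP] : exists n : nat, `|x| <= n%:R.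
  by exists (Num.truncn `|x|).+1; apply/ltW/truncnS_gt.
exists n; apply/cubeP => i; exact: le_trans (coord_le_norm x i) nP.
Qed.

Lemma bigcup_cube : \bigcup_n cube n%:R = [set: RN].
Proof. by apply/seteqP; split => // x _; have [n ?] := cube_nat_cover x; exists n. Qed.

Lemma cube_subset (r s : R) : r <= s -> cube r `<=` cube s.
Proof. by move=> rs x /cubeP h; apply/cubeP => i; exact: le_trans (h i) rs. Qed.

Lemma measurable_shift_RN (v : V) :
  measurable_fun [set: RN] ((fun x : V => x + v) : RN -> RN).
Proof.
apply: (@measurability _ _ RN RN setT (fun x : V => x + v) _ measurable_RN_boxesE) => _ [_ [->|[a [b ->]]] <-].
  by rewrite preimage_set0 setI0.
rewrite setTI (_ : _ @^-1` _ = box (a - v) (b - v)); first exact: measurable_box.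
by apply/seteqP; split => x h i; have := h i; rewrite !mxE lerBlDr lerBrDr.
Qed.

Lemma measurable_scale_RN (c : R) : 0 < c ->
  measurable_fun [set: RN] ((fun x : V => c *: x) : RN -> RN).
Proof.
move=> c0.
apply: (@measurability _ _ RN RN setT (fun x : V => c *: x) _ measurable_RN_boxesE) => _ [_ [->|[a [b ->]]] <-].
  by rewrite preimage_set0 setI0.
rewrite setTI (_ : _ @^-1` _ = box (c^-1 *: a) (c^-1 *: b)); first exact: measurable_box.
by apply/seteqP; split => x h i; have := h i; rewrite !mxE ![c^-1 * _]mulrC ler_pdivlMr// ler_pdivrMr// ![c * _]mulrC.
Qed.

Lemma measurable_add_RN :
  measurable_fun [set: RN * RN] ((fun z : V * V => z.1 + z.2) : RN * RN -> RN).
Proof.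
apply: (@measurability _ _ (RN * RN)%type RN setT (fun z : V * V => z.1 + z.2) _ measurable_RN_boxesE) => _ [_ [->|[a [b ->]]] <-].
  by rewrite preimage_set0 setI0.
rewrite setTI (_ : _ @^-1` _ = \bigcap_(i in [set: 'I_N])
    ((fun z : RN * RN => (z.1 : V) ord0 i + (z.2 : V) ord0 i) @^-1` `[a ord0 i, b ord0 i]%classic)); last first.
  apply/seteqP; split => x /= h i; first by move=> _; have := h i; rewrite /= in_itv !mxE.
  by have := h i I; rewrite /= in_itv !mxE.
apply: fin_bigcap_measurable => // i _.
rewrite -[X in measurable X]setTI.
apply: (measurable_funD (f := fun z : RN * RN => (z.1 : V) ord0 i)) => //.
- apply: (@measurableT_comp _ _ _ _ _ _ ((fun x : V => x ord0 i) : RN -> R) _ (@fst RN RN)).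
  + exact: measurable_coord_RN.
  + exact: measurable_fst.
- apply: (@measurableT_comp _ _ _ _ _ _ ((fun x : V => x ord0 i) : RN -> R) _ (@snd RN RN)).
  + exact: measurable_coord_RN.
  + exact: measurable_snd.
Qed.

End borel_structure_of_RN.

Section sigma_finite_packing.
Context d (T : measurableType d) (R : realType).
Variables (m : {measure set T -> \bar R}) (mfin : sigma_finite [set: T] m).

(** Tonelli asks for a bundled sigma-finite measure, while sigma-finiteness of [mu] is a proved
    proposition. This copy of [m] has a head symbol of its own, on which the instance can be
    declared. *)
Definition sigma_finite_copy of phant (sigma_finite [set: T] m) : set T -> \bar R := m.
Local Notation m' := (sigma_finite_copy (Phant (sigma_finite [set: T] m))).

HB.instance Definition _ := isMeasure.Build _ _ _ m'
  (measure0 m) (measure_ge0 m) (@measure_semi_sigma_additive _ _ _ m).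
HB.instance Definition _ := Measure_isSigmaFinite.Build _ _ _ m' mfin.

Lemma sigma_finite_measureE :
  exists m1 : {sigma_finite_measure set T -> \bar R}, (m : set T -> \bar R) = m1.
Proof. by exists m'. Qed.

End sigma_finite_packing.

Section lebesgue_measure_of_RN.
Context {R : realType} {N : nat}.
Local Notation V := 'rV[R]_N.
Local Notation RN := (RN R N).
Variable mu : {measure set RN -> \bar R}.
Hypothesis hmu : is_lebesgue_RN mu.

Lemma box_empty (a b : V) : ~ (forall i, a ord0 i <= b ord0 i) -> box a b = set0.
Proof.
move=> nab; apply/seteqP; split => // x h; apply: nab => i.
by have /andP[h1 h2] := h i; exact: le_trans h1 h2.
Qed.

Lemma lebesgue_RN_box_fin (a b : V) : (mu (box a b) < +oo)%E.
Proof.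
have [ab|/box_empty ->] := pselect (forall i, a ord0 i <= b ord0 i).
  by rewrite [X in (X < _)%E](hmu ab) ltry.
by rewrite measure0.
Qed.

(** The pushforward of [mu] by [g] and the multiple [c mu] agree on boxes, which generate the
    sigma-algebra, are stable under intersection and cover the space with finite measure. The maps
    [g] of interest are translations, with [c = 1], and dilations by [a], with [c = a ^- N]. *)
Lemma measure_preimage_scale (g : V -> V) (c : {nonneg R}) :
  measurable_fun [set: RN] (g : RN -> RN) ->
  (forall a b : V, mu (g @^-1` box a b) = (c%:num%:E * mu (box a b))%E) ->
  forall A : set RN, measurable A -> mu (g @^-1` A) = (c%:num%:E * mu A)%E.
Proof.
move=> mg gbox A mA.
pose m1 : {measure set RN -> \bar R} :=
  measure_function_pushforward__canonical__measure_function_Measure mu mg.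
apply: (measure_unique boxes (fun n => cube n%:R) measurable_RN_boxesE
  setI_closed_boxes _ bigcup_cube m1 (mscale c mu)) mA => //.
- by move=> n; right; exists (const_mx (- n%:R)), (const_mx n%:R).
- move=> B [->|[a [b ->]]]; first by rewrite !measure0.
  exact: gbox.
- move=> n /=; rewrite /pushforward gbox.
  by rewrite lte_mul_pinfty// ?lee_fin// lebesgue_RN_box_fin.
Qed.

Lemma ge0_integral_preimage_scale (g : V -> V) (c : {nonneg R}) (F : V -> \bar R) :
  measurable_fun [set: RN] (g : RN -> RN) ->
  (forall a b : V, mu (g @^-1` box a b) = (c%:num%:E * mu (box a b))%E) ->
  measurable_fun [set: RN] (F : RN -> \bar R) -> (forall x, (0 <= F x)%E) ->
  (\int[mu]_x F (g x) = c%:num%:E * \int[mu]_x F x)%E.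
Proof.
move=> mg gbox mF F0.
have := ge0_integral_pushforward mg mu measurableT mF (fun y _ => F0 y).
rewrite preimage_setT /comp => <-.
rewrite -ge0_integral_mscale//.
pose m1 : {measure set RN -> \bar R} :=
  measure_function_pushforward__canonical__measure_function_Measure mu mg.
apply: (@eq_measure_integral _ _ _ setT (mscale c mu) m1) => B mB _.
exact: measure_preimage_scale.
Qed.

Lemma ge0_integral_shift (v : V) (F : V -> \bar R) :
  measurable_fun [set: RN] (F : RN -> \bar R) -> (forall x, (0 <= F x)%E) ->
  (\int[mu]_x F ((x : V) + v)%R = \int[mu]_x F x)%E.
Proof.
move=> mF F0; have one0 : 0 <= 1 :> R by [].
rewrite (@ge0_integral_preimage_scale (fun x => x + v) (NngNum one0))//= ?mul1e//.
  exact: measurable_shift_RN.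
move=> a b; rewrite mul1e.
rewrite (_ : _ @^-1` _ = box (a - v) (b - v)); last first.
  by apply/seteqP; split => x h i; have := h i; rewrite !mxE lerBlDr lerBrDr.
have [ab|nab] := pselect (forall i, a ord0 i <= b ord0 i).
  rewrite [LHS]hmu; last by move=> i; rewrite !mxE lerD2r.
  rewrite [RHS]hmu//; congr (_%:E); apply: eq_bigr => i _.
  by rewrite !mxE opprD opprK addrACA addNr addr0.
rewrite !box_empty// => h; apply: nab => i.
by have := h i; rewrite !mxE lerD2r.
Qed.

Lemma integral_shift (v : V) (F : V -> \bar R) :
  measurable_fun [set: RN] (F : RN -> \bar R) ->
  (\int[mu]_x F ((x : V) + v)%R = \int[mu]_x F x)%E.
Proof.
move=> mF; rewrite [LHS]integralE [RHS]integralE.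
rewrite -(@ge0_integral_shift v (F^\+)%E)//; last exact: measurable_funepos.
rewrite -(@ge0_integral_shift v (F^\-)%E)//; last exact: measurable_funeneg.
congr (_ - _)%E; apply: eq_integral => x _.
  exact: (congr1 (@^~ x) (funepos_comp F (fun y : V => y + v))).
exact: (congr1 (@^~ x) (funeneg_comp F (fun y : V => y + v))).
Qed.

Lemma ge0_integral_dilate (c : R) (F : V -> \bar R) : 0 < c ->
  measurable_fun [set: RN] (F : RN -> \bar R) -> (forall x, (0 <= F x)%E) ->
  (\int[mu]_x F (c *: (x : V)) = (c ^- N)%:E * \int[mu]_x F x)%E.
Proof.
move=> c0 mF F0; have cN0 : 0 <= c ^- N by rewrite invr_ge0 exprn_ge0// ltW.
rewrite (@ge0_integral_preimage_scale (fun x => c *: x) (NngNum cN0))//=.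
  exact: measurable_scale_RN.
move=> a b; rewrite (_ : _ @^-1` _ = box (c^-1 *: a) (c^-1 *: b)); last first.
  apply/seteqP; split => x h i; have := h i; rewrite !mxE ![c^-1 * _]mulrC;
  by rewrite ler_pdivlMr// ler_pdivrMr// ![c * _]mulrC.
have [ab|nab] := pselect (forall i, a ord0 i <= b ord0 i).
  rewrite [LHS]hmu; last by move=> i; rewrite !mxE ler_pM2l ?invr_gt0.
  rewrite [X in (_ * X)%E]hmu// -EFinM; congr (_%:E).
  transitivity (\prod_(i < N) (c^-1 * (b ord0 i - a ord0 i))).
    by apply: eq_bigr => i _; rewrite !mxE mulrBr.
  by rewrite big_split /= prodr_const card_ord exprVn.
rewrite !box_empty ?measure0 ?mule0// => h; apply: nab => i.
by have := h i; rewrite !mxE ler_pM2l ?invr_gt0.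
Qed.

Lemma sigma_finite_lebesgue_RN : sigma_finite [set: RN] mu.
Proof.
exists (fun n => cube n%:R); first by rewrite bigcup_cube.
by move=> n; split; [exact: measurable_box|exact: lebesgue_RN_box_fin].
Qed.

Lemma measurable_integral_snd (F : RN * RN -> \bar R) :
  measurable_fun [set: RN * RN] F -> (forall z, (0 <= F z)%E) ->
  measurable_fun [set: RN] (fun h => \int[mu]_x F (h, x))%E.
Proof.
move=> mF F0.
have [m ->] := sigma_finite_measureE sigma_finite_lebesgue_RN.
exact: (@measurable_fun_fubini_tonelli_F _ _ _ _ _ m F mF F0).
Qed.

(* The integral of a nonnegative function is a supremum over simple functions, so
   monotonicity needs no measurability: none is available for [w] of the inner integral. *)
Lemma le_integral_of_ge0 (F G : V -> \bar R) :
  (forall x, (0 <= F x)%E) -> (forall x, (F x <= G x)%E) ->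
  (\int[mu]_x F x <= \int[mu]_x G x)%E.
Proof.
move=> F0 FG; have G0 x : (0 <= G x)%E by exact: le_trans (F0 x) (FG x).
rewrite !ge0_integralTE//; apply: le_ereal_sup => _ [h hF <-].
by exists h => // x; exact: le_trans (hF x) (FG x).
Qed.

End lebesgue_measure_of_RN.

(** * Test functions *)

Section C1c_calculus.
Context {R : realType} {N : nat}.
Local Notation V := 'rV[R]_N.
Implicit Types (phi psi : V -> R) (v x : V).

(** Both derivatives are limits of the same quotient. This transfers the one-variable rules, in
    particular the chain rule, to directional derivatives. *)
Lemma is_derive_lineP phi x v (d : R) :
  is_derive x v phi d <-> is_derive (0 : R) (1 : R) (fun s : R => phi (s *: v + x)) d.
Proof.
have E : (fun h : R => h^-1 *: ((phi \o shift x) (h *: v) - phi x)) =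
   (fun h : R => h^-1 *: (((fun s : R => phi (s *: v + x)) \o shift 0) (h *: (1:R)) - phi (0 *: v + x))).
  by apply/funext => h /=; rewrite scale0r add0r addr0 scaler1.
split => -[].
  rewrite /derivable /derive E => h1 h2; exact: DeriveDef.
rewrite /derivable /derive -E => h1 h2; exact: DeriveDef.
Qed.

Lemma is_derive_shift_line phi x v (s : R) (d : R) :
  is_derive (s *: v + x) v phi d ->
  is_derive s (1 : R) (fun s : R => phi (s *: v + x)) d.
Proof.
move=> /is_derive_lineP [h1 h2].
have E : (fun h : R => h^-1 *: (((fun s : R => phi (s *: v + x)) \o shift s) (h *: (1:R)) - phi (s *: v + x))) =
   (fun h : R => h^-1 *: (((fun t : R => phi (t *: v + (s *: v + x))) \o shift 0) (h *: (1:R)) - phi (0 *: v + (s *: v + x)))).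
  by apply/funext => h /=; rewrite scale0r add0r addr0 scalerDl addrA.
move: h1 h2; rewrite /derivable /derive -E => h1 h2.
by split.
Qed.

Lemma is_derive_comp_real (theta : R -> R) phi x v (dt d : R) :
  is_derive (phi x) (1 : R) theta dt -> is_derive x v phi d ->
  is_derive x v (theta \o phi) (dt * d).
Proof.
move=> ht /is_derive_lineP hp; apply/is_derive_lineP.
have ht' : is_derive ((fun s : R => phi (s *: v + x)) 0) (1 : R) theta dt.
  by rewrite /= scale0r add0r.
exact: is_derive1_comp.
Qed.

Lemma is_derive_translate phi x v u (d : R) :
  is_derive (x + u) v phi d -> is_derive x v (fun y => phi (y + u)) d.
Proof.
move=> /is_derive_lineP h; apply/is_derive_lineP.
by under eq_fun do rewrite -addrA.
Qed.

Lemma is_derive_coord (j : 'I_N) x v :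
  is_derive x v (fun y : V => y ord0 j) (v ord0 j).
Proof.
apply/is_derive_lineP.
have -> : (fun s : R => (s *: v + x) ord0 j) =
    (fun s : R => v ord0 j *: s + x ord0 j).
  by apply/funext => s; rewrite !mxE /= mulrC.
rewrite -[X in is_derive _ _ _ X]addr0 -[X in is_derive _ _ _ (X + _)]mulr1.
by apply: is_deriveD.
Qed.

Lemma continuous_fD (f g : V -> R) : continuous f -> continuous g ->
  continuous (fun x => f x + g x).
Proof. by move=> cf cg x; exact: (cvgD (cf x) (cg x)). Qed.

Lemma continuous_fB (f g : V -> R) : continuous f -> continuous g ->
  continuous (fun x => f x - g x).
Proof. by move=> cf cg x; exact: (cvgB (cf x) (cg x)). Qed.

Lemma continuous_fM (f g : V -> R) : continuous f -> continuous g ->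
  continuous (fun x => f x * g x).
Proof. by move=> cf cg x; exact: (cvgM (cf x) (cg x)). Qed.

Lemma continuous_fcst (c : R) : continuous (fun _ : V => c).
Proof. exact: cst_continuous. Qed.

Lemma continuous_fcomp (theta : R -> R) (f : V -> R) :
  continuous theta -> continuous f -> continuous (fun x => theta (f x)).
Proof. by move=> ct cf x; exact: (continuous_comp (cf x) (ct (f x))). Qed.

Lemma continuous_ftranslate (f : V -> R) (u : V) :
  continuous f -> continuous (fun x => f (x + u)).
Proof.
move=> cf x; have h : {for x, continuous (fun y : V => y + u)}.
  exact: (cvgD (@cvg_id _ (nbhs x)) (@cvg_cst _ u _ (nbhs x) _)).
exact: (continuous_comp h (cf (x + u))).
Qed.

Lemma continuous_fcoord (i : 'I_N) : continuous (fun x : V => x ord0 i).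
Proof. exact: coord_continuous. Qed.

Lemma continuous_fsum (I : Type) (s : seq I) (F : I -> V -> R) :
  (forall i, continuous (F i)) -> continuous (fun x => \sum_(i <- s) F i x).
Proof.
move=> cF; elim: s => [|i s ih].
  by rewrite (_ : (fun x => _) = (fun=> 0)); [exact: continuous_fcst|apply/funext => x; rewrite big_nil].
rewrite (_ : (fun x => _) = (fun x => F i x + \sum_(j <- s) F j x)).
  exact: continuous_fD.
by apply/funext => x; rewrite big_cons.
Qed.

Lemma continuous_of_is_derive (theta dtheta : R -> R) :
  (forall s, is_derive s (1 : R) theta (dtheta s)) -> continuous theta.
Proof.
move=> ht s; apply: differentiable_continuous; apply/derivable1_diffP.
by have [] := ht s.
Qed.

Lemma C1c_support phi : C1c phi ->
  exists2 r : R, 0 <= r & forall x, ~ cube r x -> phi x = 0.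
Proof.
move=> [_ [_ [_ /compact_bounded [M [Mr MP]]]]].
exists (Num.max 0 (M + 1)); first by rewrite le_max lexx.
move=> x nx; apply/eqP; apply: contra_notT nx => px; apply/cubeP => i.
have : `|x| <= M + 1.
  by apply: MP; [rewrite ltrDl|exact: subset_closure].
move=> h; rewrite le_max (le_trans _ h) ?orbT//.
exact: coord_le_norm.
Qed.

Lemma closed_cube (r : R) : closed (cube r : set V).
Proof.
have -> : (cube r : set V) = \bigcap_(i in [set: 'I_N])
    ((fun x : V => x ord0 i) @^-1` `[- r, r]%classic).
  apply/seteqP; split => x /=.
    by move=> /cubeP h i _; rewrite /= in_itv /= -ler_norml.
  by move=> h; apply/cubeP => i; have := h i I; rewrite /= in_itv /= -ler_norml.
apply: closed_bigI => i _; apply: closed_comp; last exact: itv_closed.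
by move=> x _; exact: coord_continuous.
Qed.

Lemma compact_cube (r : R) : compact (cube r : set V).
Proof.
apply: bounded_closed_compact; last exact: closed_cube.
exists `|r|; split => // M rM x /cubeP h /=.
rewrite [leLHS]/Num.norm /= mx_normrE; apply/bigmax_leP; split => [|[i j] _ /=].
  by rewrite (le_trans _ (ltW rM)).
by rewrite (ord1 i) (le_trans (h j))// (le_trans (ler_norm r))// ltW.
Qed.

Lemma bounded_of_support (g : V -> R) (r : R) :
  continuous g -> (forall x, ~ cube r x -> g x = 0) ->
  exists2 M : R, 0 < M & forall x, `|g x| <= M.
Proof.
move=> cg g0.
have [M [Mr MP]] : bounded_set (g @` (cube r : set V)).
  apply: compact_bounded; apply: continuous_compact; last exact: compact_cube.
  by move=> x; apply: (@continuous_subspaceT V).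
exists (Num.max 1 (M + 1)); first by rewrite lt_max ltr01.
move=> x; have [cx|/g0 ->] := pselect (cube r x); last first.
  by rewrite normr0 le_max ler01.
by rewrite le_max; apply/orP; right; apply: (MP (M + 1)); [rewrite ltrDl|exists x].
Qed.

Lemma C1c_is_derive phi (i : 'I_N) x : C1c phi ->
  is_derive x (evec R i) phi ('D_(evec R i) phi x).
Proof. by move=> [_ [h _]]; apply: DeriveDef. Qed.

Lemma C1cI phi (dphi : 'I_N -> V -> R) (r : R) : continuous phi ->
  (forall i x, is_derive x (evec R i) phi (dphi i x)) ->
  (forall i, continuous (dphi i)) ->
  (forall x, ~ cube r x -> phi x = 0) -> C1c phi.
Proof.
move=> cphi dp cd p0; split => //; split; first by move=> i x; have [] := dp i x.
split.
  move=> i; rewrite (_ : (fun x => 'D_(evec R i) phi x) = dphi i)//.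
  by apply/funext => x; rewrite derive_val.
apply: (subclosed_compact _ (@compact_cube r)); first exact: closed_closure.
rewrite (_ : (cube r : set V) = closure (cube r)); last first.
  by apply/closure_id; exact: closed_cube.
apply: closureS => x /= px; apply: contrapT => /p0 /eqP; exact/negP.
Qed.

Lemma derive_support phi (r : R) (i : 'I_N) : C1c phi ->
  (forall x, ~ cube r x -> phi x = 0) ->
  forall x, ~ cube r x -> 'D_(evec R i) phi x = 0.
Proof.
move=> cphi p0 x nx.
(* The cube is closed, so [phi] vanishes on a whole neighbourhood of [x] and the difference quotient
   is eventually 0. *)
have nz : \forall y \near x, phi y = 0.
  have /closed_openC oc := @closed_cube r.
  by apply: filterS (open_nbhs_nbhs (conj oc nx)) => y; exact: p0.
have hc : (fun h : R => h *: evec R i + x) @ 0^' --> x.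
  rewrite -[X in _ --> X]add0r -(scale0r (evec R i)); apply: cvgD; last exact: cvg_cst.
  by apply: cvgZ; [exact: cvg_within|exact: cvg_cst].
apply: cvg_lim => //; apply: cvg_near_cst.
near=> h; have /= -> : phi (h *: evec R i + x) = 0 by near: h; exact: hc _ nz.
by rewrite p0// subrr scaler0.
Unshelve. all: by end_near.
Qed.

Lemma C1c_translate phi u : C1c phi -> C1c (fun x => phi (x + u)).
Proof.
move=> cphi; have [r r0 rP] := C1c_support cphi.
apply: (@C1cI _ (fun i x => 'D_(evec R i) phi (x + u)) (r + `|u|)).
- by apply: continuous_ftranslate; case: cphi.
- by move=> i x; apply: is_derive_translate; exact: C1c_is_derive.
- by move=> i; apply: (@continuous_ftranslate (fun y => 'D_(evec R i) phi y)); case: cphi => _ [_ []].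
- move=> x nx; apply: rP; apply: contra_not nx => /cubeP h; apply/cubeP => i.
  have -> : x ord0 i = (x + u) ord0 i - u ord0 i by rewrite mxE addrK.
  rewrite (le_trans (ler_normB _ _))// lerD//.
  exact: coord_le_norm.
Qed.

Lemma C1c_comp (theta dtheta : R -> R) phi :
  (forall s, is_derive s (1 : R) theta (dtheta s)) -> continuous dtheta ->
  theta 0 = 0 -> C1c phi -> C1c (theta \o phi).
Proof.
move=> ht ct t0 cphi; have [r r0 rP] := C1c_support cphi.
have [cp [_ [cd _]]] := cphi.
apply: (@C1cI _ (fun i x => dtheta (phi x) * 'D_(evec R i) phi x) r).
- by apply: continuous_fcomp => //; exact: continuous_of_is_derive ht.
- by move=> i x; apply: is_derive_comp_real; exact: C1c_is_derive.
- by move=> i; apply: continuous_fM (cd i); exact: continuous_fcomp.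
- by move=> x /rP /= ->.
Qed.

Lemma C1c_lin (a : R) phi psi : C1c phi -> C1c psi ->
  C1c (fun x => a * phi x + psi x).
Proof.
move=> cphi cpsi; have [r r0 rP] := C1c_support cphi.
have [s s0 sP] := C1c_support cpsi.
have [cp [_ [cdp _]]] := cphi; have [cq [_ [cdq _]]] := cpsi.
apply: (@C1cI _ (fun i x => a * 'D_(evec R i) phi x + 'D_(evec R i) psi x) (Num.max r s)).
- by apply: continuous_fD => //; apply: continuous_fM => //; exact: continuous_fcst.
- move=> i x; apply: is_deriveD; last exact: C1c_is_derive.
  by apply: is_deriveZ; exact: C1c_is_derive.
- by move=> i; apply: continuous_fD (cdq i); apply: continuous_fM (cdp i); exact: continuous_fcst.
- move=> x nx; rewrite rP ?sP ?mulr0 ?addr0//.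
    by apply: contra_not nx; apply: cube_subset; rewrite le_max lexx orbT.
  by apply: contra_not nx; apply: cube_subset; rewrite le_max lexx.
Qed.

Lemma C1c_zero : C1c (fun _ : V => 0 : R).
Proof.
apply: (@C1cI _ (fun _ _ => 0) 0) => //.
- exact: continuous_fcst.
- by move=> _; exact: continuous_fcst.
Qed.

(** The square of the positive part: of class C^1 and zero exactly on the nonpositive half-line. The
    explicit test functions are built from it. *)
Definition possq (s : R) : R := (Num.max 0 s) ^+ 2.

Lemma possq_diff (s h : R) :
  `|possq (h + s) - possq s - 2 * Num.max 0 s * h| <= h ^+ 2.
Proof.
rewrite /possq; case: (leP 0 s) => s0; case: (leP 0 (h + s)) => hs0; rewrite ler_norml;
by apply/andP; split; nra.
Qed.

Lemma is_derive_possq (s : R) : is_derive s (1 : R) possq (2 * Num.max 0 s).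
Proof.
suff h : (fun h : R => h^-1 *: ((possq \o shift s) (h *: (1:R)) - possq s)) @ 0^' --> 2 * Num.max 0 s.
  by split; [apply/cvg_ex; exists (2 * Num.max 0 s)|exact/cvg_lim].
apply/cvgrPdist_le => e e0; near=> h.
have h0 : h != 0 by near: h; exact: nbhs_dnbhs_neq.
rewrite /= scaler1.
have -> : 2 * Num.max 0 s - h^-1 * (possq (h + s) - possq s) =
   - (h^-1 * (possq (h + s) - possq s - 2 * Num.max 0 s * h)).
  by field.
rewrite normrN normrM normfV ler_pdivrMl ?normr_gt0//.
rewrite (le_trans (possq_diff _ _))// -(real_normK (num_real h)) expr2 ler_pM2l ?normr_gt0//.
near: h; exact: dnbhs0_le.
Unshelve. all: by end_near. Qed.

Lemma continuous_dpossq : continuous (fun s : R => 2 * Num.max 0 s).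
Proof.
move=> s; apply: cvgMr.
by apply: (@continuous_max R R (cst 0) id); [exact: cvg_cst|exact: cvg_id].
Qed.

Lemma continuous_possq : continuous possq.
Proof.
move=> s; apply: differentiable_continuous; apply/derivable1_diffP.
by have [] := is_derive_possq s.
Qed.

(** For a nonempty box this is the squared Euclidean distance to it: in each coordinate at most one
    of the two terms is nonzero. *)
Definition box_sqdist (a b x : V) : R :=
  \sum_(i < N) (possq (a ord0 i - x ord0 i) + possq (x ord0 i - b ord0 i)).

(** Equal to 1 on the box and to 0 where the squared distance is at least [1 / n], so it tends
    pointwise to the indicator of the box. *)
Definition box_bump (a b : V) (n : R) (x : V) : R :=
  possq (1 - n * box_sqdist a b x).

Lemma possq_ge0 (s : R) : 0 <= possq s. Proof. exact: sqr_ge0. Qed.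

Lemma possq_eq0 (s : R) : (possq s == 0) = (s <= 0).
Proof. by rewrite /possq sqrf_eq0; case: (leP 0 s) => s0; rewrite ?eqxx ?(ltW s0)// eq_le s0 andbT. Qed.

Lemma box_sqdist_ge0 a b x : 0 <= box_sqdist a b x.
Proof. by apply: sumr_ge0 => i _; rewrite addr_ge0 ?possq_ge0. Qed.

Lemma box_sqdist_eq0 a b x : (box_sqdist a b x = 0) <-> box a b x.
Proof.
split.
  move=> /eqP; rewrite psumr_eq0; last by move=> i _; rewrite addr_ge0 ?possq_ge0.
  move=> /allP h i; have := h i (mem_index_enum _).
  by rewrite /= paddr_eq0 ?possq_ge0// !possq_eq0 !subr_le0.
move=> h; apply: big1 => i _; have /andP[h1 h2] := h i.
by apply/eqP; rewrite paddr_eq0 ?possq_ge0// !possq_eq0 !subr_le0 h1 h2.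
Qed.

Lemma is_derive_box_sqdist a b x v : is_derive x v (box_sqdist a b)
  (\sum_(i < N) ((2 * Num.max 0 (a ord0 i - x ord0 i)) * (- v ord0 i)
     + (2 * Num.max 0 (x ord0 i - b ord0 i)) * v ord0 i)).
Proof.
rewrite (_ : box_sqdist a b = \sum_(i < N) (fun y : V => possq (a ord0 i - y ord0 i) + possq (y ord0 i - b ord0 i))); last first.
  by apply/funext => y; rewrite fct_sumE.
apply: is_derive_sum => i; apply: is_deriveD.
  apply: (@is_derive_comp_real possq (fun y : V => a ord0 i - y ord0 i)).
    exact: is_derive_possq.
  rewrite -[X in is_derive _ _ _ X]add0r; apply: is_deriveD.
  by apply: is_deriveN; exact: is_derive_coord.
apply: (@is_derive_comp_real possq (fun y : V => y ord0 i - b ord0 i)).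
  exact: is_derive_possq.
by rewrite -[X in is_derive _ _ _ X]addr0; apply: is_deriveD; exact: is_derive_coord.
Qed.

Lemma continuous_box_sqdist a b : continuous (box_sqdist a b).
Proof.
apply: continuous_fsum => i; apply: continuous_fD; apply: (continuous_fcomp continuous_possq);
apply: continuous_fB; try exact: continuous_fcst; exact: continuous_fcoord.
Qed.

(** Leaving the box by 1 in one coordinate already makes the squared distance at least 1. The
    enlarged box serves all [n >= 1] at once, as dominated convergence requires. *)
Lemma box_bump_support (a b : V) (n : R) x : 1 <= n ->
  ~ box (\row_i (a ord0 i - 1)) (\row_i (b ord0 i + 1)) x -> box_bump a b n x = 0.
Proof.
move=> n1 nx; apply/eqP; rewrite possq_eq0 subr_le0.
have [i ni] : exists i, ~~ (a ord0 i - 1 <= x ord0 i <= b ord0 i + 1).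
  apply: contrapT => h; apply: nx => i; rewrite !mxE.
  by apply: contrapT => /negP hi; apply: h; exists i.
suff h : 1 <= box_sqdist a b x by rewrite (le_trans h)// ler_peMl// box_sqdist_ge0.
rewrite /box_sqdist (bigD1 i)//=.
have h0 : 0 <= \sum_(j < N | j != i) (possq (a ord0 j - x ord0 j) + possq (x ord0 j - b ord0 j)).
  by apply: sumr_ge0 => j _; rewrite addr_ge0 ?possq_ge0.
move: ni; rewrite negb_and -!ltNge => /orP[h|h].
  have : 1 <= possq (a ord0 i - x ord0 i) by rewrite /possq; case: (leP 0 (a ord0 i - x ord0 i)); nra.
  by have := possq_ge0 (x ord0 i - b ord0 i); lra.
have : 1 <= possq (x ord0 i - b ord0 i) by rewrite /possq; case: (leP 0 (x ord0 i - b ord0 i)); nra.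
by have := possq_ge0 (a ord0 i - x ord0 i); lra.
Qed.

Lemma box_bump_le1 a b (n : R) x : 0 <= n -> box_bump a b n x <= 1.
Proof.
move=> n0; rewrite /box_bump /possq.
have := mulr_ge0 n0 (box_sqdist_ge0 a b x); set t := n * _ => t0.
by case: (leP 0 (1 - t)); nra.
Qed.

Lemma box_bump_ge0 a b (n : R) x : 0 <= box_bump a b n x.
Proof. exact: possq_ge0. Qed.

Lemma box_bump_in a b (n : R) x : box a b x -> box_bump a b n x = 1.
Proof.
move=> /box_sqdist_eq0 h; rewrite /box_bump h mulr0 subr0 /possq.
by rewrite (max_idPr _) ?expr1n.
Qed.

Lemma box_bump_out a b x : ~ box a b x -> \forall n \near \oo, box_bump a b n.+1%:R x = 0.
Proof.
move=> nx; have d0 : 0 < box_sqdist a b x.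
  by rewrite lt_def box_sqdist_ge0 andbT; apply/eqP => /box_sqdist_eq0.
near=> n; apply/eqP; rewrite possq_eq0 subr_le0 -ler_pdivrMr// div1r.
rewrite (@le_trans _ _ n%:R)// ?ler_nat//.
near: n; exact: nbhs_infty_ger.
Unshelve. all: by end_near. Qed.

Lemma C1c_box_bump a b (n : R) : 1 <= n -> C1c (box_bump a b n).
Proof.
move=> n1.
have [r rP] : exists r, forall x, ~ cube r x -> ~ box (\row_i (a ord0 i - 1)) (\row_i (b ord0 i + 1)) x.
  exists (`|a| + `|b| + 1) => x; apply: contra_not => h; apply/cubeP => i.
  have ha : `|a ord0 i| <= `|a|.
    exact: coord_le_norm.
  have hb : `|b ord0 i| <= `|b|.
    exact: coord_le_norm.
  have := h i; rewrite !mxE => /andP[h1 h2].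
  move: ha hb; rewrite !ler_norml => /andP[? ?] /andP[? ?].
  have := normr_ge0 a; have := normr_ge0 b => ? ?.
  by apply/andP; split; lra.
have cP : continuous (fun y : V => 1 - n * box_sqdist a b y).
  apply: continuous_fB; first exact: continuous_fcst.
  by apply: continuous_fM; [exact: continuous_fcst|exact: continuous_box_sqdist].
apply: (@C1cI _ (fun i x => 2 * Num.max 0 (1 - n * box_sqdist a b x) *
   (0 - n * (\sum_(j < N) ((2 * Num.max 0 (a ord0 j - x ord0 j)) * (- evec R i ord0 j)
     + (2 * Num.max 0 (x ord0 j - b ord0 j)) * evec R i ord0 j)))) r).
- exact: (continuous_fcomp continuous_possq).
- move=> i x; apply: (@is_derive_comp_real possq (fun y : V => 1 - n * box_sqdist a b y)).
    exact: is_derive_possq.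
  apply: is_deriveB; apply: is_deriveZ; exact: is_derive_box_sqdist.
- move=> i; apply: continuous_fM; first exact: (continuous_fcomp continuous_dpossq).
  apply: continuous_fB; first exact: continuous_fcst.
  apply: continuous_fM; first exact: continuous_fcst.
  apply: continuous_fsum => j; apply: continuous_fD; apply: continuous_fM; try exact: continuous_fcst;
  apply: (continuous_fcomp continuous_dpossq);
  apply: continuous_fB; try exact: continuous_fcst; exact: continuous_fcoord.
- by move=> x /rP nx; exact: box_bump_support.
Qed.

(** A smooth substitute for truncation to [[-1, 1]]. It fixes -1, 0 and 1 and is 2-Lipschitz, so
    composing with it turns an approximation of a sign function into one bounded by 1, at the cost
    of a factor 2. *)
Definition clip (s : R) : R := 2 * s / (1 + s ^+ 2).

Lemma clip_den (s : R) : 0 < 1 + s ^+ 2.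
Proof. by rewrite ltr_pwDl// sqr_ge0. Qed.

Lemma clip_le1 (s : R) : `|clip s| <= 1.
Proof.
have d := clip_den s.
rewrite /clip normrM normfV (gtr0_norm d) ler_pdivrMr// mul1r ler_norml.
by have := sqr_ge0 (s + 1); have := sqr_ge0 (s - 1) => ? ?; apply/andP; split; nra.
Qed.

Lemma clip_lipschitz (s t : R) : `|clip s - clip t| <= 2 * `|s - t|.
Proof.
have ds := clip_den s; have dt := clip_den t.
have -> : clip s - clip t = 2 * (s - t) * ((1 - s * t) / ((1 + s ^+ 2) * (1 + t ^+ 2))).
  by rewrite /clip; field; rewrite !gt_eqF.
rewrite normrM normrM [`|2|]ger0_norm// ler_piMr ?mulr_ge0//.
rewrite normrM normfV (gtr0_norm (mulr_gt0 ds dt)) ler_pdivrMr ?mulr_gt0// mul1r ler_norml.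
by apply/andP; split; nra.
Qed.

Lemma clipN1 : clip (-1) = -1. Proof. by rewrite /clip; field. Qed.
Lemma clip0 : clip 0 = 0. Proof. by rewrite /clip mulr0 mul0r. Qed.
Lemma clip1 : clip 1 = 1. Proof. by rewrite /clip; field. Qed.

Lemma is_derive_clip (s : R) :
  is_derive s (1 : R) clip (2 * (1 - s ^+ 2) / (1 + s ^+ 2) ^+ 2).
Proof.
have d := clip_den s.
pose g : R -> R := cst 1 + id ^+ 2.
have gs : g s = 1 + s ^+ 2 by [].
have hg : is_derive s (1 : R) g (0 + (2%:R * s ^+ 1) *: 1).
  by apply: is_deriveD; exact: (@is_deriveX _ _ id 2 s 1 1 (is_derive_id s 1)).
have g0 : g s != 0 by rewrite gs gt_eqF.
have := is_deriveM (is_deriveZ 2 (is_derive_id s (1 : R))) (is_deriveV g0 hg).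
rewrite (_ : (2 \*: id) * _ = clip) //.
move=> h; apply: (is_derive_eq h); rewrite gs /= /GRing.scale /=.
by field; rewrite gt_eqF.
Qed.

Lemma continuous_dclip : continuous (fun s : R => 2 * (1 - s ^+ 2) / (1 + s ^+ 2) ^+ 2).
Proof.
move=> s; have d := clip_den s.
have hX : (fun t : R => t ^+ 2) @ s --> s ^+ 2 by exact: exprn_continuous.
have hD : (fun t : R => 1 + t ^+ 2) @ s --> 1 + s ^+ 2 by apply: cvgD => //; exact: cvg_cst.
have hB : (fun t : R => 1 - t ^+ 2) @ s --> 1 - s ^+ 2 by apply: cvgB => //; exact: cvg_cst.
apply: cvgM; first by apply: cvgM => //; exact: cvg_cst.
apply: cvgV; first by rewrite gt_eqF// exprn_gt0.
exact: (cvgM hD hD).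
Qed.

Lemma C1c_clip phi : C1c phi -> C1c (clip \o phi).
Proof.
by move=> cp; apply: (C1c_comp is_derive_clip) => //; [exact: continuous_dclip|exact: clip0].
Qed.

End C1c_calculus.

(** * Elementary inequalities for real powers *)

Section powR_inequalities.
Context {R : realType}.
Implicit Types a b p q : R.

Lemma powR_le a b q : 0 <= q -> 0 <= a -> a <= b -> a `^ q <= b `^ q.
Proof.
by move=> q0 a0 ab; apply: ge0_ler_powR => //; rewrite nnegrE// (le_trans a0).
Qed.

Lemma powR_add_le a b q : 0 <= q -> 0 <= a -> 0 <= b ->
  (a + b) `^ q <= 2 `^ q * (a `^ q + b `^ q).
Proof.
move=> q0 a0 b0; wlog ab : a b a0 b0 / a <= b.
  by move=> h; case: (leP a b) => [/h->//|/ltW/h]; rewrite addrC [a `^ q + _]addrC; apply.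
rewrite (@le_trans _ _ ((2 * b) `^ q))//.
  by apply: powR_le => //; [rewrite addr_ge0|lra].
by rewrite powRM// ler_wpM2l ?powR_ge0// lerDr powR_ge0.
Qed.

Lemma le_1_powR a q : 1 <= q -> 0 <= a -> a <= 1 + a `^ q.
Proof.
move=> q1 a0; case: (leP a 1) => a1.
  by rewrite (le_trans a1)// lerDl powR_ge0.
by rewrite (le_trans (@le1r_powR _ a q (ltW a1) q1))// lerDr.
Qed.

Lemma powR_le_id a q : 1 <= q -> 0 <= a -> a <= 1 -> a `^ q <= a.
Proof.
move=> q1; rewrite le_eqVlt => /orP[/eqP <- _|a0 a1].
  by rewrite powR0// gt_eqF// (lt_le_trans ltr01).
by apply: ge1r_powR => //; rewrite a0.
Qed.

Lemma cvg_powR0 (u : nat -> R) q : 1 <= q -> (forall n, 0 <= u n) ->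
  u @ \oo --> 0 -> (fun n => u n `^ q) @ \oo --> 0.
Proof.
move=> q1 u0 cu.
apply: (@squeeze_cvgr _ _ _ _ (cst 0) u) => //; last exact: cvg_cst.
have : \forall n \near \oo, u n < 1 by apply: (cvgr_lt 0).
by apply: filterS => n /ltW un; rewrite powR_ge0 powR_le_id.
Qed.

End powR_inequalities.

(** * Local integrability and pairings with test functions *)

Section integration_against_test_functions.
Context {R : realType} {N : nat}.
Local Notation V := 'rV[R]_N.
Local Notation RN := (RN R N).
Variable mu : {measure set RN -> \bar R}.
Hypothesis hmu : is_lebesgue_RN mu.
Implicit Types (phi psi f g : V -> R) (v x : V).

Definition mfun_RN f := measurable_fun [set: RN] (f : RN -> R).
Definition itg f := mu.-integrable [set: RN] (EFin \o (f : RN -> R)).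

Definition locint f := mfun_RN f /\
  forall r : R, mu.-integrable (cube r) (EFin \o (f : RN -> R)).

Lemma measurable_cube (r : R) : measurable (cube r : set RN).
Proof. exact: measurable_box. Qed.

Lemma cube_fin (r : R) : (mu (cube r) < +oo)%E.
Proof. exact: lebesgue_RN_box_fin. Qed.

Lemma itg_ge0 f : mfun_RN f -> (forall x, 0 <= f x) ->
  (\int[mu]_x (f x)%:E < +oo)%E -> itg f.
Proof.
move=> mf f0 fi; apply/integrableP; split; first exact/measurable_EFinP.
by under eq_integral do rewrite /= ger0_norm//.
Qed.

Lemma mfun_powR f (q : R) : mfun_RN f -> mfun_RN (fun x => `|f x| `^ q).
Proof.
move=> mf; apply: (@measurableT_comp _ _ _ _ _ _ (fun t : R => t `^ q) _ (fun x : RN => `|f x|)).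
  exact: measurable_powR.
exact: measurableT_comp.
Qed.

Lemma Lp_itg (p : R) f : Lp mu p f -> itg (fun x => `|f x| `^ p).
Proof.
by move=> [mf fi]; apply: itg_ge0 => //; exact: mfun_powR.
Qed.

(** Cubes have finite measure and [|f| <= 1 + |f|^p]. *)
Lemma Lp_locint (p : R) f : 1 <= p -> Lp mu p f -> locint f.
Proof.
move=> p1 Lf; have [mf _] := Lf; split => // r.
have mc := measurable_cube r.
have i1 : mu.-integrable (cube r) (fun x : RN => (1 + `|f x| `^ p)%:E).
  apply: (@integrableD _ _ _ mu (cube r) mc (fun _ => 1%:E) (fun x : RN => (`|f x| `^ p)%:E)).
    apply: (@measurable_bounded_integrable _ _ _ mu (cst 1) (cube r)) => //.
      exact: cube_fin.
    by exists 1; split => // M M1 x _ /=; rewrite normr1 ltW.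
  apply: (@integrableS _ _ _ mu setT) => //; exact: Lp_itg.
apply: (le_integrable mc _ _ i1).
  by apply/measurable_EFinP; apply: measurable_funTS.
move=> x _ /=; rewrite lee_fin [leRHS]ger0_norm ?addr_ge0 ?powR_ge0//.
exact: le_1_powR.
Qed.

Lemma itg_mul_support f g (r M : R) : locint f -> mfun_RN g ->
  (forall x, `|g x| <= M) -> (forall x, ~ cube r x -> g x = 0) ->
  itg (fun x => f x * g x).
Proof.
move=> [mf fi] mg gM g0; have mc := measurable_cube r.
have E : EFin \o (fun x : RN => f x * g x) = (EFin \o (fun x : RN => f x * g x)) \_ (cube r).
  apply/funext => x /=; rewrite patchE; case: ifPn => //; rewrite notin_setE => /g0 ->.
  by rewrite mulr0.
rewrite /itg E; apply/(integrable_mkcond _ mc).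
have iM := integrableZl mc M (fi r).
apply: (le_integrable mc _ _ iM).
  by apply/measurable_EFinP; apply: measurable_funTS; exact: measurable_funM.
move=> x _ /=; rewrite lee_fin !normrM mulrC ler_wpM2r//.
by rewrite (le_trans (gM x))// ler_norm.
Qed.

Lemma itgD f g : itg f -> itg g -> itg (fun x => f x + g x).
Proof. by move=> hf hg; exact: (integrableD measurableT hf hg). Qed.

Lemma itgB f g : itg f -> itg g -> itg (fun x => f x - g x).
Proof. by move=> hf hg; exact: (integrableB measurableT hf hg). Qed.

Lemma itgZ (k : R) f : itg f -> itg (fun x => k * f x).
Proof. by move=> hf; exact: (integrableZl measurableT k hf). Qed.

Lemma itg_sum (I : Type) (s : seq I) (F : I -> V -> R) : (forall i, itg (F i)) ->
  itg (fun x => \sum_(i <- s) F i x).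
Proof.
move=> iF; elim: s => [|i s ih].
  by under eq_fun do rewrite big_nil; exact: integrable0.
by under eq_fun do rewrite big_cons; exact: itgD (iF i) ih.
Qed.

Lemma itg_le f g : mfun_RN f -> (forall x, `|f x| <= g x) -> itg g -> itg f.
Proof.
move=> mf fg ig; apply: (le_integrable measurableT _ _ ig); first exact/measurable_EFinP.
by move=> x _ /=; rewrite lee_fin (le_trans (fg x))// ler_norm.
Qed.

Lemma itg_mfun f : itg f -> mfun_RN f.
Proof. by move=> /integrableP[/measurable_EFinP]. Qed.

Lemma itg_norm f : itg f -> itg (fun x => `|f x|).
Proof. by move=> h; exact: (integrable_norm h). Qed.

Lemma EFin_Rint f : itg f -> (\int[mu]_x f x)%:E = (\int[mu]_x (f x)%:E)%E.
Proof. by move=> h; rewrite /Rintegral fineK//; exact: integrable_fin_num. Qed.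

Lemma itg_shift f v : itg f -> itg (fun x => f (x + v)).
Proof.
move=> /integrableP[/measurable_EFinP mf fi]; apply/integrableP; split.
  by apply/measurable_EFinP; exact: (measurableT_comp mf (measurable_shift_RN v)).
rewrite (@integral_shift _ _ _ hmu v (fun x => `|(f x)%:E|)%E)//.
by apply: measurableT_comp => //; exact/measurable_EFinP.
Qed.

Lemma Rint_shift f v : mfun_RN f -> \int[mu]_x f (x + v) = \int[mu]_x f x.
Proof.
move=> mf; rewrite /Rintegral; congr fine.
by apply: (@integral_shift _ _ _ hmu v (EFin \o f)); exact/measurable_EFinP.
Qed.

Lemma Lp_shift (p : R) f v : Lp mu p f -> Lp mu p (fun x => f (x + v)).
Proof.
move=> [mf fi]; split.
  exact: (measurableT_comp mf (measurable_shift_RN v)).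
rewrite (@integral_shift _ _ _ hmu v (fun x => (`|f x| `^ p)%:E)%E)//.
by apply/measurable_EFinP; exact: mfun_powR.
Qed.

Lemma Lp_lin (p a : R) f g : 0 <= p -> Lp mu p f -> Lp mu p g ->
  Lp mu p (fun x => a * f x + g x).
Proof.
move=> p0 Lf Lg; have [mf _] := Lf; have [mg _] := Lg.
have m1 : mfun_RN (fun x => a * f x + g x).
  by apply: measurable_funD => //; apply: measurable_funM => //; exact: measurable_cst.
split => //.
apply: integrable_lty => //.
have := itgZ (2 `^ p) (itgD (itgZ (`|a| `^ p) (Lp_itg Lf)) (Lp_itg Lg)).
apply: itg_le; first exact: mfun_powR.
move=> x; rewrite ger0_norm ?powR_ge0//.
rewrite -powRM// -normrM (le_trans _ (powR_add_le _ _ _))//.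
by apply: powR_le => //; exact: ler_normD.
Qed.

Lemma C1c_mfun phi : C1c phi -> mfun_RN phi.
Proof. by move=> [h _]; exact: measurable_continuous_RN. Qed.

Lemma C1c_dmfun phi (i : 'I_N) : C1c phi -> mfun_RN (fun x => 'D_(evec R i) phi x).
Proof. by move=> [_ [_ [h _]]]; exact: measurable_continuous_RN. Qed.

Lemma C1c_bounds phi : C1c phi -> exists r M : R, [/\ 0 < M,
  forall x, ~ cube r x -> phi x = 0, forall x, `|phi x| <= M,
  forall i x, ~ cube r x -> 'D_(evec R i) phi x = 0 &
  forall i x, `|'D_(evec R i) phi x| <= M].
Proof.
move=> cphi; have [r r0 rP] := C1c_support cphi.
have [M1 M10 M1P] := bounded_of_support (proj1 cphi) rP.
have dP i := derive_support i cphi rP.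
have hM i : exists M : R, 0 < M /\ forall x, `|'D_(evec R i) phi x| <= M.
  have [M M0 MP] := bounded_of_support (proj1 (proj2 (proj2 cphi)) i) (dP i).
  by exists M.
have [M2 M2P] := choice hM.
exists r, (M1 + \sum_i M2 i).
have s0 : 0 <= \sum_i M2 i by apply: sumr_ge0 => i _; have [/ltW] := M2P i.
split => //.
- by rewrite ltr_pwDl.
- by move=> x; rewrite (le_trans (M1P x))// lerDl.
- move=> i x; have [_ h] := M2P i; rewrite (le_trans (h x))// (bigD1 i)//= addrCA lerDl addr_ge0 ?(ltW M10)//.
  by apply: sumr_ge0 => j _; have [/ltW] := M2P j.
Qed.

Lemma itg_mul_C1c f phi : locint f -> C1c phi -> itg (fun x => f x * phi x).
Proof.
move=> lf cphi; have [r [M [M0 h1 h2 _ _]]] := C1c_bounds cphi.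
exact: (itg_mul_support lf (C1c_mfun cphi) h2 h1).
Qed.

Lemma itg_mul_dC1c f phi (i : 'I_N) : locint f -> C1c phi ->
  itg (fun x => f x * 'D_(evec R i) phi x).
Proof.
move=> lf cphi; have [r [M [M0 _ _ h1 h2]]] := C1c_bounds cphi.
exact: (itg_mul_support lf (C1c_dmfun i cphi) (h2 i) (h1 i)).
Qed.

Lemma pair_shift f phi v : locint f -> C1c phi ->
  \int[mu]_x (f (x + v) * phi x) = \int[mu]_x (f x * phi (x - v)).
Proof.
move=> [mf fi] cphi.
rewrite -(@Rint_shift (fun x => f x * phi (x - v)) v).
  by apply: eq_Rintegral => x _; rewrite addrK.
apply: measurable_funM => //.
exact: (measurableT_comp (C1c_mfun cphi) (measurable_shift_RN (- v))).
Qed.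

(** Differentiation under the integral: the translation acts on [phi] alone, so [f] only has to be
    locally integrable. *)
Lemma derive_pairing f phi (i : 'I_N) (s : R) : locint f -> C1c phi ->
  is_derive s (1 : R) (fun t : R => \int[mu]_x (f x * phi (x + t *: evec R i)))
    (\int[mu]_x (f x * 'D_(evec R i) phi (x + s *: evec R i))).
Proof.
move=> lf cphi; have [mf fi] := lf; have [r [M [M0 h1 h2 h3 h4]]] := C1c_bounds cphi.
pose F (t : R) (x : RN) : R := f x * phi ((x : V) + t *: evec R i).
(* For [t] within distance 1 of [s] the translated supports all stay in this cube, on which [M |f|]
   dominates the derivative of the integrand. *)
pose r' := r + `|s| + 1.
have cubeS (t : R) x : `]s - 1, s + 1[%classic t -> ~ cube r' x -> ~ cube r (x + t *: evec R i).
  rewrite /= in_itv /= => /andP[t1 t2]; apply: contra_not => /cubeP h; apply/cubeP => j.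
  have -> : x ord0 j = (x + t *: evec R i) ord0 j - t * evec R i ord0 j.
    by rewrite !mxE addrK.
  rewrite (le_trans (ler_normB _ _))// /r' -addrA lerD// normrM.
  have e1 : `|evec R i ord0 j| <= 1.
    by rewrite mxE eqxx /=; case: (j == i); rewrite ?normr1 ?normr0.
  rewrite (@le_trans _ _ (`|t| * 1))// ?ler_wpM2l// mulr1.
  have := ler_norm s; have := ler_norm (- s); rewrite normrN => ? ?.
  by rewrite ler_norml; apply/andP; split; lra.
have dF (t : R) (x : RN) : is_derive t (1 : R) (F ^~ x) (f x * 'D_(evec R i) phi ((x : V) + t *: evec R i)).
  rewrite /F; apply: is_deriveZ.
  have := is_derive_shift_line (C1c_is_derive i (t *: evec R i + x) cphi).
  by rewrite addrC; under eq_fun do rewrite addrC.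
have iG : itg (fun x => M * (`|f x| * \1_(cube r') x)).
  apply: itgZ; apply: (@itg_mul_support _ _ r' 1).
  - split; first exact: measurableT_comp.
    by move=> r0; exact: (integrable_norm (fi r0)).
  - exact: measurable_indic (measurable_cube r').
  - by move=> x; rewrite indicE; case: (_ \in _); rewrite ?normr1 ?normr0.
  - by move=> x nx; rewrite indicE memNset.
have Is : `]s - 1, s + 1[%classic s by rewrite /= in_itv /= ltrBlDr ltrDl ltr01.
have iF (t : R) : `]s - 1, s + 1[%classic t -> mu.-integrable setT (EFin \o F t).
  by move=> _; apply: itg_mul_C1c => //; exact: C1c_translate.
have dF' (t : R) (x : RN) : `]s - 1, s + 1[%classic t -> setT x -> derivable (F ^~ x) t 1.
  by move=> _ _; have [] := dF t x.
have G0 (x : RN) : 0 <= M * (`|f x| * \1_(cube r') x).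
  by rewrite !mulr_ge0// ltW.
have Gub (t : R) (x : RN) : `]s - 1, s + 1[%classic t -> setT x ->
    `|partial1of2 F t x| <= M * (`|f x| * \1_(cube r') x).
  move=> It _; rewrite partial1of2E (derive_val (is_derive := dF t x)) normrM.
  have [cx|ncx] := pselect (cube r' x).
    by rewrite indicE mem_set// mulr1 mulrC ler_wpM2r.
  by rewrite h3 ?normr0 ?mulr0 ?mulr_ge0 ?(ltW M0)//; exact: cubeS.
have d1 := derivable_under_integral measurableT Is iF dF' G0 iG Gub.
have d2 := differentiation_under_integral measurableT Is iF dF' G0 iG Gub.
split; first exact: d1.
rewrite -derive1E d2; apply: eq_Rintegral => x _.
by rewrite partial1of2E (derive_val (is_derive := dF s x)).
Qed.

Lemma dominated_cvg0_le (h : nat -> V -> R) (g : V -> R) :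
  (forall n, mfun_RN (h n)) -> (forall x, h ^~ x @ \oo --> 0) ->
  (forall n x, 0 <= h n x <= g x) -> itg g ->
  forall e : R, 0 < e -> exists n, (\int[mu]_x (h n x)%:E <= e%:E)%E.
Proof.
move=> mh h0 hg ig e e0.
have ih n : itg (h n).
  apply: itg_le ig => // x; have /andP[a b] := hg n x.
  by rewrite ger0_norm.
have := @dominated_cvg _ _ _ mu setT measurableT (fun n x => (h n x)%:E) (fun=> 0%E) (EFin \o g).
have H1 : forall n, measurable_fun [set: RN] (fun x : RN => (h n x)%:E).
  by move=> n; apply/measurable_EFinP; exact: mh.
have H2 : forall x : RN, setT x -> (fun n => (h n x)%:E) @ \oo --> 0%E.
  by move=> x _; apply: cvg_EFin; [exact: nearW|exact: h0].
have H3 : forall n (x : RN), setT x -> (`|(h n x)%:E| <= (EFin \o g) x)%E.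
  by move=> n x _; have /andP[a b] := hg n x; rewrite /= lee_fin ger0_norm.
move=> /(_ H1 H2 (fun _ _ => isT) ig H3); rewrite integral0 => /fine_cvgP[_].
move=> /cvgrPdist_le /(_ e e0) [n _ /(_ n (leqnn n))] /=.
rewrite sub0r normrN => hn; exists n.
rewrite -(fineK (integrable_fin_num measurableT (ih n))) lee_fin.
exact: le_trans (ler_norm _) hn.
Qed.

End integration_against_test_functions.

(** * Density of test functions in L^q *)

Section density_of_test_functions.
Import HBNNSimple.
Context {R : realType} {N : nat}.
Local Notation V := 'rV[R]_N.
Local Notation RN := (RN R N).
Variable mu : {measure set RN -> \bar R}.
Hypothesis hmu : is_lebesgue_RN mu.
Variable q : R.
Hypothesis q1 : 1 <= q.
Implicit Types (phi psi f g : V -> R) (v x : V).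

Let q0 : 0 <= q := le_trans ler01 q1.

(** The root is not taken. The triangle inequality then holds up to the factor [2 ^ q], which is
    harmless since the final constants are not sharp. *)
Definition normq f : \bar R := (\int[mu]_x (`|f x| `^ q)%:E)%E.

Definition lq_approx psi := mfun_RN psi /\ forall e : R, 0 < e ->
  exists phi, C1c phi /\ (normq (fun x => (phi x - psi x)%R) <= e%:E)%E.

Lemma normq_ge0 f : (0 <= normq f)%E.
Proof. by apply: integral_ge0 => x _; rewrite lee_fin powR_ge0. Qed.

Lemma normq_add f g : mfun_RN f -> mfun_RN g ->
  (normq (fun x => (f x + g x)%R) <= (2 `^ q)%:E * (normq f + normq g))%E.
Proof.
move=> mf mg.
have mE (h : V -> R) : mfun_RN h -> measurable_fun [set: RN] (fun x : RN => (`|h x| `^ q)%:E).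
  by move=> mh; apply/measurable_EFinP; exact: mfun_powR.
have E0 (h : V -> R) (x : RN) : setT x -> (0 <= (`|h x| `^ q)%:E)%E by rewrite lee_fin powR_ge0.
rewrite /normq -ge0_integralD//; try solve [exact: mE | exact: E0].
rewrite -ge0_integralZl//; last first.
- by move=> x _; rewrite adde_ge0// lee_fin powR_ge0.
- by apply: emeasurable_funD; exact: mE.
apply: le_integral_of_ge0 => x; first by rewrite lee_fin powR_ge0.
rewrite -EFinD -EFinM lee_fin (le_trans _ (powR_add_le _ _ _))//.
by apply: powR_le => //; exact: ler_normD.
Qed.

Lemma normqZ (k : R) f : mfun_RN f -> normq (fun x => k * f x)%R = ((`|k| `^ q)%:E * normq f)%E.
Proof.
move=> mf; rewrite /normq -ge0_integralZl//; last first.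
- by apply/measurable_EFinP; exact: mfun_powR.
by apply: eq_integral => x _; rewrite normrM powRM// EFinM.
Qed.

Lemma approx_closed psi : mfun_RN psi ->
  (forall e : R, 0 < e -> exists2 chi, lq_approx chi & (normq (fun x => (chi x - psi x)%R) <= e%:E)%E) ->
  lq_approx psi.
Proof.
move=> mpsi h; split => // e e0.
pose c : R := 2 `^ q.
have c0 : 0 < c by rewrite powR_gt0.
have e'0 : 0 < e / (c * 2) by rewrite divr_gt0// mulr_gt0.
have [chi [mchi /(_ _ e'0)[phi [cphi h1]]] h2] := h _ e'0.
exists phi; split => //.
rewrite (_ : (fun x => phi x - psi x) = (fun x => (phi x - chi x) + (chi x - psi x))); last first.
  by apply/funext => x; ring.
apply: le_trans (normq_add _ _) _.
- by apply: measurable_funB => //; exact: C1c_mfun.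
- exact: measurable_funB.
apply: (@le_trans _ _ (c%:E * ((e / (c * 2))%:E + (e / (c * 2))%:E))%E).
  by apply: lee_wpmul2l; [rewrite lee_fin ltW|exact: (leeD h1 h2)].
rewrite -EFinD -EFinM lee_fin; move: c c0 {e'0 h1 h2} => c c0.
by rewrite le_eqVlt; apply/orP; left; apply/eqP; field; rewrite gt_eqF.
Qed.

Lemma approx_lin (k : R) f g : lq_approx f -> lq_approx g -> lq_approx (fun x => k * f x + g x).
Proof.
move=> [mf hf] [mg hg]; split.
  by apply: measurable_funD => //; apply: measurable_funM => //; exact: measurable_cst.
move=> e e0.
pose c : R := 2 `^ q; pose K := `|k| `^ q.
have c0 : 0 < c by rewrite powR_gt0.
have K0 : 0 <= K by exact: powR_ge0.
have K1 : 0 < K + 1 by rewrite ltr_pwDr.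
pose e' := e / (c * (K + 1)).
have e1 : 0 < e' by rewrite divr_gt0// mulr_gt0.
have [phi [cphi h1]] := hf _ e1; have [psi [cpsi h2]] := hg _ e1.
exists (fun x => k * phi x + psi x); split; first exact: C1c_lin.
rewrite (_ : (fun x => _) = (fun x => k * (phi x - f x) + (psi x - g x))); last first.
  by apply/funext => x; ring.
have m1 : mfun_RN (fun x => phi x - f x) by apply: measurable_funB => //; exact: C1c_mfun.
apply: le_trans (normq_add _ _) _.
- by apply: measurable_funM => //; exact: measurable_cst.
- by apply: measurable_funB => //; exact: C1c_mfun.
rewrite normqZ// -/c -/K.
apply: (@le_trans _ _ (c%:E * (K%:E * e'%:E + e'%:E))%E).
  apply: lee_wpmul2l; first by rewrite lee_fin ltW.
  apply: (leeD _ h2); apply: (lee_wpmul2l _ h1); by rewrite lee_fin.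
have -> : (c%:E * (K%:E * e'%:E + e'%:E))%E = (c * (K * e' + e'))%:E.
  by rewrite [in RHS]EFinM [in RHS]EFinD [in RHS]EFinM.
rewrite lee_fin /e'; move: c c0 K K0 K1 {e' e1 h1 h2} => c c0 K K0 K1.
by rewrite le_eqVlt; apply/orP; left; apply/eqP; field; rewrite !gt_eqF.
Qed.

Lemma approx_zero : lq_approx (fun=> 0).
Proof.
split; first exact: measurable_cst.
move=> e e0; exists (fun=> 0); split; first exact: C1c_zero.
rewrite /normq; under eq_integral do rewrite subrr normr0 powR0 ?gt_eqF ?(lt_le_trans ltr01 q1)//.
by rewrite integral0 lee_fin ltW.
Qed.

Lemma mfun_indic (A : set RN) : measurable A -> mfun_RN (\1_A : RN -> R).
Proof. exact: measurable_indic. Qed.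

Lemma itg_indic (A : set RN) : measurable A -> (mu A < +oo)%E -> itg mu (\1_A : RN -> R).
Proof.
move=> mA fA; apply: itg_ge0; first exact: mfun_indic.
  by move=> x; rewrite indicE.
by rewrite integral_indic// setIT.
Qed.

Lemma approx_dominated psi (chi : nat -> V -> R) (g : V -> R) : mfun_RN psi ->
  (forall n, lq_approx (chi n)) -> (forall x, (fun n => `|chi n x - psi x|) @ \oo --> 0) ->
  (forall n x, `|chi n x - psi x| `^ q <= g x) -> itg mu g -> lq_approx psi.
Proof.
move=> mpsi hchi cchi hg ig; apply: approx_closed => // e e0.
have [|||n hn] := @dominated_cvg0_le _ _ mu (fun n x => `|chi n x - psi x| `^ q) g _ _ _ ig e e0.
- by move=> n; apply: mfun_powR; apply: measurable_funB => //; have [] := hchi n.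
- by move=> x; apply: cvg_powR0 => //; exact: cchi.
- by move=> n x; rewrite powR_ge0 hg.
by exists (chi n).
Qed.

Lemma approx_C1c phi : C1c phi -> lq_approx phi.
Proof.
move=> cphi; split; first exact: C1c_mfun.
move=> e e0; exists phi; split => //.
rewrite /normq; under eq_integral do rewrite subrr normr0 powR0 ?gt_eqF ?(lt_le_trans ltr01 q1)//.
by rewrite integral0 lee_fin ltW.
Qed.

Lemma approx_box (a b : V) : lq_approx (\1_(box a b) : RN -> R).
Proof.
pose B : set RN := box (\row_i (a ord0 i - 1)) (\row_i (b ord0 i + 1)).
have BB : box a b `<=` B.
  move=> x h i; have /andP[h1 h2] := h i; rewrite !mxE; apply/andP; split; lra.
apply: (@approx_dominated _ (fun n => box_bump a b n.+1%:R) (\1_B : RN -> R)).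
- exact: mfun_indic (measurable_box a b).
- by move=> n; apply: approx_C1c; apply: C1c_box_bump; rewrite ler1n.
- move=> x; apply: cvg_near_cst; have [hx|hx] := pselect (box a b x).
    by apply: nearW => n; rewrite box_bump_in// indicE mem_set// subrr normr0.
  have := box_bump_out hx; apply: filterS => n ->.
  by rewrite indicE memNset// subrr normr0.
- move=> n x; have n1 : 1 <= n.+1%:R :> R by rewrite ler1n.
  have [hx|hx] := pselect (B x).
    rewrite [in leRHS]indicE mem_set//=.
    have h1 := box_bump_ge0 a b n.+1%:R x.
    have h2 := @box_bump_le1 _ _ a b n.+1%:R x (ler0n _ _).
    have h3 : `|box_bump a b n.+1%:R x - \1_(box a b) x| <= 1.
      by rewrite indicE ler_norml; case: (_ \in _) => /=; apply/andP; split; lra.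
    exact: le_trans (powR_le_id q1 _ h3) h3.
  rewrite box_bump_support// indicE memNset; last by move=> /BB.
  by rewrite subrr normr0 powR0 ?indicE// gt_eqF// (lt_le_trans ltr01 q1).
- by apply: itg_indic; [exact: measurable_box|exact: lebesgue_RN_box_fin].
Qed.

Lemma indicI_setC (S B : set RN) :
  (\1_(~` S `&` B) : RN -> R) = (fun x => (-1) * \1_(S `&` B) x + \1_B x).
Proof.
apply/funext => x; rewrite !indicE !in_setI in_setC.
by case: (x \in S); case: (x \in B) => /=; ring.
Qed.

(** Dynkin induction on [S], starting from boxes. The fixed cube keeps everything of finite measure:
    complements become differences of approximable indicators, and disjoint unions are dominated by
    the indicator of the cube. *)
Lemma approx_indic_cube (r : R) (S : set RN) : measurable S ->
  lq_approx (\1_(S `&` cube r) : RN -> R).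
Proof.
pose P (S : set RN) := lq_approx (\1_(S `&` cube r) : RN -> R).
move=> mS; suff: forall S, <<s boxes >> S -> P S.
  by apply; rewrite -measurable_RN_boxesE.
apply: (@dynkin_induction _ RN boxes P measurable_RN_boxesE setI_closed_boxes).
- by rewrite /P setTI; exact: approx_box.
- move=> A [->|[a [b ->]]].
    by rewrite /P set0I indic0; exact: approx_zero.
  have hb1 : boxes (box a b) by right; exists a, b.
  have hb2 : boxes (cube r : set RN) by right; exists (const_mx (- r)), (const_mx r).
  rewrite /P; have [->|[c [d ->]]] := setI_closed_boxes hb1 hb2.
    by rewrite indic0; exact: approx_zero.
  exact: approx_box.
- move=> A mA hA; rewrite /P indicI_setC.
  exact: (@approx_lin (-1) (\1_(A `&` cube r) : RN -> R) (\1_(cube r) : RN -> R) hA (approx_box _ _)).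
- move=> F mF tF hF; rewrite /P.
  (* Partial unions. By disjointness each step adds exactly the indicator of [F n] inside the cube,
     so linearity carries the induction on [n]. *)
  pose G n : set RN := (\bigcup_(k < n) F k) `&` cube r.
  have mU n : measurable (\bigcup_(k < n) F k) by apply: bigcup_measurable.
  apply: (@approx_dominated _ (fun n => \1_(G n) : RN -> R) (\1_(cube r) : RN -> R)).
  + by apply: mfun_indic; apply: measurableI; [exact: bigcupT_measurable|exact: measurable_cube].
  + elim => [|n ih].
      by rewrite /G (_ : \bigcup_(k < 0) F k = set0) ?set0I ?indic0; [exact: approx_zero|apply/seteqP; split => // x []].
    rewrite (_ : (\1_(G n.+1) : RN -> R) = (fun x => 1 * \1_(G n) x + \1_(F n `&` cube r) x)); first exact: (@approx_lin 1 (\1_(G n) : RN -> R) (\1_(F n `&` cube r) : RN -> R) ih (hF n)).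
    apply/funext => x; rewrite mul1r !indicE.
    have [xn|xn] := pselect (F n x); have [xr|xr] := pselect (cube r x).
    * rewrite (@mem_set _ (G n.+1))//; last by split => //; exists n => /=.
      rewrite (@mem_set _ (F n `&` cube r))// memNset ?add0r//.
      move=> [[k /= kn Fk] _]; move/trivIsetP : tF => /(_ k n I I).
      rewrite (ltn_eqF kn) => /(_ isT) h; have : (F k `&` F n) x by [].
      by rewrite h.
    * by rewrite !memNset ?addr0//; move=> [].
    * rewrite (@memNset _ (F n `&` cube r)) ?addr0//; last by case.
      suff -> : (x \in G n.+1) = (x \in G n) by [].
      apply/idP/idP; rewrite !inE => -[[k /= kn Fk] _]; split => //.
        exists k => //=; rewrite ltn_neqAle -ltnS kn andbT; apply/eqP => kE.
        by apply: xn; rewrite -kE.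
      by exists k => //=; exact: ltnW.
    * by rewrite !memNset ?addr0//; move=> [].
  + move=> x; apply: cvg_near_cst.
    have [[[k _ Fk] xr]|nx] := pselect ((\bigcup_k F k `&` cube r) x).
      near=> n; rewrite !indicE !mem_set ?subrr ?normr0//.
        by split => //; exists k.
      split => //; exists k => //=; near: n; exact: nbhs_infty_gt.
    apply: nearW => n; rewrite !indicE !memNset ?subrr ?normr0//.
    by move=> [[k _ Fk] xr]; apply: nx; split => //; exists k.
  + move=> n x; rewrite (_ : \1_(cube r) x = `|\1_(cube r) x| `^ q); last first.
      by rewrite indicE; case: (_ \in _); rewrite ?normr1 ?powR1 ?normr0 ?powR0 ?gt_eqF ?(lt_le_trans ltr01 q1).
    apply: powR_le => //.
    have [xr|xr] := pselect (cube r x).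
      rewrite [in leRHS]indicE mem_set// normr1 !indicE ler_norml.
      by case: (_ \in _); case: (_ \in _) => /=; apply/andP; split; lra.
    by rewrite !indicE !memNset ?subrr ?normr0//; case.
  + by apply: itg_indic; [exact: measurable_cube|exact: cube_fin].
Unshelve. all: by end_near. Qed.

Lemma approx_sum (I : Type) (s : seq I) (c : I -> R) (F : I -> V -> R) :
  (forall i, lq_approx (F i)) -> lq_approx (fun x => \sum_(i <- s) c i * F i x).
Proof.
move=> hF; elim: s => [|i s ih].
  by under eq_fun do rewrite big_nil; exact: approx_zero.
rewrite (_ : (fun x => _) = (fun x => c i * F i x + (fun y => \sum_(j <- s) c j * F j y) x)).
  exact: approx_lin (hF i) ih.
by apply/funext => x; rewrite big_cons.
Qed.

Lemma approx_nonneg psi : mfun_RN psi -> (forall x, 0 <= psi x) ->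
  (normq psi < +oo)%E -> lq_approx psi.
Proof.
move=> mpsi psi0 npsi.
have mE : measurable_fun [set: RN] (EFin \o (psi : RN -> R)) by exact/measurable_EFinP.
pose sn n := nnsfun_approx measurableT mE n.
pose s n : V -> R := sn n.
have sle n x : s n x <= psi x.
  rewrite -lee_fin /s /sn nnsfun_approxE.
  by apply: (le_approx (f := EFin \o (psi : RN -> R)) (D := setT)) => // y _; rewrite /= lee_fin.
have scvg x : (fun n => s n x) @ \oo --> psi x.
  have /fine_cvgP[_] : (fun n => (s n x)%:E) @ \oo --> (psi x)%:E.
    have f0 (y : RN) : setT y -> (0 <= (EFin \o (psi : RN -> R)) y)%E by rewrite /= lee_fin.
    exact: (cvg_nnsfun_approx measurableT mE f0 I).
  exact.
(* Cutting off to growing cubes makes every level set bounded, the case settled by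
   [approx_indic_cube]. *)
pose chi n x := s n x * \1_(cube n%:R) x.
have chi0 n x : 0 <= chi n x by rewrite /chi mulr_ge0.
have chile n x : chi n x <= psi x.
  by rewrite /chi indicE; case: (_ \in _); rewrite ?mulr1 ?mulr0.
apply: (@approx_dominated _ chi (fun x => `|psi x| `^ q)) => //.
- move=> n; rewrite (_ : chi n = (fun x => \sum_(y <- finmap.enum_fset (fset_set (range (sn n)))) y * \1_((sn n @^-1` [set y]) `&` cube n%:R) x)).
    by apply: (@approx_sum _ _ id) => y; apply: approx_indic_cube; exact: measurable_sfunP.
  apply/funext => x; rewrite /chi /s (fimfunE (sn n) x) fsbig_finite//= mulr_suml.
  by apply: eq_bigr => y _; rewrite indicI -mulrA.
- move=> x; have [m hm] := cube_nat_cover x.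
  have h : (fun n => `|s n x - psi x|) @ \oo --> 0.
    rewrite -(normr0 R); apply: cvg_norm; rewrite -(subrr (psi x)).
    by apply: cvgB => //; exact: cvg_cst.
  apply: cvg_trans h; apply: near_eq_cvg; near=> n.
  rewrite /chi indicE mem_set ?mulr1//; apply: cube_subset hm.
  by rewrite ler_nat; near: n; exact: nbhs_infty_ge.
- move=> n x; apply: powR_le => //.
  rewrite distrC ger0_norm ?subr_ge0// ger0_norm// lerBlDr lerDl//.
- by apply: itg_ge0 => //; exact: mfun_powR.
Unshelve. all: by end_near. Qed.

Lemma approx_Lq psi : mfun_RN psi -> (normq psi < +oo)%E -> lq_approx psi.
Proof.
move=> mpsi npsi.
have E : psi = (fun x => (-1) * Num.max (- psi x) 0 + Num.max (psi x) 0).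
  by apply/funext => x; case: (leP (- psi x) 0); case: (leP (psi x) 0); lra.
rewrite E; apply: approx_lin; apply: approx_nonneg.
- by apply: measurable_maxr; [exact: measurable_funN|exact: measurable_cst].
- by move=> x; rewrite le_max lexx orbT.
- apply: le_lt_trans npsi; apply: le_integral_of_ge0 => x; first by rewrite lee_fin powR_ge0.
  rewrite lee_fin; apply: powR_le => //; case: (leP (- psi x) 0) => h; rewrite ?normr0//.
  by rewrite normrN.
- by apply: measurable_maxr => //; exact: measurable_cst.
- by move=> x; rewrite le_max lexx orbT.
- apply: le_lt_trans npsi; apply: le_integral_of_ge0 => x; first by rewrite lee_fin powR_ge0.
  by rewrite lee_fin; apply: powR_le => //; case: (leP (psi x) 0) => h; rewrite ?normr0.
Qed.

End density_of_test_functions.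

(** * Duality and difference quotients *)

Section duality.
Context {R : realType} {N : nat}.
Local Notation V := 'rV[R]_N.
Local Notation RN := (RN R N).
Variable mu : {measure set RN -> \bar R}.
Hypothesis hmu : is_lebesgue_RN mu.
Implicit Types (phi psi f g u : V -> R) (v x : V) (p q : R).

Lemma mfun_sgr u : mfun_RN u -> mfun_RN (fun x => Num.sg (u x)).
Proof.
move=> mu_; apply: (@measurableT_comp _ _ _ _ _ _ (fun t : R => Num.sg t) _ (u : RN -> R)) => //.
apply: nondecreasing_measurable => // s t st.
by case: (sgrP s); case: (sgrP t) => //; lra.
Qed.

Lemma sgr_norm_le1 (t : R) : `|Num.sg t| <= 1.
Proof. by rewrite normr_sg; case: (t != 0). Qed.

Lemma clip_sgr (t : R) : clip (Num.sg t) = Num.sg t.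
Proof. by case: sgrP => _; rewrite ?clip0 ?clip1 ?clipN1. Qed.

Lemma itg_abs1 u : Lp mu 1 u -> itg mu (fun x => `|u x|).
Proof.
move=> Lu; have := Lp_itg Lu.
by rewrite (_ : (fun x => _) = (fun x => `|u x|))//; apply/funext => x; rewrite powRr1.
Qed.

(** The ideal test function is the sign of [u]. It is approximated in L^1 on a large cube and then
    clipped to respect the bound 1. Since [u] may be unbounded, the L^1 error is only usable where
    [|u| <= n]; the rest of the mass of [u] is discarded by dominated convergence. *)
Lemma L1_norm_le_of_pairing (K : R) u : Lp mu 1 u ->
  (forall phi, C1c phi -> (forall x, `|phi x| <= 1) -> \int[mu]_x (u x * phi x) <= K) ->
  \int[mu]_x `|u x| <= K.
Proof.
move=> Lu hK; have iu := itg_abs1 Lu; have lu := Lp_locint hmu (lexx 1) Lu.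
have [mu_ _] := lu.
apply/ler_addgt0Pl => e' e'0; have e0 : 0 < e' / 2 by rewrite divr_gt0.
set e := e' / 2 in e0.
have ma : mfun_RN (fun x => `|u x|) by exact: measurableT_comp.
have mgt (n : nat) : measurable [set x : RN | n%:R < `|u x|].
  rewrite (_ : [set x | _] = [set: RN] `&` (fun x : RN => `|u x|) @^-1` `]n%:R, +oo[%classic).
    by apply: ma => //; exact: measurable_itv.
  by apply/seteqP; split => x /=; rewrite in_itv /= andbT // => -[].
pose bad (n : nat) : set RN := [set x : RN | n%:R < `|u x|].
(* The discarded mass. The factor 2 is the bound on [|clip (phi x) - psi x|], all that is known on
   [bad n]. *)
pose t (n : nat) x : R := `|u x| * \1_(~` cube n%:R) x + 2 * (`|u x| * \1_(bad n) x).
have mt n : mfun_RN (t n).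
  apply: measurable_funD; first apply: measurable_funM => //.
    by apply: measurable_indic; apply: measurableC; exact: measurable_cube.
  apply: measurable_funM; first exact: measurable_cst.
  by apply: measurable_funM => //; exact: measurable_indic (mgt n).
have t0 x : t ^~ x @ \oo --> 0.
  apply: cvg_near_cst; have [m hm] := cube_nat_cover x.
  near=> n.
  have h1 : cube n%:R x.
    apply: cube_subset hm; rewrite ler_nat; near: n; exact: nbhs_infty_ge.
  have h2 : ~ bad n x.
    move=> /= h; have : `|u x| <= n%:R by near: n; exact: nbhs_infty_ger.
    by rewrite leNgt h.
  by rewrite /t !indicE memNset ?memNset// !mulr0 addr0.
have tb n x : 0 <= t n x <= 3 * `|u x|.
  rewrite /t !indicE; have := normr_ge0 (u x).
  by case: (_ \in _); case: (_ \in _) => /= ?; apply/andP; split; lra.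
have [n hn] := dominated_cvg0_le mt t0 tb (itgZ 3 iu) e0.
have it : itg mu (t n).
  apply: itg_le (itgZ 3 iu) => // x.
  by have /andP[a b] := tb n x; rewrite ger0_norm.
pose psi x : R := Num.sg (u x) * \1_(cube n%:R) x.
have mpsi : mfun_RN psi.
  by apply: measurable_funM; [exact: mfun_sgr|exact: measurable_indic (measurable_cube _)].
have npsi : (normq mu 1 psi < +oo)%E.
  have := integrable_lty measurableT (itg_indic (measurable_cube n%:R) (cube_fin hmu n%:R)).
  apply: le_lt_trans; apply: le_integral_of_ge0 => x; first by rewrite lee_fin powR_ge0.
  rewrite lee_fin powRr1// /psi normrM indicE.
  by case: (_ \in _); rewrite ?normr1 ?normr0 ?mulr1 ?mulr0 ?sgr_norm_le1.
have [_ hap] := approx_Lq hmu (lexx 1) mpsi npsi.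
(* Off [bad n] the error is at most [n] times twice [dd], by the Lipschitz bound on [clip]; this
   tolerance makes its integral at most [e], also for [n = 0]. *)
have d0 : 0 < e / (2 * n%:R + 1) by rewrite divr_gt0// ltr_wpDl// mulr_ge0.
have [phi [cphi hphi]] := hap _ d0.
pose dd x : R := `|phi x - psi x|.
have mdd : mfun_RN dd by apply: measurableT_comp => //; apply: measurable_funB => //; exact: C1c_mfun.
have hdd : (\int[mu]_x (dd x)%:E <= (e / (2 * n%:R + 1))%:E)%E.
  apply: le_trans hphi; apply: le_integral_of_ge0 => x; first by rewrite lee_fin normr_ge0.
  by rewrite lee_fin powRr1.
have idd : itg mu dd.
  apply: itg_ge0 => //; first by move=> x; exact: normr_ge0.
  exact: le_lt_trans hdd (ltry _).
have pw x : `|u x| <= u x * (clip \o phi) x + (t n x + 2 * n%:R * dd x).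
  have ule : `|u x| = u x * psi x + `|u x| * \1_(~` cube n%:R) x.
    rewrite /psi !indicE in_setC; case: (_ \in _) => /=.
      by rewrite mulr1 mulr0 addr0 mulrC -normrEsg.
    by rewrite !mulr0 add0r mulr1.
  have h1 : u x * psi x <= u x * clip (phi x) + `|u x| * `|clip (phi x) - psi x|.
    rewrite -lerBlDl -mulrBr (le_trans (ler_norm _))// normrM distrC//.
  have cpsi : clip (psi x) = psi x.
    rewrite /psi indicE; case: (_ \in _); rewrite ?mulr1 ?mulr0 ?clip0//.
    exact: clip_sgr.
  have h2 : `|clip (phi x) - psi x| <= 2 * dd x by rewrite -cpsi; exact: clip_lipschitz.
  have h3 : `|clip (phi x) - psi x| <= 2.
    rewrite (le_trans (ler_normB _ _))// -[leRHS]/(1 + 1) lerD ?clip_le1//.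
    by rewrite -cpsi clip_le1.
  have h4 : `|u x| * `|clip (phi x) - psi x| <= 2 * (`|u x| * \1_(bad n) x) + 2 * n%:R * dd x.
    have dd0 : 0 <= dd x by exact: normr_ge0.
    have n0 : 0 <= n%:R :> R by [].
    have u0 := normr_ge0 (u x); have c0 := normr_ge0 (clip (phi x) - psi x).
    have [hb|hb] := pselect (bad n x).
      rewrite indicE mem_set// mulr1.
      have : `|u x| * `|clip (phi x) - psi x| <= `|u x| * 2 by rewrite ler_wpM2l.
      have := mulr_ge0 n0 dd0; lra.
    rewrite indicE memNset// !mulr0 add0r.
    have un : `|u x| <= n%:R by rewrite leNgt; apply/negP.
    rewrite (@le_trans _ _ (n%:R * (2 * dd x)))//; first exact: ler_pM.
    by rewrite mulrCA mulrA.
  by rewrite ule /t /=; lra.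
have cc : C1c (clip \o phi) by exact: C1c_clip.
have i1 : itg mu (fun x => u x * (clip \o phi) x) by exact: itg_mul_C1c.
have i2 : itg mu (fun x => 2 * n%:R * dd x) by exact: itgZ.
have i3 : itg mu (fun x => t n x + 2 * n%:R * dd x) by exact: itgD.
apply: le_trans (le_Rintegral measurableT iu (itgD i1 i3) (fun x _ => pw x)) _.
rewrite (RintegralD measurableT i1 i3) (RintegralD measurableT it i2) (RintegralZl _ measurableT idd).
have r1 : \int[mu]_x (u x * (clip \o phi) x) <= K.
  by apply: hK => // x; exact: clip_le1.
have r2 : \int[mu]_x t n x <= e by rewrite -lee_fin EFin_Rint.
have r3 : \int[mu]_x dd x <= e / (2 * n%:R + 1) by rewrite -lee_fin EFin_Rint.
have r4 : 2 * n%:R * \int[mu]_x dd x <= e.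
  rewrite (@le_trans _ _ (2 * n%:R * (e / (2 * n%:R + 1))))// ?ler_wpM2l ?mulr_ge0//.
  rewrite mulrA ler_pdivrMr ?ltr_wpDl ?mulr_ge0// mulrC ler_wpM2l ?(ltW e0)// lerDl//.
by rewrite /e in r2 r4 *; lra.
Unshelve. all: by end_near. Qed.

Lemma young_powR (a b p q : R) : 0 <= a -> 0 <= b -> 0 < p -> 0 < q ->
  p^-1 + q^-1 = 1 -> a * b <= a `^ p + b `^ q.
Proof.
move=> a0 b0 p0 q0 pq; rewrite (le_trans (conjugate_powR a0 b0 p0 q0 pq))//.
have ip : 0 < p^-1 by rewrite invr_gt0.
have iq : 0 < q^-1 by rewrite invr_gt0.
by apply: lerD; rewrite ler_piMr ?powR_ge0//; lra.
Qed.

(** The weight [k] makes one of the two terms as small as desired, so that it can be absorbed. *)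
Lemma young_powR_eps (k a b p q : R) : 0 < k -> 0 <= a -> 0 <= b -> 0 < p -> 0 < q ->
  p^-1 + q^-1 = 1 -> a * b <= k `^ p * a `^ p + k^-1 `^ q * b `^ q.
Proof.
move=> k0 a0 b0 p0 q0 pq.
have -> : a * b = (k * a) * (k^-1 * b) by field; rewrite gt_eqF.
by rewrite -!powRM ?invr_ge0 ?(ltW k0)// young_powR// mulr_ge0// ?invr_ge0 ltW.
Qed.

Lemma conjugate_exponent p : 1 < p -> let q := p / (p - 1) in
  [/\ 1 < q, p^-1 + q^-1 = 1 & (p - 1) * q = p].
Proof.
move=> p1; have p0 : 0 < p by rewrite (lt_trans ltr01).
have p10 : 0 < p - 1 by rewrite subr_gt0.
split.
- by rewrite ltr_pdivlMr// mul1r ltrBlDr ltrDl.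
- by field; rewrite !gt_eqF.
- by field; rewrite gt_eqF.
Qed.

(** The unnormalised hypothesis is what Young gives directly for a pairing with a function of L^p,
    and no homogeneity argument is needed. The extremal test function is [l sg(u) |u|^(p-1)]: its
    pairing with [u] is [l |u|^p] and its [q]-th power is [l^q |u|^p]. As [q > 1], a small [l] makes
    the second negligible against the first. *)
Lemma Lp_norm_le_of_pairing p : 1 < p -> exists2 C : R, 0 < C &
  forall (M : R) u, 0 <= M -> Lp mu p u ->
  (forall phi, C1c phi ->
    \int[mu]_x (u x * phi x) <= M + \int[mu]_x (`|phi x| `^ (p / (p - 1)))) ->
  \int[mu]_x (`|u x| `^ p) <= C * M.
Proof.
move=> p1; have [q1 pq pq'] := conjugate_exponent p1.
set q := p / (p - 1) in q1 pq pq' *.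
have p0 : 0 < p by rewrite (lt_trans ltr01).
have q0 : 0 < q by rewrite (lt_trans ltr01).
(* With [l ^ (q - 1) = 1 / (4 2^q)] the inequality is an equality. *)
have [l l0 hl] : exists2 l : R, 0 < l & 2 `^ q * l `^ q <= l / 4.
  pose b : R := (4 * 2 `^ q)^-1.
  have c0 : 0 < 2 `^ q :> R by rewrite powR_gt0.
  have b0 : 0 < b by rewrite invr_gt0 mulr_gt0.
  exists (b `^ (q - 1)^-1); first by rewrite powR_gt0.
  have q10 : 0 < q - 1 by rewrite subr_gt0.
  have l0' : 0 < b `^ (q - 1)^-1 by rewrite powR_gt0.
  rewrite -(mulr_powRB1 (ltW l0') q0) -powRrM mulVf ?gt_eqF// powRr1 ?(ltW b0)//.
  rewrite mulrCA /b ler_wpM2l ?(ltW l0')//.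
  by rewrite le_eqVlt; apply/orP; left; apply/eqP; field; rewrite gt_eqF.
(* The weight for Young, so that replacing [psi] by [phi] costs only a quarter of [l I]. *)
have [k k0 hk] : exists2 k : R, 0 < k & k `^ p = l / 4.
  exists ((l / 4) `^ p^-1); first by rewrite powR_gt0// divr_gt0.
  by rewrite -powRrM mulVf ?gt_eqF// powRr1// divr_ge0// ltW.
exists (2 / l); first by rewrite divr_gt0.
move=> M u M0 Lu hM; have iu := Lp_itg Lu; have [mu_ _] := Lu.
have lu := Lp_locint hmu (ltW p1) Lu.
set I := \int[mu]_x _.
pose psi x : R := l * (Num.sg (u x) * `|u x| `^ (p - 1)).
have mpsi : mfun_RN psi.
  apply: measurable_funM; first exact: measurable_cst.
  by apply: measurable_funM; [exact: mfun_sgr|exact: mfun_powR].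
have psiq x : `|psi x| `^ q = l `^ q * `|u x| `^ p.
  rewrite /psi normrM (gtr0_norm l0) powRM ?(ltW l0)//; congr (_ * _).
  have [->|u0] := eqVneq (u x) 0.
    by rewrite sgr0 mul0r normr0 !powR0 ?gt_eqF.
  by rewrite normrM normr_sg u0 mul1r ger0_norm ?powR_ge0// -powRrM pq'.
have upsi x : u x * psi x = l * `|u x| `^ p.
  by rewrite /psi mulrCA; congr (_ * _); rewrite mulrA [u x * _]mulrC -normrEsg mulr_powRB1.
have npsi : (normq mu q psi < +oo)%E.
  apply: integrable_lty => //.
  by under [X in integrable _ _ X]eq_fun do rewrite psiq; exact: itgZ.
have [_ hap] := approx_Lq hmu (ltW q1) mpsi npsi.
(* Of [l I], one quarter is absorbed by the power of [phi] and one by the error in the pairing; half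
   of it remains. The error terms are proportional to [d], which is arbitrary. *)
suff h (d : R) : 0 < d -> l / 2 * I <= M + (2 `^ q + k^-1 `^ q) * d.
  have : l / 2 * I <= M.
    apply/ler_addgt0Pr => e e0; have c0 : 0 < 2 `^ q + k^-1 `^ q by rewrite addr_gt0// powR_gt0// invr_gt0.
    have := h (e / (2 `^ q + k^-1 `^ q)); rewrite divr_gt0// => /(_ isT).
    by rewrite mulrCA divff ?gt_eqF// mulr1.
  move=> h'; rewrite (_ : I = 2 / l * (l / 2 * I)); last by field; rewrite gt_eqF.
  by rewrite ler_wpM2l// divr_ge0// ltW.
move=> d0; have [phi [cphi hphi]] := hap _ d0.
have mphi := C1c_mfun cphi.
pose dd x : R := `|phi x - psi x| `^ q.
have idd : itg mu dd.
  apply: itg_ge0; first by apply: mfun_powR; exact: measurable_funB.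
    by move=> x; exact: powR_ge0.
  exact: le_lt_trans hphi (ltry _).
have rdd : \int[mu]_x dd x <= d by rewrite -lee_fin EFin_Rint.
have iup : itg mu (fun x => u x * phi x) by exact: itg_mul_C1c.
have iphi : itg mu (fun x => `|phi x| `^ q).
  have := itgZ (2 `^ q) (itgD idd (itgZ (l `^ q) iu)).
  apply: itg_le; first exact: mfun_powR.
  move=> x; rewrite ger0_norm ?powR_ge0// -psiq /dd.
  rewrite (le_trans _ (powR_add_le _ _ _))// ?(ltW q0)//; apply: powR_le => //; first exact: ltW.
  by rewrite (le_trans _ (ler_normD _ _))// subrK.
have pw1 x : l * `|u x| `^ p <= u x * phi x + (k `^ p * `|u x| `^ p + k^-1 `^ q * dd x).
  rewrite -upsi -lerBlDl -mulrBr (le_trans (ler_norm _))// normrM distrC.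
  exact: young_powR_eps.
have i1 := itgD (itgZ (k `^ p) iu) (itgZ (k^-1 `^ q) idd).
have := le_Rintegral measurableT (itgZ l iu) (itgD iup i1) (fun x _ => pw1 x).
rewrite (RintegralD measurableT iup i1) (RintegralD measurableT (itgZ _ iu) (itgZ _ idd)).
rewrite !RintegralZl// -/I => e1.
have pw2 x : `|phi x| `^ q <= 2 `^ q * (dd x + l `^ q * `|u x| `^ p).
  rewrite -psiq /dd (le_trans _ (powR_add_le _ _ _))// ?(ltW q0)//; apply: powR_le => //; first exact: ltW.
  by rewrite (le_trans _ (ler_normD _ _))// subrK.
have i2 := itgD idd (itgZ (l `^ q) iu).
have := le_Rintegral measurableT iphi (itgZ (2 `^ q) i2) (fun x _ => pw2 x).
rewrite (RintegralZl _ measurableT i2) (RintegralD measurableT idd (itgZ _ iu)) RintegralZl// -/I => e2.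
have e3 := hM _ cphi.
have I0 : 0 <= I by apply: Rintegral_ge0 => x _; exact: powR_ge0.
have c1 : 0 <= 2 `^ q :> R by exact: powR_ge0.
have c2 : 0 <= k^-1 `^ q :> R by exact: powR_ge0.
have e4 : 2 `^ q * l `^ q * I <= l / 4 * I by rewrite ler_wpM2r.
have e5 : 2 `^ q * \int[mu]_x dd x <= 2 `^ q * d by rewrite ler_wpM2l.
have e6 : k^-1 `^ q * \int[mu]_x dd x <= k^-1 `^ q * d by rewrite ler_wpM2l.
move: e1 e2; rewrite hk mulrDr mulrA => e1 e2.
move: e1 e2 e3 e4 e5 e6 I0; rewrite -/I.
move: (\int[mu]_x (u x * phi x)) (\int[mu]_x dd x) (\int[mu]_x (`|phi x| `^ q)) I => A B D J.
clear; lra.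
Qed.

End duality.

(** * Increments and difference quotients *)

Section difference_quotients.
Context {R : realType} {N : nat}.
Local Notation V := 'rV[R]_N.
Local Notation RN := (RN R N).
Variable mu : {measure set RN -> \bar R}.
Hypothesis hmu : is_lebesgue_RN mu.
Implicit Types (phi psi f g u : V -> R) (v x h k : V) (p q : R).

Definition shift_normp p f h : \bar R := normq mu p (fun x => f (x + h) - f x).

Lemma shift_normp0 p f : 0 < p -> shift_normp p f 0 = 0%E.
Proof.
move=> p0; rewrite /shift_normp /normq.
under eq_integral do rewrite addr0 subrr normr0 powR0 ?gt_eqF//.
by rewrite integral0.
Qed.

Lemma mfun_shift f h : mfun_RN f -> mfun_RN (fun x => f (x + h)).
Proof. by move=> mf; exact: (measurableT_comp mf (measurable_shift_RN h)). Qed.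

Lemma shift_normpN p f h : mfun_RN f -> shift_normp p f (- h) = shift_normp p f h.
Proof.
move=> mf; rewrite /shift_normp /normq.
rewrite -(@ge0_integral_shift _ _ _ hmu h (fun x => (`|f (x - h) - f x| `^ p)%:E)).
- by apply: eq_integral => x _; rewrite addrK distrC.
- by apply/measurable_EFinP; apply: mfun_powR; apply: measurable_funB => //; exact: mfun_shift.
- by move=> x; rewrite lee_fin powR_ge0.
Qed.

Lemma shift_normpD p f h k : 1 <= p -> mfun_RN f ->
  (shift_normp p f (h + k) <= (2 `^ p)%:E * (shift_normp p f h + shift_normp p f k))%E.
Proof.
move=> p1 mf; have mh := mfun_shift h mf; have mk := mfun_shift k mf.
have -> : shift_normp p f h = normq mu p (fun x => (f (x + k + h) - f (x + k))%R).
  rewrite /shift_normp /normq.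
  rewrite -(@ge0_integral_shift _ _ _ hmu k (fun x => (`|f (x + h) - f x| `^ p)%:E))//.
  by apply/measurable_EFinP; apply: mfun_powR; exact: measurable_funB.
have -> : shift_normp p f (h + k) =
    normq mu p (fun x => ((f (x + k + h) - f (x + k)) + (f (x + k) - f x))%R).
  congr normq; apply/funext => x; rewrite [h + k]addrC addrA.
  move: (f _) (f _) (f _) => a c d; ring.
apply: normq_add => //; last exact: measurable_funB.
by apply: measurable_funB => //; exact: (mfun_shift k mh).
Qed.

(** The constant [K_n = (2^p + 1)^n n] is crude, chosen to satisfy [2^p (1 + K_n) <= K_(n+1)]; only
    its independence of [f] matters. *)
Lemma shift_normp_sum p f (I : Type) (s : seq I) (F : I -> V) (b : \bar R) :
  1 <= p -> mfun_RN f -> (0 <= b)%E ->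
  (forall i, (shift_normp p f (F i) <= b)%E) ->
  (shift_normp p f (\sum_(i <- s) F i) <= (((2 `^ p + 1) ^+ size s * (size s)%:R))%:E * b)%E.
Proof.
move=> p1 mf b0 hF; elim: s => [|i s ih].
  by rewrite big_nil shift_normp0 ?mulr0 ?mul0e// (lt_le_trans ltr01).
rewrite big_cons; apply: le_trans (shift_normpD _ _ p1 mf) _.
have c0 : 0 <= 2 `^ p :> R by exact: powR_ge0.
have k0 : 0 <= (2 `^ p + 1) ^+ size s * (size s)%:R by rewrite mulr_ge0// exprn_ge0// addr_ge0.
apply: (@le_trans _ _ ((2 `^ p)%:E * (b + ((2 `^ p + 1) ^+ size s * (size s)%:R)%:E * b))%E).
  by apply: lee_wpmul2l; [rewrite lee_fin|exact: (leeD (hF i) ih)].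
rewrite -{1}[b]mul1e -ge0_muleDl ?lee_fin// muleA -EFinD -EFinM.
apply: lee_wpmul2r => //; rewrite lee_fin /= exprS -mulrA.
have h1 : 1 <= (2 `^ p + 1) ^+ size s by rewrite exprn_ege1// lerDr.
rewrite ler_pM ?addr_ge0 ?lerDl//.
by rewrite -[(size s).+1%:R]natr1 mulrDr mulr1 addrC lerD2l.
Qed.

Lemma row_sum_evec h : h = \sum_(i <- enum 'I_N) (h ord0 i *: evec R i).
Proof.
rewrite big_enum /=; apply/rowP => j; rewrite summxE (bigD1 j)//= big1 ?addr0.
  by rewrite !mxE !eqxx mulr1.
by move=> i ij; rewrite !mxE [j == i]eq_sym (negbTE ij) andbF mulr0.
Qed.

Definition dquot f (i : 'I_N) (t : R) x : R := t^-1 * (f (x + t *: evec R i) - f x).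

Lemma mfun_dquot f (i : 'I_N) t : mfun_RN f -> mfun_RN (dquot f i t).
Proof.
move=> mf; apply: measurable_funM; first exact: measurable_cst.
by apply: measurable_funB => //; exact: mfun_shift.
Qed.

Lemma Lp_dquot p f (i : 'I_N) t : 1 <= p -> Lp mu p f -> Lp mu p (dquot f i t).
Proof.
move=> p1 Lf; have p0 : 0 <= p by rewrite (le_trans ler01).
have L1 := Lp_shift hmu (t *: evec R i) Lf.
have L0 : Lp mu p (fun=> 0).
  split; first exact: measurable_cst.
  under eq_integral do rewrite normr0 powR0 ?gt_eqF ?(lt_le_trans ltr01 p1)//.
  by rewrite integral0 ltry.
have := Lp_lin t^-1 p0 (Lp_lin (-1) p0 Lf L1) L0.
rewrite (_ : (fun x => _) = dquot f i t)//.
by apply/funext => x; rewrite /dquot addr0 mulN1r addrC.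
Qed.

Lemma shift_normp_dquot p f (i : 'I_N) t : 1 <= p -> t != 0 -> mfun_RN f ->
  shift_normp p f (t *: evec R i) = ((`|t| `^ p)%:E * normq mu p (dquot f i t))%E.
Proof.
move=> p1 t0 mf; rewrite -(normqZ mu p t (mfun_dquot i t mf)).
by apply: eq_integral => x _; rewrite /dquot mulrA divff// mul1r.
Qed.

(** A change of variables moves the difference to [phi], with the opposite sign of [t]. The term
    [0 *: evec R i] is kept so that both integrals are values, at [- t] and 0, of the function
    differentiated in [derive_pairing]. *)
Lemma pairing_dquot f phi (i : 'I_N) t : locint mu f -> C1c phi ->
  \int[mu]_x (dquot f i t x * phi x) =
  t^-1 * (\int[mu]_x (f x * phi (x + (- t) *: evec R i)) - \int[mu]_x (f x * phi (x + 0 *: evec R i))).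
Proof.
move=> lf cphi.
have lf' : locint mu (fun x => f (x + t *: evec R i)).
  have [mf fi] := lf; split; first exact: mfun_shift.
  move=> r; pose r' := r + `|t *: evec R i|.
  have ic : itg mu (fun x => f x * \1_(cube r') x).
    apply: (@itg_mul_support _ _ _ f (\1_(cube r')) r' 1) => //.
    + exact: measurable_indic (measurable_cube r').
    + by move=> x; rewrite indicE; case: (_ \in _); rewrite ?normr1 ?normr0.
    + by move=> x nx; rewrite indicE memNset.
  have mc : measurable (cube r : set RN) := measurable_cube r.
  have := itg_shift hmu (t *: evec R i) ic.
  move=> /(integrableS measurableT mc (@subsetT _ _)).
  apply: (eq_integrable mc) => x; rewrite inE => xr /=.
  rewrite indicE mem_set ?mulr1//; apply/cubeP => j; rewrite mxE.
  move/cubeP : xr => xr; rewrite (le_trans (ler_normD _ _))// lerD//.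
  exact: coord_le_norm.
have E : \int[mu]_x (dquot f i t x * phi x) =
    \int[mu]_x (t^-1 * (f (x + t *: evec R i) * phi x - f x * phi x)).
  by apply: eq_Rintegral => x _; rewrite /dquot; ring.
have i1 := itg_mul_C1c lf' cphi; have i2 := itg_mul_C1c lf cphi.
rewrite E (RintegralZl _ measurableT (itgB i1 i2)) (RintegralB measurableT i1 i2).
congr (_ * (_ - _)).
  by rewrite (pair_shift hmu (t *: evec R i) lf cphi); apply: eq_Rintegral => x _; rewrite scaleNr.
by apply: eq_Rintegral => x _; rewrite scale0r addr0.
Qed.

Lemma mvt_quotient (F dF : R -> R) (t : R) : t != 0 ->
  (forall s, is_derive s (1 : R) F (dF s)) ->
  exists s : R, t^-1 * (F (- t) - F 0) = - dF s.
Proof.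
move=> t0 hF.
have cF a b : {within `[a, b], continuous F}.
  by apply: continuous_subspaceT; exact: continuous_of_is_derive hF.
have [s hs] : exists s, F (- t) - F 0 = dF s * (- t).
  have [t1|t1|t1] := ltgtP t 0.
  - have [] := @MVT _ F dF 0 (- t); rewrite ?oppr_gt0// => s _ hs.
    by exists s; rewrite hs subr0.
  - have [] := @MVT _ F dF (- t) 0; rewrite ?oppr_lt0// => s _ hs.
    by exists s; rewrite -opprB hs sub0r opprK mulrN.
  - by rewrite t1 eqxx in t0.
by exists s; rewrite hs mulrN mulrN mulrCA mulVf// mulr1.
Qed.

Lemma is_derive_quotient_near (F : R -> R) (l : R) : is_derive (0 : R) (1 : R) F l ->
  forall e : R, 0 < e -> exists2 d : R, 0 < d & forall t, 0 < t < d ->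
  `|t^-1 * (F (- t) - F 0) + l| <= e.
Proof.
move=> [/cvg_ex[l' hl] dl] e e0.
have ll : l' = l by rewrite -dl; apply/esym/cvg_lim.
rewrite ll in hl; move/cvgrPdist_le : hl => /(_ e e0).
rewrite near_withinE => /nbhs_ballP[d /= d0 hd]; exists d => // t /andP[t0 td].
have := hd (- t); rewrite /ball /= sub0r opprK (gtr0_norm t0) => /(_ td).
rewrite oppr_eq0 gt_eqF// => /(_ isT) /=.
rewrite addr0 scaler1 invrN /GRing.scale /= mulNr opprK addrC.
exact.
Qed.

Lemma derive_translate phi (i : 'I_N) x v : C1c phi ->
  'D_(evec R i) (fun y => phi (y + v)) x = 'D_(evec R i) phi (x + v).
Proof.
move=> cphi.
by rewrite (derive_val (is_derive := is_derive_translate (C1c_is_derive i (x + v) cphi))).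
Qed.

(* [t |-> \int f(x) phi(x + t e_i) dx] is differentiable even though [f] is not, so the
   mean value theorem turns the difference quotient into a weak derivative. *)
Lemma pairing_dquot_mvt f phi (i : 'I_N) t : locint mu f -> C1c phi -> t != 0 ->
  exists s : R, \int[mu]_x (dquot f i t x * phi x) =
    - \int[mu]_x (f x * 'D_(evec R i) (fun y => phi (y + s *: evec R i)) x).
Proof.
move=> lf cphi t0; rewrite pairing_dquot//.
have [s hs] := mvt_quotient t0 (fun s => derive_pairing i s lf cphi).
exists s; rewrite hs; under [in RHS]eq_Rintegral do rewrite (derive_translate _ _ _ cphi).
by [].
Qed.

Lemma pairing_dquot_cvg f phi (i : 'I_N) : locint mu f -> C1c phi ->
  forall e : R, 0 < e -> exists2 d : R, 0 < d & forall t, 0 < t < d ->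
  `|\int[mu]_x (dquot f i t x * phi x) + \int[mu]_x (f x * 'D_(evec R i) phi x)| <= e.
Proof.
move=> lf cphi e e0.
have E : \int[mu]_x (f x * 'D_(evec R i) phi (x + 0 *: evec R i)) =
    \int[mu]_x (f x * 'D_(evec R i) phi x).
  by apply: eq_Rintegral => x _; rewrite scale0r addr0.
have := is_derive_quotient_near (derive_pairing i 0 lf cphi) e0; rewrite E.
move=> [d d0 hd]; exists d; first exact: d0.
move=> t ht; rewrite (pairing_dquot i t lf cphi); exact: (hd t ht).
Qed.

Lemma dquot_L1_le (K : R) f (i : 'I_N) t : Lp mu 1 f -> t != 0 ->
  (forall phi, C1c phi -> (forall x, `|phi x| <= 1) ->
    \int[mu]_x (f x * 'D_(evec R i) phi x) <= K) ->
  (shift_normp 1 f (t *: evec R i) <= (`|t| * K)%:E)%E.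
Proof.
move=> Lf t0 hK; have lf := Lp_locint hmu (lexx 1) Lf.
have Lu := Lp_dquot i t (lexx 1) Lf.
rewrite shift_normp_dquot//; last by case: lf.
rewrite powRr1// EFinM; apply: lee_wpmul2l; first by rewrite lee_fin.
rewrite (_ : normq mu 1 (dquot f i t) = (\int[mu]_x `|dquot f i t x|)%:E); last first.
  rewrite EFin_Rint; last exact: itg_abs1.
  by apply: eq_integral => x _; rewrite powRr1.
rewrite lee_fin; apply: (L1_norm_le_of_pairing hmu Lu) => phi cphi phi1.
have [s ->] := pairing_dquot_mvt i lf cphi t0.
(* The hypothesis is stable under translation and negation of the test function, so neither the
   unknown [s] nor the minus sign matters. *)
have cN : C1c (fun x => (-1) * phi (x + s *: evec R i) + 0).
  by apply: C1c_lin; [exact: C1c_translate|exact: C1c_zero].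
have cN1 x : `|(-1) * phi (x + s *: evec R i) + 0| <= 1 by rewrite addr0 mulN1r normrN.
apply: le_trans (hK _ cN cN1).
rewrite le_eqVlt; apply/orP; left; apply/eqP.
rewrite -[LHS]mulN1r -RintegralZl//; last first.
  by apply: itg_mul_dC1c => //; exact: C1c_translate.
apply: eq_Rintegral => x _; rewrite mulrCA; congr (_ * _).
have d1 := C1c_is_derive i x (C1c_translate (s *: evec R i) cphi).
have d2 := is_deriveD (is_deriveZ (-1) d1) (is_derive_cst (0 : R) x (evec R i)).
by rewrite (derive_val (is_derive := d2)) addr0 /GRing.scale /= mulN1r.
Qed.

Lemma dquot_Lp_le p : 1 < p -> exists2 C : R, 0 < C &
  forall f g (i : 'I_N) t, Lp mu p f -> Lp mu p g -> t != 0 ->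
  (forall phi, C1c phi ->
    \int[mu]_x (f x * 'D_(evec R i) phi x) = - \int[mu]_x (g x * phi x)) ->
  (shift_normp p f (t *: evec R i) <= (`|t| `^ p * (C * \int[mu]_x (`|g x| `^ p)))%:E)%E.
Proof.
move=> p1; have [C C0 HC] := Lp_norm_le_of_pairing hmu p1.
exists C => // f g i t Lf Lg t0 hg.
have lf := Lp_locint hmu (ltW p1) Lf; have lg := Lp_locint hmu (ltW p1) Lg.
have Lu := Lp_dquot i t (ltW p1) Lf.
rewrite shift_normp_dquot ?(ltW p1)//; last by case: lf.
rewrite EFinM; apply: lee_wpmul2l; first by rewrite lee_fin powR_ge0.
rewrite (_ : normq mu p (dquot f i t) = (\int[mu]_x (`|dquot f i t x| `^ p))%:E); last first.
  by rewrite EFin_Rint//; exact: Lp_itg.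
rewrite lee_fin; apply: HC => //.
  by apply: Rintegral_ge0 => x _; exact: powR_ge0.
move=> phi cphi; have [s ->] := pairing_dquot_mvt i lf cphi t0.
have ct := C1c_translate (s *: evec R i) cphi.
rewrite hg// opprK.
have [q1 pq _] := conjugate_exponent p1; set q := p / (p - 1) in q1 pq *.
have p0 : 0 < p by rewrite (lt_trans ltr01).
have q0 : 0 < q by rewrite (lt_trans ltr01).
have mq : mfun_RN (fun x => `|phi x| `^ q) by apply: mfun_powR; exact: C1c_mfun.
(* Translating [phi] leaves the integral of [|phi|^q] unchanged, so the unknown [s] from the mean
   value theorem disappears from the bound. *)
rewrite -(Rint_shift hmu (s *: evec R i) mq).
have i1 := Lp_itg Lg.
have i2 : itg mu (fun x => `|phi (x + s *: evec R i)| `^ q).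
  have [r [M [M0 h1 h2 _ _]]] := C1c_bounds ct.
  have ic := itg_indic (measurable_cube r) (cube_fin hmu r).
  apply: itg_le (itgZ (M `^ q) ic); first by apply: mfun_powR; exact: C1c_mfun.
  move=> x; rewrite ger0_norm ?powR_ge0// indicE.
  have [xr|xr] := pselect (cube r x).
    by rewrite mem_set// mulr1; apply: powR_le => //; exact: ltW.
  by rewrite memNset// mulr0 h1// normr0 powR0// gt_eqF.
rewrite -(RintegralD measurableT i1 i2).
apply: (le_Rintegral measurableT (itg_mul_C1c lg ct) (itgD i1 i2)) => x _.
rewrite (le_trans (ler_norm _))// normrM.
exact: young_powR.
Qed.

End difference_quotients.

(** * Weak derivatives from bounded difference quotients *)

Section uniform_convexity.
Context {R : realType}.
Implicit Types a b p t : R.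

(** The graph of [y^p] lies strictly above its tangent at 1. With [y = e^u] this says that
    [e^(p s) - p e^s] has a strict minimum at 0, which the sign of its derivative shows. *)
Lemma bernoulli_powR_strict p (y : R) : 1 < p -> 0 <= y -> y != 1 ->
  1 + p * (y - 1) < y `^ p.
Proof.
move=> p1 y0 y1; have p0 : 0 < p by rewrite (lt_trans ltr01).
move: y0; rewrite le_eqVlt => /orP[/eqP <-|y0].
  by rewrite powR0 ?gt_eqF// sub0r; lra.
pose u := ln y.
have yE : y = expR u by rewrite lnK.
have u0 : u != 0 by rewrite ln_eq0// .
rewrite yE; have -> : (expR u) `^ p = expR (p * u) by rewrite /powR gt_eqF ?expR_gt0// expRK.
pose h (s : R) := expR (p * s) - p * expR s.
have dh (s : R) : is_derive s (1 : R) h (p * (expR (p * s) - expR s)).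
  have d1 : is_derive s (1 : R) (fun s : R => p * s) p.
    by have := is_deriveZ p (is_derive_id s (1 : R)); rewrite /GRing.scale /= mulr1.
  have d2 := is_derive1_comp (is_derive_expR (p * s)) d1.
  have d3 := is_deriveB d2 (is_deriveZ p (is_derive_expR s)).
  by apply: (is_derive_eq d3); rewrite /GRing.scale /=; ring.
have ch a b : {within `[a, b], continuous h}.
  by apply: continuous_subspaceT; exact: continuous_of_is_derive dh.
have h0 : h 0 = 1 - p by rewrite /h mulr0 expR0 mulr1.
suff : h 0 < h u by rewrite h0 /h; lra.
have [un|up|ue] := ltgtP u 0.
- have [s] := @MVT _ h _ u 0 un (fun x _ => dh x) (ch _ _).
  rewrite in_itv /= => /andP[s1 s2] hs; rewrite -subr_lt0 hs sub0r.
  rewrite mulrN oppr_lt0 nmulr_rgt0//.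
  by rewrite pmulr_rlt0// subr_lt0 ltr_expR; nra.
- have [s] := @MVT _ h _ 0 u up (fun x _ => dh x) (ch _ _).
  rewrite in_itv /= => /andP[s1 s2] hs; rewrite -subr_gt0 hs subr0.
  by rewrite mulr_gt0// mulr_gt0// subr_gt0 ltr_expR; nra.
- by rewrite ue eqxx in u0.
Qed.

Lemma midpoint_powR_strict p t : 1 < p -> -1 <= t -> t < 1 ->
  `|(t + 1) / 2| `^ p < (`|t| `^ p + 1) / 2.
Proof.
move=> p1 t1 t2; have p0 : 0 < p by rewrite (lt_trans ltr01).
(* At [t = -1] one has [|t| = 1] and the tangent inequality used below is not strict; but there the
   left side vanishes. *)
have [->|tn1] := eqVneq t (-1).
  by rewrite addNr mul0r normr0 powR0 ?gt_eqF// normrN normr1 powR1; lra.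
have tgt : -1 < t by rewrite lt_neqAle eq_sym tn1.
(* The tangent inequality is applied at [|t| / c] and [1 / c], whose mean is 1, so the linear terms
   cancel in the sum. *)
pose c : R := (`|t| + 1) / 2.
have at1 : `|t| < 1 by rewrite ltr_norml tgt.
have at0 := normr_ge0 t.
have c0 : 0 < c by rewrite divr_gt0// ltr_wpDl.
apply: (@le_lt_trans _ _ (c `^ p)).
  apply: powR_le; [exact: ltW|exact: normr_ge0|].
  rewrite normrM [`|2^-1|]ger0_norm ?invr_ge0// ler_wpM2r ?invr_ge0//.
  by rewrite (le_trans (ler_normD _ _))// normr1.
have hy1 : `|t| / c != 1.
  by rewrite lt_eqF// ltr_pdivrMr// mul1r /c; lra.
have hz1 : 1 / c != 1.
  by rewrite gt_eqF// ltr_pdivlMr// mul1r /c; lra.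
have h1 := bernoulli_powR_strict p1 (divr_ge0 at0 (ltW c0)) hy1.
have h2 := bernoulli_powR_strict p1 (divr_ge0 ler01 (ltW c0)) hz1.
have e1 : `|t| `^ p = c `^ p * (`|t| / c) `^ p.
  by rewrite -powRM ?(ltW c0)// ?divr_ge0 ?(ltW c0)// mulrCA divff ?gt_eqF// mulr1.
have e2 : 1 = c `^ p * (1 / c) `^ p.
  by rewrite -powRM ?(ltW c0)// ?divr_ge0 ?(ltW c0)// mulrCA divff ?gt_eqF// mulr1 powR1.
have cp : 0 < c `^ p by rewrite powR_gt0.
rewrite e1 [X in (_ + X) / 2]e2 -mulrDr -mulrA ltr_pMr//.
have : `|t| / c + 1 / c = 2 by rewrite /c; field; rewrite gt_eqF// ltr_wpDl.
by nra.
Qed.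

Lemma continuous_powR_norm p : 0 < p -> continuous (fun t : R => `|t| `^ p).
Proof.
move=> p0 t; have [t0|t0] := eqVneq t 0.
  rewrite t0 /continuous_at normr0 powR0 ?gt_eqF//.
  apply/cvgrPdist_le => e e0.
  have ep : 0 < e `^ p^-1 by exact: powR_gt0.
  have hn : \forall s \near (0 : R), `|s| <= e `^ p^-1 by exact: nbhs0_le.
  apply: filterS hn => s hs.
  rewrite sub0r normrN ger0_norm ?powR_ge0//.
  move: hs => /(powR_le (ltW p0) (normr_ge0 s)) /le_trans; apply.
  by rewrite -powRrM mulVf ?gt_eqF// powRr1// ltW.
apply: (@continuous_comp _ _ _ (fun t : R => `|t|) (fun t => t `^ p)).
  exact: norm_continuous.
apply: differentiable_continuous; apply/derivable1_diffP.
by apply: derivable_powR; rewrite in_itv /= andbT normr_gt0.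
Qed.

(** Away from [t = 1] the convexity gap is continuous and positive on a compact interval, hence
    bounded below; near [t = 1] the left side is at most [th]. This qualitative argument treats all
    [p > 1] alike, where the Clarkson inequalities would distinguish [p < 2] from [p >= 2]. *)
Lemma uniform_convexity_unit p (th : R) : 1 < p -> 0 < th -> exists2 C : R, 0 <= C &
  forall t, -1 <= t <= 1 ->
  `|t - 1| `^ p <= th + C * ((`|t| `^ p + 1) / 2 - `|(t + 1) / 2| `^ p).
Proof.
move=> p1 th0; have p0 : 0 < p by rewrite (lt_trans ltr01).
(* [|t - 1| <= r] implies [|t - 1|^p <= th], and [r <= 1] keeps the interval [[-1, 1 - r]]
   nonempty. *)
pose r := Num.min 1 (th `^ p^-1).
have r0 : 0 < r by rewrite lt_min ltr01 powR_gt0.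
have r1 : r <= 1 by rewrite ge_min lexx.
pose G t := (`|t| `^ p + 1) / 2 - `|(t + 1) / 2| `^ p.
have cG : continuous G.
  move=> t; apply: cvgB.
    apply: cvgM; last exact: cvg_cst.
    by apply: cvgD; [exact: continuous_powR_norm|exact: cvg_cst].
  apply: (@continuous_comp _ _ _ (fun t : R => (t + 1) / 2) (fun t : R => `|t| `^ p)).
    apply: cvgM; last exact: cvg_cst.
    by apply: cvgD; [exact: cvg_id|exact: cvg_cst].
  exact: continuous_powR_norm.
have [c ci cm] := @EVT_min R G (-1) (1 - r) ltac:(lra) (continuous_subspaceT cG).
have Gc : 0 < G c.
  move: ci; rewrite in_itv /= => /andP[c1 c2].
  by rewrite subr_gt0 midpoint_powR_strict//; lra.
exists (2 `^ p / G c); first by rewrite divr_ge0 ?powR_ge0// ltW.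
move=> t /andP[t1 t2]; rewrite -/(G t).
have G0 : 0 <= G t.
  have [t3|t3] := ltP t 1; first by rewrite subr_ge0 ltW// midpoint_powR_strict.
  have -> : t = 1 by lra.
  rewrite /G normr1 powR1; have -> : (1 + 1) / 2 = 1 :> R by field.
  by rewrite normr1 powR1; lra.
have C0 : 0 <= 2 `^ p / G c by rewrite divr_ge0 ?powR_ge0// ltW.
have [t3|t3] := leP t (1 - r).
  have h : G c <= G t by apply: cm; rewrite in_itv /= t1 t3.
  rewrite (@le_trans _ _ (2 `^ p / G c * G t))//; last by rewrite lerDr ltW.
  rewrite (@le_trans _ _ (2 `^ p))//; last first.
    by rewrite mulrAC ler_pdivlMr// ler_wpM2l ?powR_ge0.
  by apply: powR_le; [exact: ltW|exact: normr_ge0|rewrite ler_norml; apply/andP; split; lra].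
rewrite (@le_trans _ _ th)//; last by rewrite lerDl mulr_ge0.
have : `|t - 1| <= th `^ p^-1.
  have : r <= th `^ p^-1 by rewrite ge_min lexx orbT.
  by rewrite ler_norml => ?; apply/andP; split; lra.
move=> /(powR_le (ltW p0) (normr_ge0 _)) /le_trans; apply.
by rewrite -powRrM mulVf ?gt_eqF// powRr1// ltW.
Qed.

(** By homogeneity, dividing by the larger of the two numbers. Being linear in the [p]-th powers,
    the inequality can be integrated and passes to L^p as it stands. *)
Lemma uniform_convexity_powR p (th : R) : 1 < p -> 0 < th -> exists2 C : R, 0 <= C &
  forall a b, `|a - b| `^ p <= th * (`|a| `^ p + `|b| `^ p) +
    C * ((`|a| `^ p + `|b| `^ p) / 2 - `|(a + b) / 2| `^ p).
Proof.
move=> p1 th0; have p0 : 0 < p by rewrite (lt_trans ltr01).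
have [C C0 HC] := uniform_convexity_unit p1 th0; exists C => //.
move=> a b; wlog ab : a b / `|a| <= `|b|.
  move=> h; case: (leP `|a| `|b|) => [/h//|/ltW/h].
  by rewrite distrC [`|b| `^ p + _]addrC [b + a]addrC.
have [b0|b0] := eqVneq b 0.
  have -> : a = 0 by apply/eqP; move: ab; rewrite b0 normr0 normr_le0.
  rewrite b0 subrr addr0 mul0r normr0 powR0 ?gt_eqF// addr0 mul0r subrr !mulr0 addr0//.
pose t := a / b.
have at_ : a = t * b by rewrite /t divfK.
have bn : 0 < `|b| by rewrite normr_gt0.
have ht : -1 <= t <= 1.
  by rewrite -ler_norml /t normrM normfV ler_pdivrMr// mul1r.
have B0 : 0 < `|b| `^ p by rewrite powR_gt0.
have e1 : `|a - b| `^ p = `|b| `^ p * `|t - 1| `^ p.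
  by rewrite -powRM// -normrM; congr (`|_| `^ p); rewrite at_; ring.
have e2 : `|a| `^ p = `|b| `^ p * `|t| `^ p by rewrite -powRM// -normrM at_ mulrC.
have e3 : `|(a + b) / 2| `^ p = `|b| `^ p * `|(t + 1) / 2| `^ p.
  by rewrite -powRM// -normrM; congr (`|_| `^ p); rewrite at_; ring.
rewrite e1 e2 e3.
have := HC t ht; set B := `|b| `^ p in B0 *; set T := `|t| `^ p; set S := `|(t + 1) / 2| `^ p; set U := `|t - 1| `^ p => h.
have T0 : 0 <= T by exact: powR_ge0.
have h2 : B * U <= B * (th + C * ((T + 1) / 2 - S)) by rewrite ler_pM2l.
have h3 : 0 <= B * (th * T) by rewrite mulr_ge0 ?mulr_ge0// ltW.
move: h2 h3; clear; nra.
Qed.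

End uniform_convexity.

(** * Completeness of L^p *)

Section weak_limits_in_Lp.
Context {R : realType} {N : nat}.
Local Notation V := 'rV[R]_N.
Local Notation RN := (RN R N).
Variable mu : {measure set RN -> \bar R}.
Hypothesis hmu : is_lebesgue_RN mu.
Implicit Types (phi psi f g u : V -> R) (x : V).

(** With [d k = 2 h 2^-k], the sequence [u - d] increases and [u + d] decreases; the limit lies
    between them, which gives the rate as well. *)
Lemma geometric_cauchy (u : nat -> R) (h : R) :
  (forall k, `|u k.+1 - u k| <= h * 2^-1 ^+ k) ->
  exists2 l : R, u @ \oo --> l & forall k, `|u k - l| <= 2 * h * 2^-1 ^+ k.
Proof.
move=> hu.
pose d k : R := 2 * h * 2^-1 ^+ k.
pose a k := u k - d k; pose b k := u k + d k.
have dS k : d k.+1 = d k / 2 by rewrite /d exprS; field.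
have hd k : h * 2^-1 ^+ k = d k / 2 by rewrite /d; field.
have d0 k : 0 <= d k by have := hu k; rewrite hd; have := normr_ge0 (u k.+1 - u k); lra.
have ha : nondecreasing_seq a.
  apply/nondecreasing_seqP => k; rewrite /a dS.
  by have := hu k; rewrite hd ler_norml => /andP[? ?]; lra.
have hb : nonincreasing_seq b.
  apply/nonincreasing_seqP => k; rewrite /b dS.
  by have := hu k; rewrite hd ler_norml => /andP[? ?]; lra.
have ab j k : a j <= b k.
  have h1 := ha j _ (leq_maxl j k); have h2 := hb k _ (leq_maxr j k).
  have : a (maxn j k) <= b (maxn j k) by rewrite /a /b; have := d0 (maxn j k); lra.
  by move: h1 h2; lra.
have ua : has_ubound (range a) by exists (b 0%N) => _ [j _ <-].
have ca := nondecreasing_cvgn ha ua.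
set l := sup (range a) in ca.
have cd : d @ \oo --> 0.
  rewrite -(mulr0 (2 * h)); apply: cvgMr; apply: cvg_expr.
  by rewrite ger0_norm ?invr_ge0// invf_lt1// ltr1n.
have cu : u @ \oo --> l.
  rewrite (_ : u = (fun k => a k + d k)); last by apply/funext => k; rewrite /a subrK.
  by rewrite -[l]addr0; apply: cvgD.
exists l => // k.
have l1 : a k <= l by apply: ub_le_sup => //; exists k.
have l2 : l <= b k by apply: ge_sup; [by exists (a 0%N), 0%N|move=> _ [j _ <-]; exact: ab].
by rewrite -/(d k) ler_norml; move: l1 l2; rewrite /a /b => ? ?; apply/andP; split; lra.
Qed.

Lemma sum_half_le2 (n : nat) : \sum_(0 <= k < n) (2^-1 ^+ k : R) <= 2.
Proof.
have h : \sum_(0 <= k < n) (2^-1 ^+ k : R) = 2 - 2 * 2^-1 ^+ n.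
  elim: n => [|n ih]; first by rewrite big_geq// expr0 mulr1 subrr.
  by rewrite big_nat_recr//= ih exprS; field.
by rewrite h gerBl mulr_ge0// exprn_ge0// invr_ge0.
Qed.

Variable p : R.
Hypothesis p1 : 1 <= p.

Let p0 : 0 < p := lt_le_trans ltr01 p1.

Lemma fast_subsequence (u : nat -> V -> R) :
  (forall d : R, 0 < d -> exists n0 : nat, forall n m, (n0 <= n)%N -> (n0 <= m)%N ->
    (normq mu p (fun x => (u n x - u m x)%R) <= d%:E)%E) ->
  forall d : nat -> R, (forall k, 0 < d k) ->
  exists s : nat -> nat, (forall k, (k <= s k)%N) /\
    forall k, (normq mu p (fun x => (u (s k.+1) x - u (s k) x)%R) <= (d k)%:E)%E.
Proof.
move=> hu d d0.
have [n0 hn0] := choice (fun k => hu _ (d0 k)).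
(* Summing the thresholds makes [s] nondecreasing while staying above each [n0 k]. *)
pose s k := (k + \sum_(j < k.+1) n0 j)%N.
exists s; split; first by move=> k; exact: leq_addr.
have h1 k : (n0 k <= s k)%N by rewrite /s big_ord_recr /= addnA leq_addl.
have h2 k : (s k <= s k.+1)%N.
  by rewrite /s [X in (_ <= _ + X)%N]big_ord_recr /= leq_add// leq_addr.
by move=> k; apply: hn0; rewrite ?h1// (leq_trans (h1 k)).
Qed.

(** Closeness to [g] is claimed only for some arbitrarily late [n]: a subsequence is enough for the
    later use, and no passage back to the full sequence is made. *)
Lemma Lp_complete (u : nat -> V -> R) : (forall n, Lp mu p (u n)) ->
  (forall d : R, 0 < d -> exists n0 : nat, forall n m, (n0 <= n)%N -> (n0 <= m)%N ->
    (normq mu p (fun x => (u n x - u m x)%R) <= d%:E)%E) ->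
  exists g, mfun_RN g /\ forall (d : R) (n0 : nat), 0 < d ->
    exists2 n, (n0 <= n)%N & (normq mu p (fun x => (u n x - g x)%R) <= d%:E)%E.
Proof.
move=> Lu hu.
(* The increments are required to be so small that, even after multiplication by [2^k], their [p]-th
   powers have integrals at most [2^-k], with sum at most 2. *)
pose c k : R := 2 ^+ k.
have c0 k : 0 < c k by rewrite exprn_gt0.
have ci k : (c k)^-1 = 2^-1 ^+ k by rewrite /c exprVn.
pose d k : R := 2^-1 ^+ k / (c k) `^ p.
have d0 k : 0 < d k by rewrite divr_gt0 ?powR_gt0// exprn_gt0// invr_gt0.
have [s [sk hs]] := fast_subsequence hu d0.
pose w k : V -> R := u (s k).
have mw k : mfun_RN (w k) by have [] := Lu (s k).
pose v k : V -> R := fun x => c k * (w k.+1 x - w k x).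
have mv k : mfun_RN (v k).
  by apply: measurable_funM; [exact: measurable_cst|exact: (measurable_funB (mw k.+1) (mw k))].
have mvE k : measurable_fun [set: RN] (fun x : RN => (`|v k x| `^ p)%:E).
  by apply/measurable_EFinP; exact: mfun_powR.
have v0 k (x : RN) : (0 <= (`|v k x| `^ p)%:E)%E by rewrite lee_fin powR_ge0.
(* [H] controls every increment of the subsequence: [|w_k+1 - w_k| <= 2^-k H^(1/p)], which
   gives both the pointwise limit and the rate of convergence in L^p. *)
pose H (x : RN) : \bar R := (\sum_(k <oo) (`|v k x| `^ p)%:E)%E.
have mH : measurable_fun [set: RN] H.
  have := @ge0_emeasurable_sum _ RN R setT (fun k (x : RN) => (`|v k x| `^ p)%:E) xpredT (fun k x _ _ => v0 k x) (fun k _ => mvE k).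
  exact.
have H0 x : (0 <= H x)%E by apply: nneseries_ge0 => k _ _; exact: v0.
have vH k x : ((`|v k x| `^ p)%:E <= H x)%E.
  have := @nneseries_lim_ge R (fun k => (`|v k x| `^ p)%:E) xpredT 0 k.+1 (fun n _ _ => v0 n x).
  apply: le_trans; rewrite big_nat_recr//= leeDr// sume_ge0// => i _; exact: v0.
have nv k : (normq mu p (v k) <= (2^-1 ^+ k)%:E)%E.
  rewrite normqZ; last exact: (measurable_funB (mw k.+1) (mw k)).
  rewrite (gtr0_norm (c0 k)).
  have := lee_wpmul2l _ (hs k) => /(_ ((c k) `^ p)%:E); rewrite lee_fin powR_ge0 => /(_ isT) /le_trans; apply.
  by rewrite -EFinM lee_fin /d mulrCA divff ?gt_eqF ?powR_gt0// mulr1.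
have IH : (\int[mu]_x H x <= 2%:E)%E.
  rewrite /H integral_nneseries//.
  apply: lime_le; first by apply: is_cvg_nneseries => n _ _; exact: normq_ge0.
  apply: nearW => n; apply: (@le_trans _ _ (\sum_(0 <= k < n) (2^-1 ^+ k)%:E)%E).
    by apply: lee_sum => k _; exact: nv.
  by rewrite sumEFin lee_fin sum_half_le2.
(* Where [H] is infinite the limit is set to 0. No null set has to be removed: the pointwise bound
   by a multiple of [H] holds trivially there. *)
pose good : set RN := [set x | (H x < +oo)%E].
have mgood : measurable good.
  by rewrite -[X in measurable X]setTI; exact: emeasurable_fun_infty_o.
pose w' k x : R := w k x * \1_good x.
have geo x : exists l : R, w' ^~ x @ \oo --> l /\
    (good x -> forall k, `|w k x - l| <= 2 * (fine (H x)) `^ p^-1 * 2^-1 ^+ k).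
  have [gx|gx] := pselect (good x); last first.
    exists 0; split => //; apply: cvg_near_cst; apply: nearW => k.
    by rewrite /w' indicE memNset// mulr0.
  have Hf : H x \is a fin_num by rewrite ge0_fin_numE.
  have hw k : `|w k.+1 x - w k x| <= (fine (H x)) `^ p^-1 * 2^-1 ^+ k.
    have := vH k x; rewrite -[X in (_ <= X)%E](fineK Hf) lee_fin.
    have pi0 : 0 <= p^-1 by rewrite invr_ge0 ltW.
    move=> /(powR_le pi0 (powR_ge0 _ _)).
    rewrite -powRrM mulfV ?gt_eqF// powRr1// /v normrM (gtr0_norm (c0 k)) => h.
    by rewrite -ci mulrC ler_pdivlMl.
  have [l cl hl] := geometric_cauchy hw.
  exists l; split; last by move=> _.
  by rewrite (_ : w' ^~ x = w ^~ x)//; apply/funext => k; rewrite /w' indicE mem_set// mulr1.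
have [g hg] := choice geo.
have mg : mfun_RN g.
  apply: (@measurable_fun_cvg _ RN R setT w' g); last by move=> x _; have [] := hg x.
  have mi : mfun_RN (\1_good : RN -> R) by exact: mfun_indic.
  by move=> k; exact: (measurable_funM (mw k) mi).
exists g; split => // e n0 e0.
have key k : (normq mu p (fun x => (w k x - g x)%R) <= ((2 * 2^-1 ^+ k) `^ p * 2)%:E)%E.
  apply: (@le_trans _ _ (\int[mu]_x (((2 * 2^-1 ^+ k) `^ p)%:E * H x))%E).
    apply: le_integral_of_ge0 => x; first by rewrite lee_fin powR_ge0.
    have h0 : 0 <= 2 * 2^-1 ^+ k :> R by rewrite mulr_ge0// exprn_ge0// invr_ge0.
    have [gx|gx] := pselect (good x); last first.
      have -> : H x = +oo%E by apply/eqP; rewrite -leye_eq leNgt; apply/negP.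
      rewrite gt0_muley ?leey// lte_fin powR_gt0// mulr_gt0// exprn_gt0// invr_gt0//.
    have Hf : H x \is a fin_num by rewrite ge0_fin_numE.
    rewrite -(fineK Hf) -EFinM lee_fin.
    have [_ /(_ gx k) h] := hg x.
    have := powR_le (ltW p0) (normr_ge0 _) h => /le_trans; apply.
    rewrite -mulrA [_ `^ p^-1 * _]mulrC mulrA powRM// ?powR_ge0//.
    by rewrite -powRrM mulVf ?gt_eqF// powRr1// fine_ge0.
  rewrite ge0_integralZl//.
  by rewrite EFinM; apply: lee_wpmul2l => //; rewrite lee_fin powR_ge0.
have cv : (fun k : nat => (2 * 2^-1 ^+ k) `^ p * 2 : R) @ \oo --> 0.
  rewrite -(mul0r 2); apply: cvgMl; apply: cvg_powR0.
  - exact: p1.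
  - by move=> n /=; rewrite mulr_ge0// exprn_ge0// invr_ge0.
  have h : (fun k : nat => 2^-1 ^+ k : R) @ \oo --> 0.
    by apply: cvg_expr; rewrite ger0_norm ?invr_ge0// invf_lt1// ltr1n.
  by rewrite -(mulr0 2); apply: (@cvgMr R nat _ _ _ 2 0); exact: h.
have [k0 _ hk0] : \forall k \near \oo, (2 * 2^-1 ^+ k) `^ p * 2 <= e by apply: (cvgr_le 0).
have hk := hk0 (maxn k0 n0) (leq_maxl _ _).
exists (s (maxn k0 n0)); first by rewrite (leq_trans _ (sk _))// leq_maxr.
by apply: le_trans (key _) _; rewrite lee_fin.
Qed.

End weak_limits_in_Lp.

(** * Weak derivatives of functions with bounded difference quotients *)

Section weak_derivative_from_difference_quotients.
Context {R : realType} {N : nat}.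
Local Notation V := 'rV[R]_N.
Local Notation RN := (RN R N).
Variable mu : {measure set RN -> \bar R}.
Hypothesis hmu : is_lebesgue_RN mu.
Implicit Types (phi psi f g u : V -> R) (x : V).
Variable p : R.
Hypothesis p1 : 1 < p.

Let p0 : 0 < p := lt_trans ltr01 p1.
Let p1' : 1 <= p := ltW p1.

Definition powint u : R := \int[mu]_x (`|u x| `^ p).

Lemma normq_powint u : Lp mu p u -> normq mu p u = (powint u)%:E.
Proof. by move=> Lu; rewrite EFin_Rint//; exact: Lp_itg. Qed.

Lemma powint_ge0 u : 0 <= powint u.
Proof. by apply: Rintegral_ge0 => x _; exact: powR_ge0. Qed.

Lemma LpB u w : Lp mu p u -> Lp mu p w -> Lp mu p (fun x => u x - w x).
Proof.
move=> Lu Lw; have := Lp_lin (-1) (ltW p0) Lw Lu.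
by rewrite (_ : (fun x => _) = (fun x => u x - w x))//; apply/funext => x; ring.
Qed.

Lemma Lp_half u w : Lp mu p u -> Lp mu p w -> Lp mu p (fun x => (u x + w x) / 2).
Proof.
move=> Lu Lw; have := Lp_lin 2^-1 (ltW p0) (Lp_lin 1 (ltW p0) Lu Lw) (LpB Lu Lu).
by rewrite (_ : (fun x => _) = (fun x => (u x + w x) / 2))//; apply/funext => x; ring.
Qed.

Lemma powint_uniform_convexity (th : R) : 0 < th -> exists2 C : R, 0 <= C &
  forall u w, Lp mu p u -> Lp mu p w ->
  powint (fun x => u x - w x) <= th * (powint u + powint w) +
    C * ((powint u + powint w) / 2 - powint (fun x => (u x + w x) / 2)).
Proof.
move=> th0; have [C C0 HC] := uniform_convexity_powR p1 th0.
exists C => // u w Lu Lw.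
have iu := Lp_itg Lu; have iw := Lp_itg Lw.
have id := Lp_itg (LpB Lu Lw); have im := Lp_itg (Lp_half Lu Lw).
have iuw := itgD iu iw.
have i3 : itg mu (fun x => C * (2^-1 * (`|u x| `^ p + `|w x| `^ p) - `|(u x + w x) / 2| `^ p)).
  by apply: itgZ; apply: itgB => //; exact: itgZ.
have i4 := itgB (itgZ 2^-1 iuw) im.
have pw x : `|u x - w x| `^ p <= th * (`|u x| `^ p + `|w x| `^ p) +
    C * (2^-1 * (`|u x| `^ p + `|w x| `^ p) - `|(u x + w x) / 2| `^ p).
  by rewrite [2^-1 * _]mulrC; exact: HC.
have := le_Rintegral measurableT id (itgD (itgZ th iuw) i3) (fun x _ => pw x).
rewrite (RintegralD measurableT (itgZ th iuw) i3) (RintegralZl _ measurableT iuw).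
rewrite (RintegralZl _ measurableT i4) (RintegralB measurableT (itgZ 2^-1 iuw) im).
rewrite (RintegralZl _ measurableT iuw) (RintegralD measurableT iu iw).
by rewrite [2^-1 * _]mulrC.
Qed.

Lemma pairing_close u g phi (e : R) : Lp mu p u -> Lp mu p g -> C1c phi -> 0 < e ->
  exists2 d : R, 0 < d & forall w, Lp mu p w -> powint (fun x => w x - g x) <= d ->
    `|\int[mu]_x (w x * phi x) - \int[mu]_x (g x * phi x)| <= e.
Proof.
move=> _ Lg cphi e0; have [q1 pq _] := conjugate_exponent p1.
set q := p / (p - 1) in q1 pq.
have q0 : 0 < q by rewrite (lt_trans ltr01).
have iphi : itg mu (fun x => `|phi x| `^ q).
  have [r [M [M0 h1 h2 _ _]]] := C1c_bounds cphi.
  have ic := itg_indic (measurable_cube r) (cube_fin hmu r).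
  apply: itg_le (itgZ (M `^ q) ic); first by apply: mfun_powR; exact: C1c_mfun.
  move=> x; rewrite ger0_norm ?powR_ge0// indicE.
  have [xr|xr] := pselect (cube r x).
    by rewrite mem_set// mulr1; apply: powR_le => //; exact: ltW.
  by rewrite memNset// mulr0 h1// normr0 powR0// gt_eqF.
set B := \int[mu]_x (`|phi x| `^ q).
have B0 : 0 <= B by apply: Rintegral_ge0 => x _; exact: powR_ge0.
(* Half of [e] goes to the term with [phi], through the weight [k], and half to the distance from
   [w] to [g]. The [+ 1] covers [B = 0]. *)
pose y : R := e / (2 * (B + 1)).
have y0 : 0 < y by rewrite divr_gt0// mulr_gt0// ltr_pwDr.
have [k k0 hk] : exists2 k : R, 0 < k & k^-1 `^ q = y.
  exists ((y `^ q^-1)^-1); first by rewrite invr_gt0 powR_gt0.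
  by rewrite invrK -powRrM mulVf ?gt_eqF// powRr1// ltW.
have kp : 0 < k `^ p by rewrite powR_gt0.
exists (e / (2 * k `^ p)); first by rewrite divr_gt0// mulr_gt0.
move=> w Lw hw; have Ld := LpB Lw Lg.
have iw := itg_mul_C1c (Lp_locint hmu p1' Lw) cphi.
have ig := itg_mul_C1c (Lp_locint hmu p1' Lg) cphi.
have i1 := itgB iw ig.
rewrite -(RintegralB measurableT iw ig).
apply: le_trans (le_normr_Rintegral measurableT i1) _.
have i2 := itgD (itgZ (k `^ p) (Lp_itg Ld)) (itgZ (k^-1 `^ q) iphi).
have pw x : `|w x * phi x - g x * phi x| <= k `^ p * `|w x - g x| `^ p + k^-1 `^ q * `|phi x| `^ q.
  by rewrite -mulrBl normrM; exact: young_powR_eps.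
apply: le_trans (le_Rintegral measurableT (itg_norm i1) i2 (fun x _ => pw x)) _.
rewrite (RintegralD measurableT (itgZ _ (Lp_itg Ld)) (itgZ _ iphi)).
rewrite (RintegralZl _ measurableT (Lp_itg Ld)) (RintegralZl _ measurableT iphi).
rewrite -/(powint (fun x => w x - g x)) -/B hk.
have h1 : k `^ p * powint (fun x => w x - g x) <= e / 2.
  rewrite (@le_trans _ _ (k `^ p * (e / (2 * k `^ p))))//; first by rewrite ler_wpM2l// ltW.
  by rewrite le_eqVlt; apply/orP; left; apply/eqP; field; rewrite gt_eqF.
have h2 : y * B <= e / 2.
  have -> : e / 2 = y * (B + 1) by rewrite /y; field; rewrite gt_eqF// ltr_pwDr.
  by rewrite ler_wpM2l ?(ltW y0)// lerDl.
move: h1 h2; move: (_ * powint _) (y * B) => a b; clear -hmu p0 p1'; lra.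
Qed.

(** The factor [2 ^ p] is the price of the triangle inequality for [normq] in comparing the limit
    [g] with the almost minimal elements [U n]. *)
Lemma weak_derivative_of_dquot_bound f (i : 'I_N) (T d : R) :
  Lp mu p f -> 0 < d ->
  (forall t, 0 < t < d -> powint (dquot f i t) <= T) ->
  exists g, [/\ Lp mu p g, powint g <= 2 `^ p * T &
    forall phi, C1c phi -> \int[mu]_x (f x * 'D_(evec R i) phi x) = - \int[mu]_x (g x * phi x)].
Proof.
move=> Lf d0 hT; have lf := Lp_locint hmu p1' Lf.
pose L phi := \int[mu]_x (f x * 'D_(evec R i) phi x).
(* The shift by 2 makes [t k < d] hold strictly from [k = 0] on. *)
pose t k : R := d / k.+2%:R.
have tb k : 0 < t k < d.
  by rewrite divr_gt0//= ltr_pdivrMr// ltr_pMr// ltr1n.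
pose D k := dquot f i (t k).
have LD k : Lp mu p (D k) by exact: Lp_dquot.
have cD phi (e : R) : C1c phi -> 0 < e -> exists n : nat, forall k, (n <= k)%N ->
    `|\int[mu]_x (D k x * phi x) + L phi| <= e.
  move=> cphi e0; have [d' d'0 hd'] := pairing_dquot_cvg hmu i lf cphi e0.
  exists (Num.truncn (d / d')); move=> k hk; apply: hd'.
  have /andP[-> _] := tb k; rewrite /= /t ltr_pdivrMr// mulrC -ltr_pdivrMr//.
  rewrite (lt_le_trans (truncnS_gt _))// ler_nat; exact: (leq_trans _ (leqnSn _)).
(* [K n] is the set of [u] whose defect from the weak derivative is bounded, test function
   by test function, by that of the tail [(D k)_(k >= n)]. It is convex, so elements of
   almost minimal norm form a Cauchy sequence by uniform convexity; this replaces weak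
   compactness of the ball of L^p. *)
pose K n u := Lp mu p u /\ forall phi, C1c phi -> forall e : R,
  (forall k, (n <= k)%N -> `|\int[mu]_x (D k x * phi x) + L phi| <= e) ->
  `|\int[mu]_x (u x * phi x) + L phi| <= e.
have KD n : K n (D n).
  by split; [exact: LD|move=> phi _ e h; exact: (h n (leqnn n))].
have KS n m u : (n <= m)%N -> K m u -> K n u.
  move=> nm [Lu hu]; split => // phi cphi e he; apply: hu => // k mk; apply: he.
  exact: leq_trans mk.
have Kmid n u w : K n u -> K n w -> K n (fun x => (u x + w x) / 2).
  move=> [Lu hu] [Lw hw]; split; first exact: Lp_half.
  move=> phi cphi e he; have h1 := hu _ cphi _ he; have h2 := hw _ cphi _ he.
  have iu := itg_mul_C1c (Lp_locint hmu p1' Lu) cphi.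
  have iw := itg_mul_C1c (Lp_locint hmu p1' Lw) cphi.
  have E : \int[mu]_x ((u x + w x) / 2 * phi x) =
      2^-1 * (\int[mu]_x (u x * phi x) + \int[mu]_x (w x * phi x)).
    rewrite -(RintegralD measurableT iu iw) -(RintegralZl _ measurableT (itgD iu iw)).
    by apply: eq_Rintegral => x _; ring.
  rewrite E; move: h1 h2; move: (\int[mu]_x _) (\int[mu]_x _) (L phi) => a b c.
  by clear -hmu p0 p1'; rewrite !ler_norml => /andP[? ?] /andP[? ?]; apply/andP; split; lra.
pose a n := inf [set powint u | u in K n].
have Kinf n : has_inf [set powint u | u in K n].
  split; first by exists (powint (D n)), (D n).
  by exists 0 => _ [u _ <-]; exact: powint_ge0.
have ale n u : K n u -> a n <= powint u.
  by move=> Ku; apply: ge_inf; [have [] := Kinf n|exists u].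
have aT n : a n <= T by rewrite (le_trans (ale _ _ (KD n)))// hT.
have aS : has_ubound (range a) by exists T => _ [n _ <-].
have amono n m : (n <= m)%N -> a n <= a m.
  move=> nm; apply: lb_le_inf; first by have [] := Kinf m.
  by move=> _ [u Ku <-]; apply: ale; exact: KS Ku.
have exU n : exists u, K n u /\ powint u <= a n + n.+1%:R^-1.
  have [|_ [u Ku <-] hu] := @inf_adherent _ _ (n.+1%:R^-1) _ (Kinf n); first by rewrite invr_gt0.
  by exists u; split; [exact: Ku|exact: ltW].
have [U hU] := choice exU.
have LU n : Lp mu p (U n) by have [[]] := hU n.
have UT n : powint (U n) <= T + 1.
  have [_ h] := hU n; rewrite (le_trans h)// lerD// invf_le1// ler1n//.
have T0 : 0 <= T by exact: le_trans (powint_ge0 _) (hT _ (tb 0%N)).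
have cauchy (e : R) : 0 < e -> exists n0 : nat, forall n m, (n0 <= n)%N -> (n0 <= m)%N ->
    (normq mu p (fun x => (U n x - U m x)%R) <= e%:E)%E.
  move=> e0; pose th : R := e / (4 * (T + 1)).
  have T1 : 0 < T + 1 by rewrite ltr_pwDr.
  have th0 : 0 < th by rewrite divr_gt0// mulr_gt0.
  have [C C0 HC] := powint_uniform_convexity th0.
  pose r : R := e / (4 * (C + 1)).
  have C1 : 0 < C + 1 by rewrite ltr_pwDr.
  have r0 : 0 < r by rewrite divr_gt0// mulr_gt0.
  (* The minimal values [a n] increase and are bounded by [T]; from [n1] on they stay within [r] of
     their supremum. *)
  have [|_ [n1 _ <-] hn1] := @sup_adherent _ (range a) r r0 _.
    by split => //; exists (a 0%N), 0%N.
  pose n2 := Num.truncn r^-1.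
  have hn2 n : (n2 <= n)%N -> n.+1%:R^-1 <= r.
    move=> h; rewrite invf_ple ?posrE// ltW// (lt_le_trans (truncnS_gt _))// ler_nat.
    exact: h.
  exists (maxn n1 n2).
  have main n m : (maxn n1 n2 <= n)%N -> (n <= m)%N ->
      (normq mu p (fun x => (U n x - U m x)%R) <= e%:E)%E.
    rewrite geq_max => /andP[nn1 nn2] nm; rewrite (normq_powint (LpB (LU n) (LU m))) lee_fin.
    have [Kn hn] := hU n; have [Km hm] := hU m.
    (* Both [U n] and [U m] lie in [K n], so their midpoint competes for [a n]. Its energy is thus
       above [sup - r], while those of [U n] and [U m] are below [sup + r]: the convexity gap is at
       most [2 r]. *)
    have hmid := ale _ _ (Kmid _ _ _ Kn (KS _ _ _ nm Km)).
    have s1 : a n <= sup (range a) by apply: ub_le_sup => //; exists n.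
    have s2 : a m <= sup (range a) by apply: ub_le_sup => //; exists m.
    have s3 := amono _ _ nn1.
    have r1 := hn2 _ nn2; have r2 := hn2 _ (leq_trans nn2 nm).
    have := HC _ _ (LU n) (LU m).
    have u1 := UT n; have u2 := UT m.
    move: hn hm hmid s1 s2 s3 r1 r2 hn1 u1 u2.
    set P := powint (U n); set Q := powint (U m).
    set W := powint (fun x => (U n x + U m x) / 2); set X := powint (fun x => U n x - U m x).
    move: (sup _) (a n) (a m) (a n1) n.+1%:R^-1 m.+1%:R^-1 => S an am an1 ei ej.
    move=> hn hm hmid s1 s2 s3 r1 r2 hn1 u1 u2 hX.
    have h1 : th * (P + Q) <= e / 2.
      have -> : e / 2 = th * (2 * (T + 1)) by rewrite /th; field; rewrite gt_eqF.
      by rewrite ler_wpM2l ?(ltW th0)//; move: u1 u2; clear -hmu p0 p1'; lra.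
    have h2 : C * ((P + Q) / 2 - W) <= e / 2.
      have -> : e / 2 = (C + 1) * (2 * r) by rewrite /r; field; rewrite gt_eqF.
      rewrite (@le_trans _ _ (C * (2 * r)))//; last first.
        by apply: ler_wpM2r; [rewrite mulr_ge0// ltW|rewrite lerDl].
      by rewrite ler_wpM2l//; move: hn hm hmid s1 s2 s3 r1 r2 hn1; clear -hmu p0 p1'; lra.
    by move: hX h1 h2; clear -hmu p0 p1'; lra.
  move=> n m hn hm; case: (leqP n m) => [nm|/ltnW nm]; first exact: main.
  rewrite (_ : normq mu p (fun x => (U n x - U m x)%R) = normq mu p (fun x => (U m x - U n x)%R)).
    exact: (main _ _ hm nm).
  by apply: eq_integral => x _; rewrite distrC.
have [g [mg hg]] := Lp_complete p1' LU cauchy.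
have gbound (e : R) : 0 < e -> (normq mu p g <= (2 `^ p * (T + e))%:E)%E.
  move=> e0; have e2 : 0 < e / 2 by rewrite divr_gt0.
  pose n2 := Num.truncn (e / 2)^-1.
  have [n nn hn] := hg _ n2 e2.
  have mU : mfun_RN (U n) by have [] := LU n.
  have E : normq mu p (fun x => (U n x - g x)%R) = normq mu p (fun x => (g x - U n x)%R).
    by apply: eq_integral => x _; rewrite distrC.
  rewrite (_ : g = (fun x => ((g x - U n x) + U n x)%R)); last by apply/funext => x; rewrite subrK.
  apply: le_trans (normq_add _ p1' _ mU) _; first exact: measurable_funB.
  rewrite EFinM; apply: lee_wpmul2l; first by rewrite lee_fin powR_ge0.
  rewrite -E (normq_powint (LU n)).
  apply: le_trans (leeD hn (lexx _)) _; rewrite -EFinD lee_fin.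
  have [_ hn'] := hU n; have := aT n.
  have r1 : n.+1%:R^-1 <= e / 2.
    rewrite invf_ple ?posrE// ltW// (lt_le_trans (truncnS_gt _))// ler_nat.
    exact: nn.
  move: hn' r1; move: (n.+1%:R^-1) (a n) (powint (U n)) => x y z; clear -hmu p0 p1'; lra.
have Lg : Lp mu p g.
  by split => //; exact: le_lt_trans (gbound 1 ltr01) (ltry _).
exists g; split => //.
  apply/ler_addgt0Pr => e e0; have c0 : 0 < 2 `^ p :> R by rewrite powR_gt0.
  have := gbound (e / 2 `^ p); rewrite divr_gt0// => /(_ isT).
  rewrite (normq_powint Lg) lee_fin mulrDr [_ * (e / _)]mulrCA divff ?gt_eqF// mulr1.
  exact.
move=> phi cphi; rewrite -/(L phi); apply/eqP; rewrite -subr_eq0 opprK -normr_le0.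
apply/ler_addgt0Pr => e e0; rewrite add0r.
have e2 : 0 < e / 2 by rewrite divr_gt0.
have [dd dd0 hdd] := pairing_close Lf Lg cphi e2.
have [n1 hn1] := cD _ _ cphi e2.
have [n nn hn] := hg _ n1 dd0.
have h1 : `|\int[mu]_x (U n x * phi x) - \int[mu]_x (g x * phi x)| <= e / 2.
  by apply: (hdd _ (LU n)); rewrite -lee_fin -(normq_powint (LpB (LU n) Lg)).
have h2 : `|\int[mu]_x (U n x * phi x) + L phi| <= e / 2.
  have [[_ hu] _] := hU n; apply: hu => // k nk; apply: hn1; exact: leq_trans nk.
move: h1 h2; move: (\int[mu]_x _) (\int[mu]_x _) (L phi) => b c l; clear -hmu p0 p1'.
by rewrite !ler_norml => /andP[? ?] /andP[? ?]; apply/andP; split; lra.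
Qed.

End weak_derivative_from_difference_quotients.

(** * The gradient and the increments *)

Section euclidean_norm.
Context {R : realType} {N : nat}.
Local Notation V := 'rV[R]_N.
Implicit Types (h : V).

Lemma enorm_ge0 h : 0 <= enorm h. Proof. exact: sqrtr_ge0. Qed.

Lemma coord_le_enorm h (i : 'I_N) : `|h ord0 i| <= enorm h.
Proof.
rewrite -sqrtr_sqr ler_sqrt ?sumr_ge0// => [|j _]; last exact: sqr_ge0.
by rewrite (bigD1 i)//= lerDl sumr_ge0// => j _; exact: sqr_ge0.
Qed.

Lemma enorm_le (M : R) h : 0 <= M -> (forall i, `|h ord0 i| <= M) -> enorm h <= N%:R * M.
Proof.
move=> M0 hM; have NM : 0 <= N%:R * M by rewrite mulr_ge0.
rewrite -[leRHS](ger0_norm NM) -sqrtr_sqr ler_sqrt ?sqr_ge0//.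
rewrite (@le_trans _ _ (\sum_(i < N) M ^+ 2))//.
  by apply: ler_sum => i _; rewrite -real_normK ?num_real// lerXn2r ?nnegrE.
have -> : \sum_(i < N) M ^+ 2 = N%:R * M ^+ 2 by rewrite sumr_const card_ord mulr_natl.
rewrite exprMn; apply: ler_wpM2r; first exact: sqr_ge0.
rewrite -natrX ler_nat.
by case: (N) => // n; rewrite expnS leq_pmulr// expn_gt0.
Qed.

Lemma enorm_eq0 h : enorm h = 0 -> h = 0.
Proof.
move=> h0; apply/rowP => i; rewrite mxE; apply/eqP; rewrite -normr_le0 -h0.
exact: coord_le_enorm.
Qed.

Lemma enormZ (c : R) h : 0 <= c -> enorm (c *: h) = c * enorm h.
Proof.
move=> c0; rewrite -[in RHS](ger0_norm c0) -sqrtr_sqr -sqrtrM ?sqr_ge0//; congr Num.sqrt.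
by rewrite mulr_sumr; apply: eq_bigr => i _; rewrite mxE exprMn.
Qed.

Lemma mfun_enorm : mfun_RN (@enorm R N).
Proof.
apply: measurable_continuous_RN; apply: continuous_fcomp; first exact: sqrt_continuous.
apply: continuous_fsum => i; apply: continuous_fM; exact: continuous_fcoord.
Qed.

End euclidean_norm.

(** * Differences of points in a set carrying most of the mass *)

Section steinhaus.
Context {R : realType} {N : nat}.
Local Notation V := 'rV[R]_N.
Local Notation RN := (RN R N).
Variable mu : {measure set RN -> \bar R}.
Hypothesis hmu : is_lebesgue_RN mu.
Implicit Types (phi psi f g u : V -> R) (x h : V).

Lemma measurable_shift_normp (p : R) f : mfun_RN f ->
  measurable_fun [set: RN] (shift_normp mu p f : RN -> \bar R).
Proof.
move=> mf.
have mF : measurable_fun [set: RN * RN]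
    (fun z : RN * RN => (`|f ((z.1 : V) + z.2) - f z.2| `^ p)%:E).
  apply/measurable_EFinP.
  apply: (@measurableT_comp _ _ _ _ _ _ (fun t : R => t `^ p) _ (fun z : RN * RN => `|f ((z.1 : V) + z.2) - f z.2|)).
    exact: measurable_powR.
  apply: measurableT_comp => //; apply: measurable_funB.
    exact: (measurableT_comp mf measurable_add_RN).
  by apply: (measurableT_comp mf); exact: measurable_snd.
have -> : shift_normp mu p f = (fun h => \int[mu]_x (`|f ((h : V) + x)%R - f x| `^ p)%:E)%E.
  by apply/funext => h; apply: eq_integral => x _; rewrite [(h : V) + x]addrC.
exact: (measurable_integral_snd hmu mF (fun z => powR_ge0 _ _)).
Qed.

(** The union over [n] of these sets is where [rho > 0]; if all were null, the integral of [rho]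
    would vanish. *)
Lemma exists_thick_set (rho : V -> R) : mfun_RN rho -> (forall x, 0 <= rho x) ->
  (\int[mu]_x (rho x)%:E = 1)%E ->
  exists n : nat, (0 < mu ([set x : RN | (n.+1%:R^-1 <= rho x)%R] `&` cube n%:R))%E.
Proof.
move=> mrho rho0 rho1; apply: contrapT => hn.
pose E n : set RN := [set x : RN | n.+1%:R^-1 <= rho x] `&` cube n%:R.
have mE n : measurable (E n).
  apply: measurableI; last exact: measurable_cube.
  rewrite (_ : [set x | _] = [set: RN] `&` (rho : RN -> R) @^-1` `[n.+1%:R^-1, +oo[%classic).
    by apply: mrho => //; exact: measurable_itv.
  by apply/seteqP; split => x /=; rewrite in_itv /= andbT // => -[].
have E0 n : mu (E n) = 0%E.
  apply/eqP; rewrite eq_le measure_ge0 andbT leNgt; apply/negP => h.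
  by apply: hn; exists n.
have U0 : mu (\bigcup_n E n) = 0%E.
  apply/eqP; rewrite eq_le measure_ge0 andbT.
  have := measure_sigma_subadditive mu mE (bigcupT_measurable _ mE) (@subset_refl _ _).
  by move=> /le_trans; apply; rewrite eseries0.
have : (\int[mu]_x (rho x)%:E = 0)%E.
  have mEF : measurable_fun [set: RN] (fun x : RN => (rho x)%:E) by exact/measurable_EFinP.
  rewrite (@ge0_negligible_integral _ _ _ mu setT (\bigcup_n E n) _ (bigcupT_measurable _ mE) measurableT mEF _ U0); last first.
    by move=> x _; rewrite lee_fin.
  apply: integral0_eq => x [_ nx]; congr (_%:E).
  apply/eqP; rewrite eq_le rho0 andbT leNgt; apply/negP => r0; apply: nx.
  have [m hm] := cube_nat_cover x.
  exists (maxn m (Num.truncn (rho x)^-1)) => //; split.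
    rewrite /= invf_ple ?posrE// ltW// (lt_le_trans (truncnS_gt _))// ler_nat ltnS.
    exact: leq_maxr.
  by apply: cube_subset hm; rewrite ler_nat leq_maxl.
by rewrite rho1 => /eqP; rewrite onee_eq0.
Qed.

(* A Steinhaus argument: translation is continuous in L^1, so a set [A] that carries nearly
   all the mass of [rho] meets its translate by any small [s e_i]. *)
Lemma steinhaus (rho : V -> R) : mfun_RN rho -> (forall x, 0 <= rho x) ->
  (\int[mu]_x (rho x)%:E = 1)%E ->
  exists r k : R, [/\ 0 <= r, 0 < k & forall i : 'I_N, exists2 s : R, 0 < s &
    forall A : set RN, measurable A ->
      (\int[mu]_x (rho x * \1_(~` A) x)%:E <= k%:E)%E ->
      exists z z' : V, [/\ A z, A z', cube r z, cube r z' & z - z' = s *: evec R i]].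
Proof.
move=> mrho rho0 rho1.
have [n hn] := exists_thick_set mrho rho0 rho1.
set E := _ `&` _ in hn.
have mE : measurable E.
  apply: measurableI; last exact: measurable_cube.
  rewrite (_ : [set x | _] = [set: RN] `&` (rho : RN -> R) @^-1` `[n.+1%:R^-1, +oo[%classic).
    by apply: mrho => //; exact: measurable_itv.
  by apply/seteqP; split => x /=; rewrite in_itv /= andbT // => -[].
have fE : (mu E < +oo)%E.
  apply: le_lt_trans (cube_fin hmu n%:R); apply: le_measure; rewrite ?inE//.
    exact: measurable_cube.
  exact: subIsetr.
have iE := itg_indic mE fE.
pose m : R := fine (mu E).
have mE' : mu E = m%:E by rewrite /m fineK// ge0_fin_numE.
have m0 : 0 < m by rewrite -lte_fin -mE'.
have IE : \int[mu]_x (\1_E x : R) = m.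
  by apply/EFin_inj; rewrite EFin_Rint// integral_indic// setIT.
(* On [E] the density is at least [1 / (n + 1)], so a set missing at most [k] of the mass of [rho]
   misses at most [m / 8] of the measure of [E]. *)
pose k : R := m / (8 * n.+1%:R).
have k0 : 0 < k by rewrite divr_gt0// mulr_gt0.
exists n%:R, k; split => // i.
have [_ hap] : lq_approx mu 1 (\1_E : RN -> R).
  apply: (approx_Lq hmu (lexx 1)); first exact: mfun_indic.
  apply: integrable_lty => //.
  by rewrite (_ : (fun x => _) = EFin \o (\1_E : RN -> R))//; apply/funext => x; rewrite powRr1 /= ?indicE ?ger0_norm.
(* The budget: if no pair exists, [m] is at most three errors of [m / 16] (two from approximating
   the indicator, one from translating) plus twice [m / 8], a total of [7 m / 16]. *)
have m16 : 0 < m / 16 by rewrite divr_gt0.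
have [phi [cphi hphi]] := hap _ m16.
pose dd x : R := `|phi x - \1_E x|.
have mdd : mfun_RN dd.
  by apply: measurableT_comp => //; apply: measurable_funB; [exact: C1c_mfun|exact: mfun_indic].
have hdd : (\int[mu]_x (dd x)%:E <= (m / 16)%:E)%E.
  apply: le_trans hphi; apply: le_integral_of_ge0 => x; first by rewrite lee_fin normr_ge0.
  by rewrite lee_fin powRr1.
have idd : itg mu dd.
  apply: itg_ge0 => //; first by move=> x; exact: normr_ge0.
  exact: le_lt_trans hdd (ltry _).
have rdd : \int[mu]_x dd x <= m / 16 by rewrite -lee_fin EFin_Rint.
have lE : locint mu (\1_E : RN -> R).
  split; first exact: mfun_indic.
  by move=> r; apply: (integrableS measurableT (measurable_cube r) (@subsetT _ _)); exact: iE.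
have dP := derive_pairing i 0 lE cphi.
(* Differentiability of the pairing at 0 supplies the continuity of translation. *)
have cP : {for 0, continuous (fun t : R => \int[mu]_x (\1_E x * phi (x + t *: evec R i)))}.
  by apply: differentiable_continuous; apply/derivable1_diffP; have [] := dP.
have [d d0 hd] : exists2 d : R, 0 < d & forall t, `|t| < d ->
    `|\int[mu]_x (\1_E x * phi (x + 0 *: evec R i)) - \int[mu]_x (\1_E x * phi (x + t *: evec R i))| <= m / 16.
  move/cvgrPdist_le : cP => /(_ _ m16) /nbhs_ballP[d /= d0 hd]; exists d => // t td.
  by apply: hd; rewrite /ball /= sub0r normrN.
pose s : R := d / 2.
have s0 : 0 < s by rewrite divr_gt0.
have sd : `|s| < d by rewrite (gtr0_norm s0) /s ltr_pdivrMr// ltr_pMr// ltr1n.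
exists s => // A mA hA.
pose B : set RN := E `&` ~` A.
have mB : measurable B by apply: measurableI => //; exact: measurableC.
have fB : (mu B < +oo)%E.
  by apply: le_lt_trans fE; apply: le_measure; rewrite ?inE//; exact: subIsetl.
have iB := itg_indic mB fB.
have rB : \int[mu]_x (\1_B x : R) <= m / 8.
  have n0 : 0 < n.+1%:R :> R by [].
  have h : \int[mu]_x (n.+1%:R^-1 * \1_B x : R) <= k.
    rewrite -lee_fin EFin_Rint; last exact: itgZ.
    apply: le_trans hA; apply: le_integral_of_ge0 => x.
      by rewrite lee_fin mulr_ge0// ?invr_ge0// indicE.
    rewrite lee_fin !indicE.
    have [[Ex nA]|nB] := pselect (B x).
      by rewrite !mem_set// !mulr1; case: Ex.
    by rewrite memNset// mulr0 mulr_ge0.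
  move: h; rewrite (RintegralZl _ measurableT iB) => h.
  have -> : \int[mu]_x (\1_B x : R) = n.+1%:R * (n.+1%:R^-1 * \int[mu]_x (\1_B x : R)).
    by rewrite mulrA divff ?gt_eqF// mul1r.
  have -> : m / 8 = n.+1%:R * k by rewrite /k; field; rewrite gt_eqF.
  by rewrite ler_pM2l.
set v := s *: evec R i.
have iBv := itg_shift hmu v iB.
have iddv := itg_shift hmu v idd.
have rBv : \int[mu]_x (\1_B (x + v) : R) = \int[mu]_x (\1_B x : R).
  exact: (Rint_shift hmu v (mfun_indic mB)).
have rddv : \int[mu]_x (dd (x + v)) = \int[mu]_x (dd x) by exact: Rint_shift.
have e0 : \int[mu]_x (\1_E x * phi (x + 0 *: evec R i)) = \int[mu]_x (\1_E x * phi x).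
  by apply: eq_Rintegral => x _; rewrite scale0r addr0.
have := hd s sd; rewrite e0 -/v => hds.
have ip : itg mu (fun x => \1_E x * phi x) by exact: (itg_mul_C1c lE cphi).
have ipv : itg mu (fun x => \1_E x * phi (x + v)) by exact: (itg_mul_C1c lE (C1c_translate v cphi)).
have h1 : m <= \int[mu]_x (\1_E x * phi x) + \int[mu]_x dd x.
  rewrite -IE -(RintegralD measurableT ip idd).
  apply: (le_Rintegral measurableT iE (itgD ip idd)) => x _.
  rewrite /dd indicE; case: (x \in E) => /=.
    rewrite mul1r -lerBlDl; have := ler_norm (- (phi x - 1)); rewrite normrN; lra.
  by rewrite mul0r add0r normr_ge0.
apply: contrapT => hno.
(* Without a pair in [A], whenever [x] and [x + v] both lie in [E], one of them lies in [B], the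
   part of [E] outside [A]. *)
have pw x : \1_E x * phi (x + v) <= dd (x + v) + (\1_B x + \1_B (x + v)).
  rewrite {1}indicE; have [Ex|nEx] := pselect (E x); last first.
    by rewrite memNset// mul0r addr_ge0// ?normr_ge0// addr_ge0// indicE.
  rewrite mem_set//= mul1r.
  suff h : (\1_E (x + v) : R) <= \1_B x + \1_B (x + v).
    by have := ler_norm (phi (x + v) - \1_E (x + v)); rewrite -/(dd (x + v)); move: h; lra.
  have [Ev|nEv] := pselect (E (x + v)); last first.
    by rewrite {1}indicE memNset// addr_ge0// indicE.
  have [Bx|nBx] := pselect (B x).
    by rewrite !indicE (mem_set Ev) (mem_set Bx) lerDl.
  have [Bv|nBv] := pselect (B (x + v)).
    by rewrite !indicE (mem_set Ev) (mem_set Bv) lerDr.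
  exfalso; apply: hno; exists (x + v), x; split.
  - by apply: contrapT => nA; apply: nBv.
  - by apply: contrapT => nA; apply: nBx.
  - by case: Ev.
  - by case: Ex.
  - by rewrite addrC addKr.
have iBB := itgD iB iBv.
have := le_Rintegral measurableT ipv (itgD iddv iBB) (fun x _ => pw x).
rewrite (RintegralD measurableT iddv iBB) (RintegralD measurableT iB iBv) rBv rddv => h2.
move: hds h1 h2 rdd rB m0.
move: (\int[mu]_x (\1_E x * phi x)) (\int[mu]_x (\1_E x * phi (x + v))) (\int[mu]_x dd x) (\int[mu]_x \1_B x) => a b c e.
rewrite ler_norml => /andP[? ?]; lra.
Qed.

End steinhaus.

(** * Comparison of the gradient with the increments *)

Section gradient_bounds.
Context {R : realType} {N : nat}.
Local Notation V := 'rV[R]_N.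
Local Notation RN := (RN R N).
Variable mu : {measure set RN -> \bar R}.
Hypothesis hmu : is_lebesgue_RN mu.
Implicit Types (phi f : V -> R) (x h : V).

Lemma BV_seminorm_ge0 f : (0 <= BV_seminorm mu f)%E.
Proof.
apply: ereal_sup_ubound; exists (fun _ _ => 0).
  split; first by move=> i; exact: C1c_zero.
  move=> x; rewrite (_ : \row_i 0 = 0 :> V); last by apply/rowP => i; rewrite !mxE.
  have z0 (i : 'I_N) : `|(0 : V) ord0 i| <= 0 by rewrite mxE normr0.
  by rewrite (le_trans (enorm_le (lexx 0) z0))// mulr0.
rewrite integral0_eq// => x _; rewrite big1 ?mulr0// => i _.
by rewrite derive_cst.
Qed.

Lemma grad_norm_p_ge0 (p : R) f : (0 <= grad_norm_p mu p f)%E.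
Proof.
rewrite /grad_norm_p; case: ifP => _; first exact: BV_seminorm_ge0.
apply: le_ereal_inf_tmp => _ [g _ <-]; apply: integral_ge0 => x _.
by rewrite lee_fin powR_ge0.
Qed.

Lemma dquot_normq_le (p : R) f (i : 'I_N) (T t : R) : 1 <= p -> Lp mu p f -> 0 < t ->
  (shift_normp mu p f (t *: evec R i) <= (T * t `^ p)%:E)%E ->
  \int[mu]_x (`|dquot f i t x| `^ p) <= T.
Proof.
move=> p1 Lf t0; have [mf _] := Lf.
have tp : 0 < t `^ p by rewrite powR_gt0.
rewrite (shift_normp_dquot mu i p1 (lt0r_neq0 t0) mf) (gtr0_norm t0).
have := EFin_Rint (Lp_itg (Lp_dquot hmu i t p1 Lf)).
rewrite /normq => <-; rewrite -EFinM lee_fin mulrC.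
by rewrite ler_pM2r.
Qed.

(** The divergence is split into its [N] terms. Each is, up to sign, a limit of pairings with
    difference quotients, whose L^1 norms are at most [T]. *)
Lemma BV_seminorm_le f (T : R) : Lp mu 1 f -> 0 <= T ->
  (forall i, exists2 d : R, 0 < d & forall t, 0 < t < d ->
    (shift_normp mu 1 f (t *: evec R i) <= (T * t `^ 1)%:E)%E) ->
  (BV_seminorm mu f <= (N%:R * T)%:E)%E.
Proof.
move=> Lf T0 hT; have lf := Lp_locint hmu (lexx 1) Lf.
apply: ge_ereal_sup => _ [phi [cphi phi1] <-].
have i1 (i : 'I_N) := itg_mul_dC1c i lf (cphi i).
have E : (\int[mu]_x (f x * \sum_(i < N) 'D_(evec R i) (phi i) x)%:E =
    \sum_(i < N) \int[mu]_x (f x * 'D_(evec R i) (phi i) x)%:E)%E.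
  rewrite -(@integral_sum _ _ _ mu setT measurableT _ (fun i x => (f x * 'D_(evec R i) (phi i) x)%:E) i1).
  by apply: eq_integral => x _; rewrite mulr_sumr sumEFin.
rewrite E; apply: (@le_trans _ _ (\sum_(i < N) T%:E)%E); last first.
  by rewrite sumEFin sumr_const card_ord mulr_natl.
apply: lee_sum => i _; rewrite -(EFin_Rint (i1 i)) lee_fin.
have p1 x : `|phi i x| <= 1.
  have := coord_le_enorm (\row_i phi i x) i; rewrite mxE => h.
  exact: le_trans h (phi1 x).
apply/ler_addgt0Pr => e e0.
have [d1 d10 h1] := pairing_dquot_cvg hmu i lf (cphi i) e0.
have [d2 d20 h2] := hT i.
pose t : R := Num.min d1 d2 / 2.
have mn : 0 < Num.min d1 d2 by rewrite lt_min d10.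
have t0 : 0 < t by rewrite divr_gt0.
have tm : t < Num.min d1 d2 by rewrite /t ltr_pdivrMr// ltr_pMr// ltr1n.
have t1 : 0 < t < d1 by rewrite t0 (lt_le_trans tm)// ge_min lexx.
have t2 : 0 < t < d2 by rewrite t0 (lt_le_trans tm)// ge_min lexx orbT.
have b1 := h1 _ t1; have b2 := dquot_normq_le (lexx 1) Lf t0 (h2 _ t2).
have Ld := Lp_dquot hmu i t (lexx 1) Lf.
have id := itg_mul_C1c (Lp_locint hmu (lexx 1) Ld) (cphi i).
have b3 : `|\int[mu]_x (dquot f i t x * phi i x)| <= T.
  apply: le_trans b2; apply: le_trans (le_normr_Rintegral measurableT id) _.
  apply: (le_Rintegral measurableT (itg_norm id) (Lp_itg Ld)) => x _.
  by rewrite powRr1// normrM ler_piMr.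
move: b1 b3; move: (\int[mu]_x (dquot f i t x * phi i x)) (\int[mu]_x _) => a b.
by rewrite !ler_norml => /andP[? ?] /andP[? ?]; lra.
Qed.

Implicit Types (g : 'I_N -> V -> R).

Lemma weak_gradient_Rint (p : R) f g (i : 'I_N) phi : weak_gradient mu p f g -> C1c phi ->
  \int[mu]_x (f x * 'D_(evec R i) phi x) = - \int[mu]_x (g i x * phi x).
Proof. by move=> [_ hg] cphi; rewrite /Rintegral (hg phi cphi i) fineN. Qed.

Lemma coord_powR_le (p : R) g (i : 'I_N) x : 0 <= p ->
  `|g i x| `^ p <= enorm (\row_i g i x) `^ p.
Proof.
move=> p0; apply: powR_le => //.
by have := coord_le_enorm (\row_i g i x) i; rewrite mxE.
Qed.

Lemma enorm_powR_le (p : R) h : 1 <= p -> (1 <= N)%N ->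
  enorm h `^ p <= N%:R `^ p * \sum_(i < N) `|h ord0 i| `^ p.
Proof.
move=> p1 N1; have p0 : 0 <= p by rewrite (le_trans ler01).
pose i0 : 'I_N := Ordinal N1.
have [i _ hi] := @arg_maxP _ _ _ i0 xpredT (fun i => `|h ord0 i|) isT.
have : enorm h <= N%:R * `|h ord0 i| by apply: enorm_le => // j; exact: hi.
move=> /(powR_le p0 (enorm_ge0 h)) /le_trans; apply.
rewrite powRM// ler_wpM2l ?powR_ge0// (bigD1 i)//= lerDl sumr_ge0//.
Qed.

(** The vector [h] is decomposed along the axes, where the duality bounds apply, and the pieces are
    added by quasi-subadditivity. At [h = 0] both sides vanish, also for an infinite gradient, by
    the convention on [0 * +oo]. *)
Lemma shift_normp_le_grad (p : R) : 1 <= p -> exists2 C : R, 0 < C &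
  forall f, Lp mu p f -> forall h,
  (shift_normp mu p f h <= (C * enorm h `^ p)%:E * grad_norm_p mu p f)%E.
Proof.
move=> p1; have p0 : 0 < p by rewrite (lt_le_trans ltr01).
(* The constant of [shift_normp_sum], with 1 added to make it positive without using [1 <= N]. *)
pose n : R := (2 `^ p + 1) ^+ size (enum 'I_N) * (size (enum 'I_N))%:R + 1.
have n0' : 0 <= (2 `^ p + 1) ^+ size (enum 'I_N) * (size (enum 'I_N))%:R :> R.
  by rewrite mulr_ge0// exprn_ge0// addr_ge0// powR_ge0.
have n0 : 0 < n by rewrite ltr_pwDr.
have sum_coord f h (b : \bar R) : Lp mu p f -> (0 <= b)%E ->
    (forall i, (shift_normp mu p f (h ord0 i *: evec R i) <= b)%E) ->
    (shift_normp mu p f h <= n%:E * b)%E.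
  move=> [mf _] b0 hb; rewrite {1}(row_sum_evec h).
  apply: le_trans (shift_normp_sum _ _ p1 mf b0 hb) _; first exact: hmu.
  by apply: lee_wpmul2r => //; rewrite lee_fin lerDl.
have [p_eq1|p_neq1] := eqVneq p 1.
  exists n => // f Lf h; rewrite /grad_norm_p p_eq1 eqxx.
  have [->|h0] := eqVneq h 0.
    by rewrite shift_normp0// mule_ge0 ?BV_seminorm_ge0// lee_fin mulr_ge0 ?powR_ge0// ltW.
  have eh : 0 < enorm h.
    by rewrite lt_neqAle enorm_ge0 andbT eq_sym; apply: contra_neq h0; exact: enorm_eq0.
  have G0 := BV_seminorm_ge0 f.
  case GE : (BV_seminorm mu f) G0 => [G| |] // G0; last first.
    by rewrite gt0_muley ?leey// lte_fin mulr_gt0// powR_gt0.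
  rewrite lee_fin in G0; rewrite powRr1 ?enorm_ge0//.
  rewrite -EFinM -mulrA EFinM.
  rewrite -p_eq1; apply: sum_coord => //; first by rewrite lee_fin mulr_ge0// enorm_ge0.
  move=> i; have [->|t0] := eqVneq (h ord0 i) 0.
    by rewrite scale0r shift_normp0// lee_fin mulr_ge0// enorm_ge0.
  rewrite p_eq1 in Lf *.
  apply: (@le_trans _ _ (`|h ord0 i| * G)%:E); last first.
    by rewrite lee_fin ler_wpM2r// coord_le_enorm.
  apply: (dquot_L1_le hmu Lf t0) => phi cphi phi1.
  have lf := Lp_locint hmu (lexx 1) Lf.
  have iphi := itg_mul_dC1c i lf cphi.
  rewrite -lee_fin (EFin_Rint iphi) -GE; apply: ereal_sup_ubound.
  (* A field with the single nonzero component [phi] is admissible in the total variation, and its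
     divergence is the [i]-th derivative of [phi]. *)
  exists (fun j x => if j == i then phi x else 0).
    split.
      by move=> j; case: (j == i) => //; exact: C1c_zero.
    move=> x; rewrite -[X in _ <= X]sqrtr1 /enorm ler_sqrt//.
    rewrite (bigD1 i)//= big1 ?addr0; last first.
      by move=> j ji; rewrite mxE (negbTE ji) expr0n.
    by rewrite mxE eqxx -real_normK ?num_real// exprn_ile1.
  apply: eq_integral => x _; congr ((f x * _)%:E).
  rewrite (bigD1 i)//= eqxx big1 ?addr0// => j ji.
  by rewrite (negbTE ji) derive_cst.
have p1' : 1 < p by rewrite lt_neqAle eq_sym p_neq1.
have [C C0 HC] := dquot_Lp_le hmu p1'.
exists (n * C); first by rewrite mulr_gt0.
move=> f Lf h; rewrite /grad_norm_p (negbTE p_neq1).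
have inf0 : (0 <= ereal_inf [set \int[mu]_x (enorm (\row_i g i x) `^ p)%:E | g in [set g | weak_gradient mu p f g]])%E.
  have := grad_norm_p_ge0 p f; by rewrite /grad_norm_p (negbTE p_neq1).
have [->|h0] := eqVneq h 0.
  by rewrite shift_normp0// mule_ge0// lee_fin !mulr_ge0 ?powR_ge0// ltW.
have eh : 0 < enorm h.
  by rewrite lt_neqAle enorm_ge0 andbT eq_sym; apply: contra_neq h0; exact: enorm_eq0.
(* A positive factor can be moved to the other side, so that the claim becomes a lower bound on the
   infimum and is checked for each weak gradient. *)
have A0 : 0 < n * C * enorm h `^ p by rewrite !mulr_gt0// powR_gt0.
rewrite -lee_pdivrMl//; apply: le_ereal_inf_tmp => _ [g wg <-].
rewrite lee_pdivrMl//.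
have I0 : (0 <= \int[mu]_x (enorm (\row_i g i x) `^ p)%:E)%E.
  by apply: integral_ge0 => x _; rewrite lee_fin powR_ge0.
rewrite -!mulrA EFinM -muleA; apply: sum_coord => //.
  by rewrite mule_ge0// lee_fin mulr_ge0 ?powR_ge0// ltW.
move=> i; have Lg := (proj1 wg) i.
have [->|t0] := eqVneq (h ord0 i) 0.
  rewrite scale0r shift_normp0// mule_ge0// lee_fin mulr_ge0 ?powR_ge0// ltW//.
apply: le_trans (HC f (g i) i (h ord0 i) Lf Lg t0 _) _.
  by move=> phi cphi; exact: (weak_gradient_Rint i wg cphi).
rewrite mulrA mulrC [X in (X%:E <= _)%E]mulrC EFinM (EFin_Rint (Lp_itg Lg)).
apply: lee_pmul.
- by rewrite lee_fin mulr_ge0 ?powR_ge0// ltW.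
- by apply: integral_ge0 => x _; rewrite lee_fin powR_ge0.
- rewrite lee_fin mulrC; apply: ler_wpM2l; first exact: ltW.
  by apply: powR_le; [exact: ltW|exact: normr_ge0|exact: coord_le_enorm].
- apply: le_integral_of_ge0 => x; first by rewrite lee_fin powR_ge0.
  by rewrite lee_fin; apply: coord_powR_le; exact: ltW.
Qed.

Lemma grad_le_of_shift_normp (p : R) : 1 <= p -> (1 <= N)%N -> exists2 C : R, 0 < C &
  forall f (T : R), Lp mu p f -> 0 <= T ->
  (forall i, exists2 d : R, 0 < d & forall t, 0 < t < d ->
    (shift_normp mu p f (t *: evec R i) <= (T * t `^ p)%:E)%E) ->
  (grad_norm_p mu p f <= (C * T)%:E)%E.
Proof.
move=> p1 N1; have p0 : 0 < p by rewrite (lt_le_trans ltr01).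
have [p_eq1|p_neq1] := eqVneq p 1.
  exists N%:R; first by rewrite ltr0n.
  move=> f T Lf T0 hT; rewrite /grad_norm_p p_eq1 eqxx.
  apply: BV_seminorm_le; rewrite -?p_eq1; [exact: Lf|exact: T0|exact: hT].
have p1' : 1 < p by rewrite lt_neqAle eq_sym p_neq1.
(* [N ^ p] compares the Euclidean norm with the coordinates, [N] counts them, and [2 ^ p] comes from
   [weak_derivative_of_dquot_bound]. *)
exists (N%:R `^ p * (N%:R * 2 `^ p)).
  by rewrite !mulr_gt0 ?powR_gt0 ?ltr0n.
move=> f T Lf T0 hT; rewrite /grad_norm_p (negbTE p_neq1).
have exg i : exists g : V -> R, [/\ Lp mu p g, powint mu p g <= 2 `^ p * T &
    forall phi, C1c phi -> \int[mu]_x (f x * 'D_(evec R i) phi x) = - \int[mu]_x (g x * phi x)].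
  have [d d0 hd] := hT i.
  apply: (weak_derivative_of_dquot_bound hmu p1' Lf d0) => t td.
  have /andP[t0 _] := td.
  exact: (dquot_normq_le p1 Lf t0 (hd t td)).
have [g hg] := choice exg.
have lf := Lp_locint hmu p1 Lf.
have wg : weak_gradient mu p f g.
  split; first by move=> i; have [] := hg i.
  move=> phi cphi i; have [Lg _ h] := hg i.
  rewrite -(EFin_Rint (itg_mul_dC1c i lf cphi)) (h _ cphi) EFinN.
  by rewrite (EFin_Rint (itg_mul_C1c (Lp_locint hmu p1 Lg) cphi)).
apply: (@le_trans _ _ (\int[mu]_x (enorm (\row_i g i x) `^ p)%:E)%E).
  by apply: ereal_inf_lbound; exists g.
have ig (i : 'I_N) : itg mu (fun x => `|g i x| `^ p) by have [Lg _ _] := hg i; exact: Lp_itg.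
apply: (@le_trans _ _ (\int[mu]_x ((N%:R `^ p)%:E * \sum_(i < N) (`|g i x| `^ p)%:E))%E).
  apply: le_integral_of_ge0 => x; first by rewrite lee_fin powR_ge0.
  rewrite sumEFin -EFinM lee_fin (le_trans (enorm_powR_le _ p1 N1))//.
  by rewrite ler_wpM2l ?powR_ge0//; apply: ler_sum => i _; rewrite mxE.
have m_i (i : 'I_N) : measurable_fun [set: RN] (fun x : RN => (`|g i x| `^ p)%:E).
  by apply/measurable_EFinP; exact: (itg_mfun (ig i)).
have g0 (i : 'I_N) x : (0 <= (`|g i x| `^ p)%:E)%E by rewrite lee_fin powR_ge0.
have E1 : (\int[mu]_x ((N%:R `^ p)%:E * \sum_(i < N) (`|g i x| `^ p)%:E) =
    (N%:R `^ p)%:E * \int[mu]_x (\sum_(i < N) (`|g i x| `^ p)%:E))%E.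
  apply: ge0_integralZl => //.
  - by apply: emeasurable_sum => i; exact: m_i.
  - by move=> x _; apply: sume_ge0 => i _; exact: g0.
have E2 : (\int[mu]_x (\sum_(i < N) (`|g i x| `^ p)%:E) =
    \sum_(i < N) \int[mu]_x (`|g i x| `^ p)%:E)%E.
  by apply: ge0_integral_sum => // i x _; exact: g0.
rewrite E1 E2.
rewrite -mulrA EFinM; apply: lee_wpmul2l; first by rewrite lee_fin powR_ge0.
apply: (@le_trans _ _ (\sum_(i < N) (2 `^ p * T)%:E)%E).
  apply: lee_sum => i _; have [_ h _] := hg i.
  by rewrite -(EFin_Rint (ig i)) lee_fin.
by rewrite sumEFin sumr_const card_ord -mulrA mulr_natl.
Qed.

End gradient_bounds.

(** * The nonlocal functional *)

Section growth_functions.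
Context {R : realType}.
Implicit Types (w : R -> R).

Lemma C_inc_ge0 w t : C_inc w -> 0 <= t -> 0 <= w t.
Proof. by move=> [_ [_ [h _]]]; exact: h. Qed.

Lemma C_inc_0 w : C_inc w -> w 0 = 0.
Proof. by move=> [_ [_ [_ [h _]]]]. Qed.

Lemma C_inc_homo w s t : C_inc w -> 0 <= s -> s <= t -> w s <= w t.
Proof.
move=> [_ [h _]] s0 st; apply: h => //; rewrite in_itv/= andbT//.
exact: le_trans st.
Qed.

Lemma C_inc_unbounded w (M : R) : C_inc w -> exists2 t, 0 <= t & M < w t.
Proof.
move=> [_ [_ [_ [_ h]]]]; have [t0 [_ ht]] := (cvgryPgt _).1 h M.
exists (Num.max 0 (t0 + 1)); first by rewrite le_max lexx.
by apply: ht; rewrite lt_max ltrDl ltr01 orbT.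
Qed.

Lemma extE_ge w a (y : \bar R) : C_inc w -> 0 <= a -> (a%:E <= y)%E ->
  ((w a)%:E <= extE w y)%E.
Proof.
by move=> iw a0; case: y => [y| |] //=; rewrite ?leey// !lee_fin; exact: C_inc_homo.
Qed.

Lemma extE_le w b (y : \bar R) : C_inc w -> (0 <= y)%E -> (y <= b%:E)%E ->
  (extE w y <= (w b)%:E)%E.
Proof.
by move=> iw; case: y => [y| |] //=; rewrite !lee_fin; exact: C_inc_homo.
Qed.

Lemma extE_ge0 w (y : \bar R) : C_inc w -> (0 <= y)%E -> (0 <= extE w y)%E.
Proof.
by move=> iw; case: y => [y| |] //=; rewrite !lee_fin; exact: C_inc_ge0.
Qed.

(** Rough subadditivity gives integer factors by induction, monotonicity then any real one. This is
    how constants inside [w] are moved outside. *)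
Lemma C_inc_plus_dilate w (c : R) : C_inc_plus w -> 0 <= c ->
  exists2 C, 0 < C & forall t, 0 <= t -> w (c * t) <= C * w t.
Proof.
move=> [iw [A [A0 hA]]] c0.
have hn (n : nat) : exists2 C, 0 < C & forall t, 0 <= t -> w (n%:R * t) <= C * w t.
  elim: n => [|n [C C0 hC]].
    by exists 1 => // t t0; rewrite mul0r mul1r C_inc_0// C_inc_ge0.
  exists (A * (C + 1)); first by rewrite mulr_gt0// addr_gt0.
  move=> t t0; rewrite -natr1 mulrDl mul1r.
  have nt0 : 0 <= n%:R * t by rewrite mulr_ge0.
  rewrite (le_trans (hA _ _ nt0 t0))// -mulrA ler_wpM2l ?(ltW A0)//.
  by rewrite mulrDl mul1r lerD2r hC.
have [C C0 hC] := hn (Num.truncn c).+1.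
exists C => // t t0; apply: le_trans (hC t t0).
by apply: C_inc_homo => //; [exact: mulr_ge0|rewrite ler_wpM2r// ltW// truncnS_gt].
Qed.

End growth_functions.

Section nonlocal_functional.
Context {R : realType} {N : nat}.
Local Notation V := 'rV[R]_N.
Local Notation RN := (RN R N).
Variable mu : {measure set RN -> \bar R}.
Hypothesis hmu : is_lebesgue_RN mu.
Implicit Types (f rho : V -> R) (x h z : V) (w W : R -> R).

Definition increment_energy W f h : \bar R :=
  (\int[mu]_x (W (`|f (x + h) - f x| / enorm h))%:E)%E.

Definition mollified_energy rho w W f (eps : R) : \bar R :=
  (\int[mu]_h (((eps ^- N) * rho (eps^-1 *: (h : V)))%:E *
    extE w (increment_energy W f h)))%E.

Lemma increment_energy_ge0 W f h : C_inc W -> (0 <= increment_energy W f h)%E.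
Proof.
move=> iW; apply: integral_ge0 => x _; rewrite lee_fin; apply: C_inc_ge0 => //.
by rewrite divr_ge0// enorm_ge0.
Qed.

(* Also correct at [h = 0], where the quotients are all zero. *)
Lemma scaled_shift_normpE (p m : R) f h : 1 <= p -> 0 <= m -> mfun_RN f ->
  (\int[mu]_x (m * (`|f (x + h) - f x| / enorm h) `^ p)%:E =
   (m / enorm h `^ p)%:E * shift_normp mu p f h)%E.
Proof.
move=> p1 m0 mf; have p0 : 0 < p by rewrite (lt_le_trans ltr01).
have e0 := enorm_ge0 h.
have E : (enorm h)^-1 `^ p = (enorm h `^ p)^-1.
  have [->|en0] := eqVneq (enorm h) 0; first by rewrite invr0 powR0 ?gt_eqF// invr0.
  have eg : 0 < enorm h by rewrite lt_neqAle eq_sym en0.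
  apply: (@mulIf _ (enorm h `^ p)); first by rewrite gt_eqF// powR_gt0.
  by rewrite -powRM ?invr_ge0// !mulVf ?powR1// gt_eqF// powR_gt0.
have mF : measurable_fun [set: RN] (fun x : RN => (`|f (x + h) - f x| `^ p)%:E).
  apply/measurable_EFinP; apply: mfun_powR; apply: measurable_funB => //.
  exact: mfun_shift.
have F0 x : (0 <= (`|f (x + h) - f x| `^ p)%:E)%E by rewrite lee_fin powR_ge0.
have k0 : 0 <= m / enorm h `^ p by rewrite divr_ge0// powR_ge0.
have := @ge0_integralZl_EFin _ _ _ mu _ measurableT _ (fun x _ => F0 x) mF _ k0.
rewrite /shift_normp /normq => <-; apply: eq_integral => x _.
rewrite -EFinM powRM ?invr_ge0// E; congr (_%:E).
by move: (enorm h `^ p)^-1 (`|_| `^ p) => a b; ring.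
Qed.

Lemma increment_energy_le (p m : R) W f h : 1 <= p -> 0 <= m -> C_inc W -> Lp mu p f ->
  (forall t, 0 <= t -> W t <= m * t `^ p) ->
  (increment_energy W f h <= (m / enorm h `^ p)%:E * shift_normp mu p f h)%E.
Proof.
move=> p1 m0 iW [mf _] hW; rewrite -scaled_shift_normpE//.
have q0 x : 0 <= `|f (x + h) - f x| / enorm h by rewrite divr_ge0// enorm_ge0.
apply: le_integral_of_ge0 => x; rewrite lee_fin; [exact: C_inc_ge0|exact: hW].
Qed.

Lemma increment_energy_ge (p m : R) W f h : 1 <= p -> 0 <= m -> Lp mu p f ->
  (forall t, 0 <= t -> m * t `^ p <= W t) ->
  ((m / enorm h `^ p)%:E * shift_normp mu p f h <= increment_energy W f h)%E.
Proof.
move=> p1 m0 [mf _] hW; rewrite -scaled_shift_normpE//.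
have q0 x : 0 <= `|f (x + h) - f x| / enorm h by rewrite divr_ge0// enorm_ge0.
apply: le_integral_of_ge0 => x; rewrite lee_fin; last exact: hW.
by rewrite mulr_ge0// powR_ge0.
Qed.

(** Stated without unit mass, since it is also applied to the part of [rho] outside a set. *)
Lemma integral_mollifier (eps : R) rho : 0 < eps -> mfun_RN rho -> (forall x, 0 <= rho x) ->
  (\int[mu]_h ((eps ^- N) * rho (eps^-1 *: (h : V)))%:E = \int[mu]_h (rho h)%:E)%E.
Proof.
move=> e0 mrho rho0; have ei0 : 0 < eps^-1 by rewrite invr_gt0.
have mE : measurable_fun [set: RN] (fun x : RN => (rho x)%:E) by exact/measurable_EFinP.
have c0 : 0 <= eps ^- N by rewrite invr_ge0 exprn_ge0// ltW.
under eq_integral do rewrite EFinM.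
rewrite ge0_integralZl//; last by move=> x _; rewrite lee_fin.
- rewrite (@ge0_integral_dilate _ _ _ hmu _ (fun x => (rho x)%:E) ei0 mE)//.
  by rewrite muleA -EFinM exprVn invrK mulVf ?mul1e// gt_eqF// exprn_gt0.
- apply/measurable_EFinP; exact: (measurableT_comp mrho (measurable_scale_RN ei0)).
Qed.

Lemma mollified_energy_ge0 rho w W f (eps : R) : 0 < eps -> (forall x, 0 <= rho x) ->
  C_inc w -> C_inc W -> (0 <= mollified_energy rho w W f eps)%E.
Proof.
move=> e0 rho0 iw iW; apply: integral_ge0 => h _; apply: mule_ge0.
  by rewrite lee_fin mulr_ge0// invr_ge0 exprn_ge0// ltW.
by apply: extE_ge0 => //; exact: increment_energy_ge0.
Qed.

Lemma mollified_energy_le rho w W f (eps b : R) : 0 < eps -> mfun_RN rho ->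
  (forall x, 0 <= rho x) -> (\int[mu]_x (rho x)%:E = 1)%E ->
  C_inc w -> C_inc W -> 0 <= b -> (forall h, (increment_energy W f h <= b%:E)%E) ->
  (mollified_energy rho w W f eps <= (w b)%:E)%E.
Proof.
move=> e0 mrho rho0 rho1 iw iW b0 hb; have ei0 : 0 < eps^-1 by rewrite invr_gt0.
have wb0 := C_inc_ge0 iw b0.
have c0 h : 0 <= eps ^- N * rho (eps^-1 *: h).
  by rewrite mulr_ge0// invr_ge0 exprn_ge0// ltW.
apply: (@le_trans _ _ (\int[mu]_h ((w b)%:E * ((eps ^- N) * rho (eps^-1 *: (h : V)))%:E))%E).
  apply: le_integral_of_ge0 => h.
    by apply: mule_ge0; rewrite ?lee_fin//; apply: extE_ge0 => //; exact: increment_energy_ge0.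
  rewrite muleC; apply: lee_wpmul2r; first by rewrite lee_fin.
  by apply: extE_le => //; exact: increment_energy_ge0.
rewrite ge0_integralZl//; last by move=> x _; rewrite lee_fin.
- by rewrite integral_mollifier// rho1 mule1.
- apply/measurable_EFinP; apply: measurable_funM; first exact: measurable_cst.
  exact: (measurableT_comp mrho (measurable_scale_RN ei0)).
Qed.

Lemma BBM_quantity_le (p m2 : R) rho w W : 1 <= p -> 0 < m2 -> C_inc_plus w -> C_inc W ->
  (forall t, 0 <= t -> W t <= m2 * t `^ p) -> mfun_RN rho ->
  (forall x, 0 <= rho x) -> (\int[mu]_x (rho x)%:E = 1)%E ->
  exists2 C : R, 0 < C & forall f, Lp mu p f ->
    (BBM_quantity mu rho w W f <= C%:E * extE w (grad_norm_p mu p f))%E.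
Proof.
move=> p1 m20 cw iW hW mrho rho0 rho1; have [iw _] := cw.
have [C2 C20 hC2] := shift_normp_le_grad hmu p1.
have mC0 : 0 <= m2 * C2 by rewrite mulr_ge0// ltW.
have [C C0 hC] := C_inc_plus_dilate cw mC0.
exists C => // f Lf; have := grad_norm_p_ge0 mu p f; have := hC2 f Lf.
case: (grad_norm_p mu p f) => [G| |] //= hG; last first.
  by rewrite gt0_muley ?leey// lte_fin.
rewrite lee_fin => G0.
have hJ h : (increment_energy W f h <= (m2 * C2 * G)%:E)%E.
  apply: le_trans (increment_energy_le h p1 (ltW m20) iW Lf hW) _.
  have k0 : 0 <= m2 / enorm h `^ p by rewrite divr_ge0 ?powR_ge0// ltW.
  apply: le_trans (lee_wpmul2l _ (hG h)) _; first by rewrite lee_fin.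
  (* If [|h|^p = 0], the quotient [m2 / 0] is 0 and only a nonnegativity remains. *)
  rewrite -!EFinM lee_fin; have [->|e0] := eqVneq (enorm h `^ p) 0.
    by rewrite invr0 mulr0 mul0r mulr_ge0.
  rewrite le_eqVlt; apply/orP; left; apply/eqP; field; exact: e0.
apply: (@le_trans _ _ (w (m2 * C2 * G))%:E); last by rewrite lee_fin hC.
(* The bound is uniform in [eps], so the supremum over []0, 1[] already controls the upper limit. *)
apply: le_trans (ereal_inf_lbound _) _; first by exists 1 => //; rewrite /= in_itv/= ltr01.
apply: ge_ereal_sup => _ [e he <-].
have e0 : 0 < e by move: he; rewrite /= in_itv/= => /andP[].
by apply: mollified_energy_le => //; rewrite mulr_ge0.
Qed.

(** In the constant, [2 ^ p] comes from quasi-subadditivity, the factor 2 from the two points [z]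
    and [z'], and [N r / s] from [|z| <= N r] in the cube together with [eps = t / s]. *)
Lemma shift_normp_le_of_energy (p m1 r k s d S T : R) rho w W f (i : 'I_N) :
  1 <= p -> 0 < m1 -> C_inc w -> C_inc W ->
  (forall t, 0 <= t -> m1 * t `^ p <= W t) ->
  mfun_RN rho -> (forall x, 0 <= rho x) -> 0 <= r -> 0 < s ->
  (forall A : set RN, measurable A ->
    (\int[mu]_x (rho x * \1_(~` A) x)%:E <= k%:E)%E ->
    exists z z' : V, [/\ A z, A z', cube r z, cube r z' & z - z' = s *: evec R i]) ->
  Lp mu p f -> 0 <= T -> S < k * w (m1 * T) ->
  (forall eps, 0 < eps < d -> (mollified_energy rho w W f eps <= S%:E)%E) ->
  forall t, 0 < t < d * s ->
  (shift_normp mu p f (t *: evec R i) <=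
    (2 `^ p * (2 * (N%:R * r / s) `^ p) * T * t `^ p)%:E)%E.
Proof.
move=> p1 m10 iw iW hW mrho rho0 r0 s0 hA Lf T0 hS hE t /andP[t0 ts].
have [mf _] := Lf; have p0 : 0 <= p by rewrite (le_trans ler01).
pose eps := t / s; have e0 : 0 < eps by rewrite divr_gt0.
have ed : 0 < eps < d by rewrite e0/= ltr_pdivrMr.
(* By monotonicity of [w], the complement of [A] has [rho]-mass at most [S / w (m1 T)]. *)
pose A : set RN := [set z | (shift_normp mu p f (eps *: (z : V)) <=
  (T * enorm (eps *: (z : V)) `^ p)%:E)%E].
have mA : measurable A.
  rewrite -[A]setTI; apply: measurable_lee => //.
    exact: (measurableT_comp (measurable_shift_normp hmu p mf) (measurable_scale_RN e0)).
  apply/measurable_EFinP; apply: measurable_funM; first exact: measurable_cst.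
  apply: (measurableT_comp (measurable_powR p)).
  exact: (measurableT_comp mfun_enorm (measurable_scale_RN e0)).
have mT0 : 0 <= m1 * T by rewrite mulr_ge0// ltW.
have wT := C_inc_ge0 iw mT0.
pose u z : R := rho z * \1_(~` A) z.
have m_u : mfun_RN u.
  by apply: measurable_funM => //; apply: mfun_indic; exact: measurableC.
have u0 z : 0 <= u z by rewrite mulr_ge0// indicE.
have c0 : 0 <= eps ^- N by rewrite invr_ge0 exprn_ge0// ltW.
(* Chebyshev: at [h = eps z] with [z] outside [A] the inner integral is at least [m1 T]. Rescaling
   does not change the mass of [u]. *)
have I1 : ((w (m1 * T))%:E * \int[mu]_z (u z)%:E <= S%:E)%E.
  apply: le_trans (hE _ ed).
  rewrite -(integral_mollifier e0 m_u u0).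
  have ei0 : 0 < eps^-1 by rewrite invr_gt0.
  have mE : measurable_fun [set: RN] (fun h : RN => (eps ^- N * u (eps^-1 *: (h : V)))%:E).
    apply/measurable_EFinP; apply: measurable_funM; first exact: measurable_cst.
    exact: (measurableT_comp m_u (measurable_scale_RN ei0)).
  have E0 (h : RN) : (0 <= (eps ^- N * u (eps^-1 *: (h : V)))%:E)%E by rewrite lee_fin mulr_ge0.
  rewrite -(@ge0_integralZl_EFin _ _ _ mu _ measurableT _ (fun h _ => E0 h) mE _ wT).
  apply: le_integral_of_ge0 => h; first by apply: mule_ge0; rewrite ?E0.
  have [Ah|nAh] := pselect (A (eps^-1 *: h)).
    rewrite /u indicE memNset; last by apply.
    rewrite !mulr0 mule0; apply: mule_ge0; first by rewrite lee_fin mulr_ge0.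
    by apply: extE_ge0 => //; exact: increment_energy_ge0.
  rewrite /u indicE mem_set// mulr1 muleC.
  apply: lee_wpmul2l; first by rewrite lee_fin mulr_ge0.
  apply: extE_ge => //.
  move: nAh; rewrite /A /= scalerA divff ?gt_eqF// scale1r => /negP; rewrite -ltNge => Dh.
  (* The point 0 always belongs to [A], because the increment for [h = 0] vanishes; hence dividing
     by [|h|^p] is safe here. *)
  have eh : 0 < enorm h.
    rewrite lt_neqAle enorm_ge0 andbT eq_sym; apply/eqP => eh0; move: Dh.
    by rewrite (enorm_eq0 eh0) shift_normp0 ?(lt_le_trans ltr01)// lte_fin ltNge mulr_ge0// powR_ge0.
  have ehp : 0 < enorm h `^ p by rewrite powR_gt0.
  apply: le_trans (increment_energy_ge h p1 (ltW m10) Lf hW).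
  apply: le_trans (lee_wpmul2l _ (ltW Dh)); last by rewrite lee_fin divr_ge0// ltW.
  rewrite -EFinM lee_fin le_eqVlt; apply/orP; left; apply/eqP.
  by field; rewrite gt_eqF.
have [z [z' [Az Az' cz cz' zz]]] : exists z z' : V,
    [/\ A z, A z', cube r z, cube r z' & z - z' = s *: evec R i].
  apply: hA => //; rewrite leNgt; apply/negP => hk.
  have := lee_wpmul2l _ (ltW hk) => /(_ (w (m1 * T))%:E); rewrite lee_fin => /(_ wT) h1.
  have := le_trans h1 I1; rewrite -EFinM lee_fin mulrC leNgt.
  by rewrite hS.
have -> : t *: evec R i = eps *: z + - (eps *: z').
  by rewrite -scalerBr zz scalerA /eps -mulrA mulVf ?mulr1// gt_eqF.
have bound (y : V) : A y -> cube r y ->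
    (shift_normp mu p f (eps *: y) <= (T * ((N%:R * r / s) `^ p * t `^ p))%:E)%E.
  move=> Ay cy; apply: le_trans Ay _; rewrite lee_fin ler_wpM2l//.
  have Nr : 0 <= N%:R * r / s by rewrite divr_ge0 ?mulr_ge0// ltW.
  rewrite -powRM ?(ltW t0)//; apply: powR_le => //; first exact: enorm_ge0.
  rewrite enormZ ?(ltW e0)//.
  have -> : N%:R * r / s * t = eps * (N%:R * r) by rewrite /eps; field; rewrite gt_eqF.
  by rewrite ler_wpM2l ?(ltW e0)// enorm_le//; apply/cubeP.
apply: le_trans (shift_normpD hmu _ _ p1 mf) _.
rewrite shift_normpN//.
apply: le_trans (lee_wpmul2l _ (leeD (bound _ Az cz) (bound _ Az' cz'))) _.
  by rewrite lee_fin powR_ge0.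
rewrite -EFinD -EFinM lee_fin le_eqVlt; apply/orP; left; apply/eqP.
by move: (2 `^ p) (_ `^ p) (t `^ p) => a b c; ring.
Qed.

Lemma BBM_quantity_ge (p m1 : R) rho w W : (1 <= N)%N -> 1 <= p -> 0 < m1 ->
  C_inc_plus w -> C_inc W -> (forall t, 0 <= t -> m1 * t `^ p <= W t) -> mfun_RN rho ->
  (forall x, 0 <= rho x) -> (\int[mu]_x (rho x)%:E = 1)%E ->
  exists2 c : R, 0 < c & forall f, Lp mu p f ->
    (c%:E * extE w (grad_norm_p mu p f) <= BBM_quantity mu rho w W f)%E.
Proof.
move=> N1 p1 m10 cw iW hW mrho rho0 rho1; have [iw _] := cw.
have [r [k [r0 k0 hst]]] := steinhaus hmu mrho rho0 rho1.
have /choice[s hs] : forall i : 'I_N, exists s : R, 0 < s /\ forall A : set RN, measurable A ->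
      (\int[mu]_x (rho x * \1_(~` A) x)%:E <= k%:E)%E ->
      exists z z' : V, [/\ A z, A z', cube r z, cube r z' & z - z' = s *: evec R i].
  by move=> i; have [s s0 h] := hst i; exists s.
pose b i : R := 2 `^ p * (2 * (N%:R * r / s i) `^ p).
have b0 i : 0 <= b i by rewrite !mulr_ge0// powR_ge0.
(* A single positive constant above all the [b i], since [s i] depends on the direction. *)
pose C0 : R := \sum_(i < N) b i + 1.
have bC0 i : b i <= C0.
  by rewrite /C0 (bigD1 i)//= -addrA lerDl addr_ge0// sumr_ge0.
have C00 : 0 < C0 by rewrite ltr_pwDr// sumr_ge0.
have [C1 C10 hC1] := grad_le_of_shift_normp hmu p1 N1.
pose D := C1 * C0; have D0 : 0 < D by rewrite mulr_gt0.
(* Chosen so that [T = G / (2 D)] gives [m1 T = lam G]. *)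
pose lam := m1 / (2 * D); have lam0 : 0 < lam by rewrite divr_gt0// mulr_gt0.
have li0 : 0 <= lam^-1 by rewrite invr_ge0 ltW.
have [C' C'0 hC'] := C_inc_plus_dilate cw li0.
exists (k / C'); first by rewrite divr_gt0.
move=> f Lf; apply: le_ereal_inf_tmp => _ [d hd <-].
have d0 : 0 < d by move: hd; rewrite /= in_itv/= andbT.
rewrite -[X in ereal_sup (image _ X)]/(mollified_energy rho w W f).
set U := ereal_sup _.
have hU eps : 0 < eps < d -> (mollified_energy rho w W f eps <= U)%E.
  by move=> hd'; apply: ereal_sup_ubound; exists eps => //; rewrite /= in_itv.
(* One admissible [eps] is needed to know that the supremum [U] is nonnegative. *)
have d2 : 0 < d / 2 < d by rewrite divr_gt0//= ltr_pdivrMr// ltr_pMr// ltr1n.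
have U0 : (0 <= U)%E.
  apply: le_trans (hU _ d2); apply: mollified_energy_ge0 => //.
  by move: d2 => /andP[].
move: U U0 hU => [S| |] // S0 hS; last by rewrite leey.
rewrite lee_fin in S0.
have key T : 0 <= T -> S < k * w (m1 * T) -> (grad_norm_p mu p f <= (D * T)%:E)%E.
  move=> T0 hT; rewrite /D -mulrA; apply: hC1 => //; first by rewrite mulr_ge0// ltW.
  move=> i; have [s0 hsi] := hs i; exists (d * s i); first by rewrite mulr_gt0.
  move=> t td.
  apply: le_trans (shift_normp_le_of_energy p1 m10 iw iW hW mrho rho0 r0 s0 hsi Lf T0 hT hS td) _.
  by rewrite lee_fin ler_wpM2r ?powR_ge0// ler_wpM2r// bC0.
(* First use of [key], at [T = a / m1]: it shows that [G] is finite, after which [T] may depend on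
   [G]. *)
have [a a0 ha] := C_inc_unbounded (S / k) iw.
have G0 := grad_norm_p_ge0 mu p f.
have am : 0 <= a / m1 by rewrite divr_ge0// ltW.
have := key _ am; rewrite [m1 * _]mulrCA divff ?gt_eqF// mulr1 mulrC -ltr_pdivrMr// => /(_ ha).
move: key; case: (grad_norm_p mu p f) G0 => [G| |] // G0 key _ /=.
rewrite lee_fin in G0.
have hl : w (lam * G) <= S / k.
  (* Otherwise [key] at [T = G / (2 D)] yields [G <= G / 2], hence [G = 0]; but [w 0 = 0] cannot
     exceed [S / k], which is nonnegative. *)
  rewrite leNgt; apply/negP => hlt.
  have GD : 0 <= G / (2 * D) by rewrite divr_ge0// mulr_ge0// ltW.
  have E1 : m1 * (G / (2 * D)) = lam * G by rewrite /lam; field; rewrite gt_eqF.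
  have := key _ GD; rewrite E1 mulrC -ltr_pdivrMr// => /(_ hlt).
  have -> : D * (G / (2 * D)) = G / 2 by field; rewrite gt_eqF.
  rewrite lee_fin => hG.
  have GE0 : G = 0 by apply/eqP; rewrite eq_le G0 andbT; move: hG; lra.
  by move: hlt; rewrite GE0 mulr0 C_inc_0// ltNge divr_ge0// ltW.
have lG : 0 <= lam * G by rewrite mulr_ge0// ltW.
have := hC' _ lG; rewrite mulrA mulVf ?gt_eqF// mul1r => hw.
rewrite lee_fin; apply: (@le_trans _ _ (k / C' * (C' * (S / k)))).
  apply: ler_wpM2l; first by rewrite divr_ge0// ltW.
  by apply: le_trans hw _; rewrite ler_wpM2l// ltW.
by rewrite le_eqVlt; apply/orP; left; apply/eqP; field; rewrite !gt_eqF.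
Qed.

(** For [p > 1] the convention [+oo] outside the Sobolev space is the infimum of the empty set;
    conversely the components of a weak gradient lie in L^p, so its energy is finite. *)
Lemma cond_iP (p : R) f : 1 <= p -> (1 <= N)%N -> cond_i mu p f <-> (grad_norm_p mu p f < +oo)%E.
Proof.
move=> p1 N1; rewrite /cond_i /grad_norm_p; case: ifP => // _; split.
  move=> [g wg]; apply: le_lt_trans (ereal_inf_lbound _) _.
    by exists g; [exact: wg|reflexivity].
  have ig i := Lp_itg (proj1 wg i).
  have i1 : itg mu (fun x => N%:R `^ p * \sum_(i < N) `|g i x| `^ p).
    apply: itgZ; apply: itg_sum => i; exact: ig.
  apply: le_lt_trans (_ : \int[mu]_x (N%:R `^ p * \sum_(i < N) `|g i x| `^ p)%:E < +oo)%E.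
    apply: le_integral_of_ge0 => x; first by rewrite lee_fin powR_ge0.
    rewrite lee_fin (le_trans (enorm_powR_le _ p1 N1))//.
    by rewrite ler_wpM2l ?powR_ge0//; apply: ler_sum => i _; rewrite mxE.
  by rewrite -(EFin_Rint i1) ltry.
move=> h; apply: contrapT => nW; move: h.
rewrite (_ : [set g | weak_gradient mu p f g] = set0) ?image_set0 ?ereal_inf0//.
by apply/seteqP; split => // g wg; apply: nW; exists g.
Qed.

End nonlocal_functional.

Theorem theorem2p6 (R : realType) (N : nat) (hN : (1 <= N)%N)
  (mu : {measure set RN R N -> \bar R}) (hmu : is_lebesgue_RN mu)
  (p : R) (hp : 1 <= p)
  (w W : R -> R) (hw : C_inc_plus w) (hW : C_inc W)
  (m1 m2 : R) (hm1 : 0 < m1) (hm12 : m1 <= m2)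
  (hWp : forall t, 0 <= t -> m1 * t `^ p <= W t /\ W t <= m2 * t `^ p)
  (rho : 'rV[R]_N -> R)
  (hrho_meas : measurable_fun [set: RN R N] (rho : RN R N -> R))
  (hrho_ge0 : forall h, 0 <= rho h)
  (hrho_int : (\int[mu]_h (rho h)%:E = 1)%E)
  (hrho_rad : forall h k, enorm h = enorm k -> rho h = rho k) :
  (forall f, Lp mu p f -> (cond_i mu p f <-> (BBM_quantity mu rho w W f < +oo)%E)) /\
  exists c C : R, 0 < c /\ c <= C /\
    forall f, Lp mu p f ->
      (c%:E * extE w (grad_norm_p mu p f) <= BBM_quantity mu rho w W f)%E /\
      (BBM_quantity mu rho w W f <= C%:E * extE w (grad_norm_p mu p f))%E.
Proof.
have [c c0 hc] := BBM_quantity_ge hmu hN hp hm1 hw hW (fun t t0 => proj1 (hWp t t0))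
  hrho_meas hrho_ge0 hrho_int.
have [C C0 hC] := BBM_quantity_le hmu hp (lt_le_trans hm1 hm12) hw hW
  (fun t t0 => proj2 (hWp t t0)) hrho_meas hrho_ge0 hrho_int.
have [iw _] := hw.
split.
  move=> f Lf; have := hc f Lf; have := hC f Lf; have := grad_norm_p_ge0 mu p f.
  rewrite (cond_iP mu f hp hN); case: (grad_norm_p mu p f) => [G| |] //= G0 h1 h2.
    by split => _; [exact: le_lt_trans h1 (ltry _)|exact: ltry].
  (* If the gradient is infinite, the lower bound with [c > 0] forces the functional to be
     infinite. *)
  by move: h2; rewrite gt0_muley ?lte_fin// leye_eq => /eqP ->.
exists c, (Num.max c C); split => //; split; first by rewrite le_max lexx.
move=> f Lf; split; first exact: hc.
apply: le_trans (hC f Lf) _; apply: lee_wpmul2r; last by rewrite lee_fin le_max lexx orbT.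
by apply: extE_ge0 => //; exact: grad_norm_p_ge0.
Qed.
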